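(* Let $\{D_\Lambda,\psi_\Lambda,g_\Lambda\}$ be the smooth family of domains, steady flows and area-preserving diffeomorphisms described in the context, let $\Phi^\star$ be the associated natural connection form, and let $$\kappa := {\bf d}\Phi^\star+\tfrac12[\Phi^\star\wedge\Phi^\star]$$ be its curvature (with ${\bf d}$ taken at fixed $\boldsymbol{x}$). Then $\kappa$ depends on position $\boldsymbol{x}\in D_\Lambda$ only through the action $I$, i.e. $\kappa=\kappa(I;\Lambda)$. Moreover, for a closed curve $C_\Lambda$ in the parameter space $\mathcal{L}$ bounding a two-dimensional surface $\mathcal{S}_\Lambda\subset\mathcal{L}$, the (leading-order) geometric angle of a fluid particle with action $I$ caused by the slow deformation of the boundary along $C_\Lambda$, namely $$\Delta\theta_{\rm geo}=\frac{\partial}{\partial I}\oint_{C_\Lambda}\bigl\langle \hat\Psi^{(1)}+{\bf d}\hat S-X\,{\bf d}Y\bigr\rangle ,$$ is given by $$\Delta\theta_{\rm geo}=\frac{{\rm d}}{{\rm d}I}\int_{\mathcal{S}_\Lambda}\kappa .$$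
   Context: All objects are assumed smooth. $\mathcal{L}$ is a parameter space (a manifold, with coordinates $\Lambda=(\Lambda_m)$; a neighbourhood of $\Lambda=0$ suffices), ${\bf d}$ is the exterior derivative in $\mathcal{L}$. For functions on the plane, $[f,g]=\partial_xf\,\partial_yg-\partial_xg\,\partial_yf$ and $\nabla^\perp f=(-\partial_yf,\partial_xf)$. For function-valued one-forms $\alpha=\alpha_m{\bf d}\Lambda_m$, $\gamma=\gamma_n{\bf d}\Lambda_n$ on $\mathcal{L}$, $[\alpha\wedge\gamma]=[\alpha_m,\gamma_n]\,{\bf d}\Lambda_m\wedge{\bf d}\Lambda_n$ (sum over $m,n$). Family of flows. For each $\Lambda\in\mathcal{L}$, $D_\Lambda\subset\mathbb{R}^2$ is a bounded simply-connected domain of fixed area with boundary $\{B(\boldsymbol{x};\Lambda)=0\}$, $\nabla B\neq0$ there. The flow $\psi_\Lambda$ on $D_\Lambda$ has $\psi_\Lambda=0$ on $\partial D_\Lambda$, vorticity $\omega_\Lambda=\Delta\psi_\Lambda$, and is steady: $\psi_\Lambda=G_\Lambda(\omega_\Lambda)$, $\omega_\Lambda=F_\Lambda(\psi_\Lambda)$ with $F_\Lambda=G_\Lambda^{-1}$; $F_\Lambda'$ denotes $F_\Lambda'\circ\psi_\Lambda$. There are area-preserving diffeomorphisms $g_\Lambda:D_0\to D_\Lambda$, depending smoothly on $\Lambda$, with $g_0=\mathrm{id}$ and $\omega_\Lambda=\omega_0\circ g_\Lambda^{-1}$. Each $\psi_\Lambda$ satisfies: (H1) $\psi_\Lambda$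 has only one critical point in $D_\Lambda$ (elliptic), and there are constants such that either $0<c_1\le G_\Lambda'\le c_2<\infty$, or $0<1/c_{\rm poi}<c_1\le -G_\Lambda'\le c_2<\infty$, where $c_{\rm poi}$ is the smallest eigenvalue of $-\Delta$ on $D_\Lambda$ with Dirichlet boundary conditions. (H2) there is $c_\psi>0$ with $\oint_{\psi_\Lambda=c}{\rm d}s\le1/c_\psi$ for all values $c$ of $\psi_\Lambda$, where ${\rm d}s={\rm d}l/|\nabla\psi_\Lambda|$, ${\rm d}l$ being arclength. Projection. $\mathsf{P}_\Lambda u:=u-\{\oint_{\psi_\Lambda=c}u\,{\rm d}s\}/\{\oint_{\psi_\Lambda=c}{\rm d}s\}$, so that $(1-\mathsf{P}_\Lambda)u$ is the average of $u$ along the streamline through the point. Forms. The one-form $\Phi$ on $\mathcal{L}$ with values in functions on $D_\Lambda$ is defined by ${\bf d}g_\Lambda=\nabla^\perp\Phi\circ g_\Lambda$. The boundary one-form $\boldsymbol\beta$, with values in functions on $\partial D_\Lambda$, is defined by ${\bf d}B+[\boldsymbol\beta,B]=0$ on $\partial D_\Lambda$ and $\oint_{\partial D_\Lambda}\boldsymbol\beta\,{\rm d}l=0$. The additive constant (in $\boldsymbol{x}$) in $\Phi$ is chosen so that $\Phi=\boldsymbol\beta$ on $\partial D_\Lambda$. The one-form $\Psi^{(1)}$ (first-order correction to the flow, $\psi=\psi_\Lambda+\varepsilon\Psi^{(1)}\cdot\dot\Lambda+\cdots$ when $\Lambda=\Lambda(\varepsilon t)$, $\dot\Lambda$ being the derivative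 with respect to $\tau=\varepsilon t$) is the unique solution of $$(\Delta-F_\Lambda'\mathsf{P}_\Lambda)\Psi^{(1)}=-F_\Lambda'\mathsf{P}_\Lambda\Phi\ \text{ in }D_\Lambda,\qquad \Psi^{(1)}=\boldsymbol\beta\ \text{ on }\partial D_\Lambda .$$ The natural connection form is $\Phi^\star:=\mathsf{P}_\Lambda\Phi+(1-\mathsf{P}_\Lambda)\Psi^{(1)}$. Action-angle variables. $I=\frac1{2\pi}\times$(area enclosed by the contour of $\psi_\Lambda$ through the point), and $\theta$ is a $2\pi$-periodic variable with $[I,\theta]=1$. The transformation $(I,\theta)\mapsto \boldsymbol{X}=(X,Y)(I,\theta;\Lambda)$ is fixed by $\boldsymbol{X}(I,\theta;\Lambda)=g_\Lambda\boldsymbol{X}(I,\theta;0)$. It has generating function $S(I,y;\Lambda)$ with $x=\partial S/\partial y$, $\theta=\partial S/\partial I$, and $\hat S(I,\theta;\Lambda)=S(I,Y(I,\theta;\Lambda);\Lambda)$; although $\hat S$ is multivalued in $\theta$, ${\bf d}\hat S$ is single-valued. A hat denotes a quantity expressed in $(I,\theta)$, e.g. $\hat\Psi^{(1)}(I,\theta;\Lambda)=\Psi^{(1)}(\boldsymbol{X}(I,\theta;\Lambda);\Lambda)$; in $\Delta\theta_{\rm geo}$, ${\bf d}$ acts at fixed $(I,\theta)$. $\langle f\rangle=\frac1{2\pi}\int_0^{2\pi}f\,{\rm d}\theta$. Geometric angle. Particles obey $\dot x=-\partial_y\psi$, $\dot y=\partial_x\psi$ with $\psi=\psi_\Lambda+\varepsilon\Psi^{(1)}\cdot\dot\Lambda$;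 in action-angle variables $\frac{{\rm d}\theta}{{\rm d}t}=\partial_I\hat\psi_\Lambda(I)+\varepsilon\,\partial_I\{\hat\Psi^{(1)}+{\bf d}\hat S-X{\bf d}Y\}\cdot\dot\Lambda$. The first term gives the dynamic phase; the remaining terms, averaged over $\theta$ and with $I$ frozen (leading order as $\varepsilon\to0$), give the geometric angle displayed in the claim. *)

(* Defs.v *)
From HB Require Import structures.
From mathcomp Require Import all_boot all_order all_algebra.
From mathcomp Require Import all_classical all_reals all_analysis.

Set Implicit Arguments.
Unset Strict Implicit.
Unset Printing Implicit Defensive.
Import Order.TTheory GRing.Theory Num.Theory numFieldNormedType.Exports.
Local Open Scope classical_set_scope.
Local Open Scope ring_scope.

(* Conventions.  Points of the plane are pairs [(x, y) : R * R]; the parameter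
   space is an open set [L] of ['rV[R]_n], i.e. a coordinate chart, and the
   parameter is always the first argument of a function.  A one-form on [L] is
   given by its components [a lam m], a two-form w by its antisymmetric array
   [w lam m k], with w = sum_(m < k) w_mk dLam_m /\ dLam_k.                     *)

Section Smoothness.
Context {R : realType}.

Fixpoint Ck (k : nat) (E F : normedModType R) (U : set E) (f : E -> F) : Prop :=
  match k with
  | 0 => forall x, U x -> {for x, continuous f}
  | k'.+1 => (forall x, U x -> differentiable f x) /\
             forall v : E, Ck k' U (fun x => 'D_v f x)
  end.

(* Meant for open [U]. *)
Definition smooth_on (E F : normedModType R) (U : set E) (f : E -> F) : Prop :=
  forall k, Ck k U f.

(* Smoothness up to the boundary: [f] is a smooth extension to a neighbourhood
   of [A] of the function of interest. *)
Definition smooth_near (E F : normedModType R) (A : set E) (f : E -> F) : Prop :=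
  exists U : set E, [/\ open U, A `<=` U & smooth_on U f].

End Smoothness.

Section PlaneCalculus.
Context {R : realType}.
Implicit Types (f u psi : R * R -> R) (v x : R * R) (D C : set (R * R)).

Definition dx f x : R := 'D_((1, 0) : R * R) f x.
Definition dy f x : R := 'D_((0, 1) : R * R) f x.
Definition grad f x : R * R := (dx f x, dy f x).
Definition nperp f x : R * R := (- dy f x, dx f x).
Definition bracket f u x : R := dx f x * dy u x - dx u x * dy f x.
Definition laplacian f x : R := dx (dx f) x + dy (dy f) x.
Definition hessian_det f x : R :=
  dx (dx f) x * dy (dy f) x - dx (dy f) x * dy (dx f) x.

(* Euclidean norm; the norm [`|v|] of the product type is the sup norm. *)
Definition enorm v : R := Num.sqrt (v.1 ^+ 2 + v.2 ^+ 2).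

Definition area D : \bar R := (lebesgue_measure \x lebesgue_measure)%E D.

Definition boundary D : set (R * R) := closure D `\` interior D.

(* Simple connectedness as in Ahlfors: the complement in the extended plane is
   connected; as [D] is bounded, this says that [~` D] is connected. *)
Definition bounded_simply_connected_domain D : Prop :=
  [/\ open D, D !=set0, connected D, bounded_set D & connected (~` D)].

(* The points surrounded by [C]: those of the bounded components of [~` C]. *)
Definition enclosed C : set (R * R) :=
  [set x | ~ C x /\ bounded_set (connected_component (~` C) x)].

Definition closed_curve_param C (c : R -> R * R) : Prop :=
  [/\ Ck 1 setT c,
      forall t, c (t + 1) = c t,
      forall t, 'D_1 c t != 0,
      {in `[0, 1[ &, injective c}
    & range c = C].

(* The integral of [u] over the simple closed curve [C] with respect to
   arclength; it does not depend on the parametrization that is picked. *)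
Definition arclength_integral C u : R :=
  let c := xget (cst 0) [set c | closed_curve_param C c] in
  \int[lebesgue_measure]_(t in `[0, 1]) (u (c t) * enorm ('D_1 c t)).

Definition streamline D psi x : set (R * R) := [set y | D y /\ psi y = psi x].

(* Integral of [u ds], ds = dl / |grad psi|, over the streamline through [x]. *)
Definition streamline_integral D psi u x : R :=
  arclength_integral (streamline D psi x) (fun y => u y / enorm (grad psi y)).

(* 1 - P.  At the critical point of [psi] the streamline is a single point. *)
Definition average D psi u x : R :=
  if grad psi x == 0 then u x
  else streamline_integral D psi u x / streamline_integral D psi (cst 1) x.

Definition proj D psi u x : R := u x - average D psi u x.

Definition action D psi x : R :=
  fine (area (enclosed (streamline D psi x))) / (2 * pi).

Definition dirichlet_eigenvalue D (c : R) : Prop :=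
  exists u, [/\ smooth_near (closure D) u,
                exists2 x, D x & u x != 0,
                forall x, D x -> - laplacian u x = c * u x
              & forall x, boundary D x -> u x = 0].

Definition first_dirichlet_eigenvalue D (c : R) : Prop :=
  dirichlet_eigenvalue D c /\ forall c', dirichlet_eigenvalue D c' -> c <= c'.

(* [G] is the function with psi = G o omega, where omega = laplacian psi; the
   critical point is elliptic when the Hessian determinant is positive. *)
Definition elliptic_stable D psi (G : R -> R) : Prop :=
  (exists x0, [/\ D x0, grad psi x0 = 0, 0 < hessian_det psi x0
                & forall x, D x -> grad psi x = 0 -> x = x0]) /\
  exists c1 c2 : R,
    (0 < c1 /\
       forall x, D x -> c1 <= derive1 G (laplacian psi x) <= c2) \/
    (exists cpoi : R, [/\ first_dirichlet_eigenvalue D cpoi,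
                          0 < 1 / cpoi, 1 / cpoi < c1
       & forall x, D x -> c1 <= - derive1 G (laplacian psi x) <= c2]).

Definition bounded_periods D psi : Prop :=
  exists2 cpsi : R, 0 < cpsi &
    forall x, D x -> streamline_integral D psi (cst 1) x <= 1 / cpsi.

End PlaneCalculus.

Section Family.
Context {R : realType} {n : nat}.
Local Notation param := 'rV[R]_n.
Local Notation plane := (R * R)%type.
Implicit Types (L : set param) (D : param -> set plane).
Implicit Types (B psi S : param -> plane -> R) (G F : param -> R -> R).
Implicit Types (g ginv X : param -> plane -> plane).
Implicit Types (alpha gamma Phi beta Psi : param -> 'I_n -> plane -> R).

Definition dpar (V : normedModType R) (f : param -> V) (m : 'I_n) (lam : param) : V :=
  'D_(delta_mx 0 m : param) f lam.

Definition family_set L (A : param -> set plane) : set (param * plane) :=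
  [set p | L p.1 /\ A p.1 p.2].

Definition curry2 (T U V : Type) (f : T -> U -> V) (p : T * U) : V := f p.1 p.2.

Definition domain_family L D B : Prop :=
  [/\ forall lam, L lam -> bounded_simply_connected_domain (D lam),
      forall lam, L lam -> area (D lam) = area (D 0),
      smooth_on (family_set L (fun=> setT)) (curry2 B),
      forall lam, L lam -> boundary (D lam) = [set x | B lam x = 0]
    & forall lam x, L lam -> boundary (D lam) x -> grad (B lam) x != 0].

Definition steady_family L D psi G F : Prop :=
  [/\ smooth_near (family_set L (fun lam => closure (D lam))) (curry2 psi),
      smooth_near [set p : param * R | L p.1 /\
        exists2 x, closure (D p.1) x & laplacian (psi p.1) x = p.2] (curry2 G),
      smooth_near [set p : param * R | L p.1 /\
        exists2 x, closure (D p.1) x & psi p.1 x = p.2] (curry2 F),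
      forall lam x, L lam -> boundary (D lam) x -> psi lam x = 0
    & forall lam x, L lam -> closure (D lam) x ->
        psi lam x = G lam (laplacian (psi lam) x) /\
        laplacian (psi lam) x = F lam (psi lam x)].

Definition diffeo_family L D g ginv : Prop :=
  [/\ smooth_near (family_set L (fun=> closure (D 0))) (curry2 g),
      smooth_near (family_set L (fun lam => closure (D lam))) (curry2 ginv),
      forall x, D 0 x -> g 0 x = x,
      forall lam, L lam ->
        [/\ forall x, D 0 x -> D lam (g lam x) /\ ginv lam (g lam x) = x
          & forall y, D lam y -> D 0 (ginv lam y) /\ g lam (ginv lam y) = y]
    & forall lam (A : set plane), L lam -> measurable A -> A `<=` D 0 ->
        area (g lam @` A) = area A].

Definition vorticity_transported L D psi ginv : Prop :=
  forall lam x, L lam -> D lam x ->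
    laplacian (psi lam) x = laplacian (psi 0) (ginv lam x).

Definition generator_form L D g Phi : Prop :=
  smooth_near (family_set L (fun lam => closure (D lam)))
    (fun p => \row_m Phi p.1 m p.2) /\
  forall lam m x, L lam -> D 0 x ->
    dpar (g ^~ x) m lam = nperp (Phi lam m) (g lam x).

(* [beta] is only meaningful on the boundary: there, [B] being constant, the
   bracket is a tangential derivative of [beta lam m] and so is independent of
   the values of [beta] off the boundary. *)
Definition boundary_form L D B beta : Prop :=
  [/\ smooth_near (family_set L (fun lam => boundary (D lam)))
        (fun p => \row_m beta p.1 m p.2),
      forall lam m x, L lam -> boundary (D lam) x ->
        dpar (B ^~ x) m lam + bracket (beta lam m) (B lam) x = 0
    & forall lam m, L lam ->
        arclength_integral (boundary (D lam)) (beta lam m) = 0].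

Definition first_order_form L D psi F Phi beta Psi : Prop :=
  [/\ smooth_near (family_set L (fun lam => closure (D lam)))
        (fun p => \row_m Psi p.1 m p.2),
      forall lam m x, L lam -> D lam x ->
        let F' := derive1 (F lam) (psi lam x) in
        let P := proj (D lam) (psi lam) in
        laplacian (Psi lam m) x - F' * P (Psi lam m) x = - F' * P (Phi lam m) x
    & forall lam m x, L lam -> boundary (D lam) x -> Psi lam m x = beta lam m x].

Definition natural_form D psi Phi Psi : param -> 'I_n -> plane -> R :=
  fun lam m x =>
    proj (D lam) (psi lam) (Phi lam m) x + average (D lam) (psi lam) (Psi lam m) x.

(* Components of [d alpha], at fixed x, and of [alpha /\ gamma] with the bracket. *)
Definition dform alpha : param -> 'I_n -> 'I_n -> plane -> R :=
  fun lam m k x =>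
    dpar (fun l => alpha l k x) m lam - dpar (fun l => alpha l m x) k lam.

Definition wedge_bracket alpha gamma : param -> 'I_n -> 'I_n -> plane -> R :=
  fun lam m k x => bracket (alpha lam m) (gamma lam k) x
                 - bracket (alpha lam k) (gamma lam m) x.

Definition curvature alpha : param -> 'I_n -> 'I_n -> plane -> R :=
  fun lam m k x => dform alpha lam m k x + 2^-1 * wedge_bracket alpha alpha lam m k x.

(* All the domains [D lam] have the area of [D 0]. *)
Definition action_max D : R := fine (area (D 0)) / (2 * pi).

Definition action_angle_set D : set plane :=
  [set p | 0 < p.1 < action_max D].

(* [X lam (I, th)] is the point with action [I] and angle [th].  The angle is
   2 pi-periodic, so the bracket [I, theta] is that of a local branch. *)
Definition action_angle L D psi g X : Prop :=
  let I := fun lam => action (D lam) (psi lam) in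
  let D' := fun lam => [set x | D lam x /\ grad (psi lam) x != 0] in
  [/\ smooth_on (family_set L D') (curry2 I)
      /\ smooth_on (family_set L (fun=> action_angle_set D)) (curry2 X),
      forall lam p, L lam -> action_angle_set D p ->
        [/\ D lam (X lam p), I lam (X lam p) = p.1 & X lam p = g lam (X 0 p)],
      forall lam x, L lam -> D' lam x ->
        0 < I lam x < action_max D /\ exists th, X lam (I lam x, th) = x,
      forall lam J th th', L lam -> 0 < J < action_max D ->
        X lam (J, th) = X lam (J, th') <-> exists j : int, th' = th + j%:~R * (2 * pi)
    & forall lam x th0, L lam -> D' lam x -> X lam (I lam x, th0) = x ->
        exists th : plane -> R, exists U : set plane,
          [/\ open U /\ U x, U `<=` D' lam, smooth_on U th, th x = th0
            & forall y, U y ->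
                X lam (I lam y, th y) = y /\ bracket (I lam) th y = 1]].

(* [Shat] is the generating function in the variables (I, theta), theta in R.
   Where (I, y) are local coordinates, dY/dtheta != 0, it is given by a smooth
   branch [S lam (I, y)] of the multivalued generating function, with
   dS/dI = theta and dS/dy = x.  At the folds dY/dtheta = 0 the branches of [S]
   are not differentiable; there these two relations are continued in the form
   dShat = theta dI + X dY (at fixed lam). *)
Definition generating_function L D X (Shat : param -> plane -> R) : Prop :=
  let Y := fun lam p => (X lam p).2 in
  [/\ smooth_on (family_set L (fun=> action_angle_set D)) (curry2 Shat),
      forall lam0 p0, L lam0 -> action_angle_set D p0 -> dy (Y lam0) p0 != 0 ->
        exists S, exists U : set (param * plane),
          smooth_near [set q | exists2 lp, U lp & q = (lp.1, (lp.2.1, Y lp.1 lp.2))]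
            (curry2 S) /\
          [/\ open U, U (lam0, p0), U `<=` family_set L (fun=> action_angle_set D)
            & forall lam p, U (lam, p) ->
                [/\ Shat lam p = S lam (p.1, Y lam p),
                    dx (S lam) (p.1, Y lam p) = p.2
                  & dy (S lam) (p.1, Y lam p) = (X lam p).1]]
    & forall lam p, L lam -> action_angle_set D p -> dy (Y lam) p = 0 ->
        dx (Shat lam) p = p.2 + (X lam p).1 * dx (Y lam) p /\
        dy (Shat lam) p = (X lam p).1 * dy (Y lam) p].

Definition angle_mean (f : R -> R) : R :=
  (2 * pi)^-1 * \int[lebesgue_measure]_(th in `[0, 2 * pi]) f th.

(* The one-form < Psihat + d Shat - X dY > on the parameter space, at fixed I. *)
Definition mean_angle_form Psi X (Shat : param -> plane -> R) (I : R) :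
    param -> 'I_n -> R :=
  fun lam m => angle_mean (fun th =>
    Psi lam m (X lam (I, th))
    + dpar (Shat ^~ (I, th)) m lam
    - (X lam (I, th)).1 * dpar (fun l => (X l (I, th)).2) m lam).

End Family.

Section Chains.
Context {R : realType} {n : nat}.
Local Notation param := 'rV[R]_n.
Implicit Types (L : set param).

Definition unit_square : set (R * R) := [set p | 0 <= p.1 <= 1 /\ 0 <= p.2 <= 1].

(* A closed curve is a cyclic sequence of smooth arcs parametrized by [0, 1]. *)
Definition closed_curve L k (C : 'I_k -> R -> param) : Prop :=
  forall i, [/\ smooth_near [set t : R | 0 <= t <= 1] (C i),
                forall t, 0 <= t <= 1 -> L (C i t)
              & C i 1 = C (ordS i) 0].

(* A surface is cut into smooth patches parametrized by the unit square; patches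
   may be degenerate, e.g. polar coordinates parametrize a disc by one patch. *)
Definition surface L p (S : 'I_p -> R * R -> param) : Prop :=
  forall i, smooth_near unit_square (S i) /\
            forall z, unit_square z -> L (S i z).

(* The sides of a patch, counterclockwise. *)
Definition side (s : R * R -> param) (e : 'I_4) (t : R) : param :=
  match val e with
  | 0 => s (t, 0)
  | 1 => s (1, t)
  | 2 => s (1 - t, 1)
  | _ => s (0, 1 - t)
  end.

(* [C] is the oriented boundary of [S]: the sides of the patches are the arcs of
   [C], each once, pairs of opposite arcs along which patches are glued, and
   arcs reduced to a point. *)
Definition bounds k (C : 'I_k -> R -> param) p (S : 'I_p -> R * R -> param) : Prop :=
  exists q r (c : 'I_q -> R -> param) (z : 'I_r -> param)
    (h : 'I_p * 'I_4 -> 'I_k + 'I_q * bool + 'I_r),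
    bijective h /\
    forall e t, 0 <= t <= 1 ->
      side (S e.1) e.2 t =
      match h e with
      | inl (inl i) => C i t
      | inl (inr (j, b)) => c j (if b then 1 - t else t)
      | inr d => z d
      end.

Definition curve_integral k (C : 'I_k -> R -> param) (a : param -> 'I_n -> R) : R :=
  \sum_(i < k) \int[lebesgue_measure]_(t in `[0, 1])
    \sum_(m < n) a (C i t) m * ('D_1 (C i) t) 0 m.

Definition surface_integral p (S : 'I_p -> R * R -> param)
    (w : param -> 'I_n -> 'I_n -> R) : R :=
  \sum_(i < p) \int[lebesgue_measure]_(s in `[0, 1])
    \int[lebesgue_measure]_(t in `[0, 1])
      \sum_(m < n) \sum_(k < n) w (S i (s, t)) m k
        * ('D_((1, 0) : R * R) (S i) (s, t)) 0 m
        * ('D_((0, 1) : R * R) (S i) (s, t)) 0 k.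

End Chains.

(* Main.v *)
(* Put N := Phi* and A := N - Phi, and let e be the one-form Phi + dS - x dy in the
   coordinates (I, theta).  As A is an average along streamlines, it is a function of
   the action, and e is independent of theta by Hamilton's equations for g.  Hence
   <Psi> + <dS - x dy> = N + dS - x dy at every theta: the mean form M needs no
   averaging.  Transporting N along g, and using [A, A] = 0 and the equality of mixed
   derivatives, the curvature of N pulled back to (I, theta) is dM.  This shows that
   it depends on I only; Stokes' theorem at fixed I gives the geometric angle. *)
Require Import Defs.
From mathcomp Require Import all_boot all_order all_algebra.
From mathcomp Require Import all_classical all_reals all_analysis.
From mathcomp Require Import ring lra.
Import Order.TTheory GRing.Theory Num.Theory numFieldNormedType.Exports.
Local Open Scope classical_set_scope.
Local Open Scope ring_scope.
Set Implicit Arguments.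
Unset Strict Implicit.
Unset Printing Implicit Defensive.

(** * Calculus in normed spaces *)

(** The identity [A, A] = 0 needs no formula for A as a function of the action. Since the
    theta-derivative of A vanishes, the gradients of all its components are orthogonal to one
    nonzero vector, hence parallel. By bilinearity [N_m, N_k] = [Phi_m, N_k] + [N_m, Phi_k] -
    [Phi_m, Phi_k]: the first two terms are the transport of N by the Hamiltonian fields of Phi, the
    third is d(dS - x dy) = -dx /\ dy on those fields. The main obstacle lies in the averages.
    [average] integrates along whatever parametrization of a level set of psi gets picked, whereas
    action-angle coordinates only prescribe the action of [X lam (I, th)]. That psi is constant in
    th, that these orbits fill the level sets, and that every parametrization lifts to the angle
    must all be derived. The coordinates miss the critical point. No limit is taken there: it is the
    only point of action 0, so any value of the curvature at it is compatible with dependence on the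
    action alone. *)

Lemma near_eq_continuous (T U : topologicalType) (f g : T -> U) x :
  (\forall z \near x, g z = f z) -> {for x, continuous g} -> {for x, continuous f}.
Proof.
move=> gf cg; have gx := nbhs_singleton gf.
have : g @ x --> f x by rewrite -gx.
by apply: cvg_trans; exact: near_eq_cvg.
Qed.

Lemma cvg_bigsum (R : realType) (E : normedModType R) (T : Type) (Fi : set_system T)
    {FF : Filter Fi} (I : Type) (r : seq I) (P : pred I) (f : I -> T -> E) (l : I -> E) :
  (forall i, P i -> f i @ Fi --> l i) ->
  (fun t => \sum_(i <- r | P i) f i t) @ Fi --> \sum_(i <- r | P i) l i.
Proof.
move=> fl; elim: r => [|i r IH].
  by under eq_fun do rewrite big_nil; rewrite big_nil; exact: cvg_cst.
under eq_fun do rewrite big_cons; rewrite big_cons.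
by case: ifP => // Pi; apply: cvgD => //; exact: fl.
Qed.

Section Derivatives.
Context {R : realType}.
Implicit Types E F K : normedModType R.

(** A directional derivative sees a function only along one line, so functions on different spaces
    that agree along lines share it. In this way partial derivatives of curried functions become
    derivatives on a product space. *)
Lemma derive_eq_along E E' F (f : E -> F) (g : E' -> F) x v y w :
  (forall h : R, g (h *: v + x) = f (h *: w + y)) -> 'D_v g x = 'D_w f y.
Proof.
move=> gf; rewrite /derive; have := gf 0; rewrite !scale0r !add0r => g0.
by under eq_fun do rewrite /= gf g0.
Qed.

Lemma derivable_eq_along E E' F (f : E -> F) (g : E' -> F) x v y w :
  (forall h : R, g (h *: v + x) = f (h *: w + y)) -> derivable f y w -> derivable g x v.
Proof.
move=> gf; rewrite /derivable; have := gf 0; rewrite !scale0r !add0r => g0.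
by under [in X in _ -> X]eq_fun do rewrite /= gf g0.
Qed.

Lemma derive_fst E E' F (f : E * E' -> F) x y v :
  'D_v (fun z => f (z, y)) x = 'D_(v, 0) f (x, y).
Proof.
apply: derive_eq_along => h; congr f.
by rewrite [RHS]surjective_pairing /= scaler0 add0r.
Qed.

Lemma derive_snd E E' F (f : E * E' -> F) x y v :
  'D_v (fun z => f (x, z)) y = 'D_(0, v) f (x, y).
Proof.
apply: derive_eq_along => h; congr f.
by rewrite [RHS]surjective_pairing /= scaler0 add0r.
Qed.

(** Only derivability of [f] along [v] is asked: restricted to the line, [f] becomes a curve on R,
    where derivable and differentiable coincide, and the chain rule for differentials applies to the
    curve. *)
Lemma derive_chain E F K (f : E -> F) (g : F -> K) x v :
  derivable f x v -> differentiable g (f x) ->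
  is_derive x v (g \o f) ('D_('D_v f x) g (f x)).
Proof.
move=> df dg.
pose c (h : R) := f (h *: v + x).
have dc : derivable c 0 1.
  apply: derivable_eq_along df => h.
  by rewrite /c addr0 /GRing.scale /= mulr1.
have c0 : c 0 = f x by rewrite /c scale0r add0r.
have Dc : 'D_1 c 0 = 'D_v f x.
  by apply: derive_eq_along => h; rewrite /c addr0 /GRing.scale /= mulr1.
have gc0 : differentiable g (c 0) by rewrite c0.
move/derivable1_diffP in dc.
have dgc : derivable (g \o c) 0 1.
  by apply: diff_derivable; exact: differentiable_comp.
have e h : (g \o f) (h *: v + x) = (g \o c) (h *: (1 : R) + 0).
  by rewrite /= /c addr0 /GRing.scale /= mulr1.
apply: DeriveDef; first exact: (derivable_eq_along e dgc).
rewrite (derive_eq_along e) deriveE; last exact: differentiable_comp.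
rewrite diff_comp //= -(deriveE _ dc) Dc.
by rewrite -deriveE // c0.
Qed.

Lemma derive_linear_dir E F (f : E -> F) x (a b : R) v w :
  differentiable f x -> 'D_(a *: v + b *: w) f x = a *: 'D_v f x + b *: 'D_w f x.
Proof. by move=> df; rewrite !deriveE // linearD !linearZ. Qed.

Lemma derive_pair E F K (f : E -> F) (g : E -> K) x v :
  derivable f x v -> derivable g x v ->
  is_derive x v (fun z => (f z, g z)) ('D_v f x, 'D_v g x).
Proof.
move=> df dg.
have c : h^-1 *: (((fun z => (f z, g z)) \o shift x) (h *: v) - (f x, g x))
    @[h --> 0^'] --> ('D_v f x, 'D_v g x).
  exact: (cvg_pair df dg).
apply: DeriveDef; first by apply/cvg_ex; eexists; exact: c.
exact/cvg_lim.
Qed.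

Lemma derive_pairD E E' F (f : E * E' -> F) p v w :
  differentiable f p -> 'D_(v, w) f p = 'D_(v, 0) f p + 'D_(0, w) f p.
Proof.
move=> df; rewrite !deriveE // -linearD; congr ('d f p _).
by rewrite [RHS]surjective_pairing /= addr0 add0r.
Qed.

Lemma differentiable_fst_line E E' F (f : E * E' -> F) x y :
  differentiable f (x, y) -> differentiable (fun z => f (z, y)) x.
Proof.
move=> df; apply: (@differentiable_comp _ _ _ _ (fun z => (z, y)) f).
  exact: differentiable_pair.
exact: df.
Qed.

Lemma differentiable_snd_line E E' F (f : E * E' -> F) x y :
  differentiable f (x, y) -> differentiable (fun z => f (x, z)) y.
Proof.
move=> df; apply: (@differentiable_comp _ _ _ _ (fun z => (x, z)) f).
  exact: differentiable_pair.
exact: df.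
Qed.

Lemma derive_row E n (f : E -> 'rV[R]_n) x v m :
  derivable f x v -> ('D_v f x) 0 m = 'D_v (fun z => f z 0 m) x.
Proof. by move=> df; rewrite derive_mx // mxE. Qed.

End Derivatives.

(** * Continuously differentiable maps *)

Section C1.
Context {R : realType}.
Implicit Types E F K : normedModType R.

(** Stands for finite dimension in the one form needed: every direction expands along finitely many
    fixed ones, with coefficients that depend continuously on it. *)
Definition finite_basis E := exists (T : finType) (e : T -> E) (c : T -> E -> R),
  (forall i, continuous (c i)) /\ forall v, v = \sum_i c i v *: e i.

Lemma finite_basis_R : finite_basis R.
Proof.
exists unit, (fun=> 1), (fun _ v => v); split=> [_ v|v]; first exact: cvg_id.
by rewrite (big_pred1 tt) /GRing.scale /= ?mulr1 //; case.
Qed.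

Lemma finite_basis_pair E F : finite_basis E -> finite_basis F -> finite_basis (E * F)%type.
Proof.
move=> [T [e [c [cc cE]]]] [T' [e' [c' [cc' cE']]]].
exists (T + T')%type,
  (fun i => match i with inl i => (e i, 0) | inr j => (0, e' j) end),
  (fun i p => match i with inl i => c i p.1 | inr j => c' j p.2 end); split.
  move=> [i|j] p.
    by apply: (@continuous_comp _ _ _ fst (c i)); [exact: cvg_fst|exact: cc].
  by apply: (@continuous_comp _ _ _ snd (c' j)); [exact: cvg_snd|exact: cc'].
move=> [v w]; rewrite big_sumType /=.
rewrite (_ : (v, w) = (v, 0) + (0, w)); last first.
  by rewrite [RHS]surjective_pairing /= addr0 add0r.
congr (_ + _).
  have m1 : {morph (fun z : E => (z, 0 : F)) : a b / a + b >-> a + b}.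
    by move=> a b /=; rewrite [RHS]surjective_pairing /= addr0.
  rewrite {1}(cE v) (big_morph _ m1 erefl); apply: eq_bigr => i _.
  by rewrite [RHS]surjective_pairing /= scaler0.
have m2 : {morph (fun z : F => (0 : E, z)) : a b / a + b >-> a + b}.
  by move=> a b /=; rewrite [RHS]surjective_pairing /= addr0.
rewrite {1}(cE' w) (big_morph _ m2 erefl); apply: eq_bigr => i _.
by rewrite [RHS]surjective_pairing /= scaler0.
Qed.

Lemma finite_basis_row n : finite_basis 'rV[R]_n.
Proof.
exists 'I_n, (fun i => delta_mx 0 i), (fun i (v : 'rV[R]_n) => v 0 i); split.
  by move=> i v; exact: coord_continuous.
by move=> v; rewrite {1}(row_sum_delta v).
Qed.

(* Continuity jointly in (x, v), rather than in x for each v, makes this notion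
   stable under composition without any assumption on the dimension. *)
Definition C1 E F (U : set E) (f : E -> F) := forall x, U x ->
  differentiable f x /\
  forall v, {for (x, v), continuous (fun p : E * E => 'D_(p.2) f p.1)}.

Lemma C1_sub E F (U V : set E) (f : E -> F) : V `<=` U -> C1 U f -> C1 V f.
Proof. by move=> VU Uf x /VU; exact: Uf. Qed.

Lemma C1_cont E F (U : set E) (f : E -> F) x v : C1 U f -> U x ->
  {for x, continuous ('D_v f)}.
Proof.
move=> Uf Ux; have [_ /(_ v) c] := Uf x Ux.
apply: (@continuous_comp _ _ _ (fun z => (z, v)) (fun p : E * E => 'D_(p.2) f p.1)) => //.
by apply: cvg_pair; [exact: cvg_id|exact: cvg_cst].
Qed.

(** By linearity in the direction, 'D_v f is the sum of c_i(v) times 'D_(e_i) f; each summand is a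
    product of a function continuous in v and one continuous in x, hence jointly continuous. *)
Lemma Ck1_C1 E F (U : set E) (f : E -> F) : finite_basis E -> open U ->
  Ck 1 U f -> C1 U f.
Proof.
move=> [T [e [c [cc cE]]]] oU [df cf] x Ux; split; first exact: df.
move=> v.
pose G (p : E * E) := \sum_i c i p.2 *: 'D_(e i) f p.1.
have fG : \forall p \near (x, v), G p = 'D_(p.2) f p.1.
  have nU : \forall p \near (x, v), U p.1.
    by apply: (@cvg_fst _ _ (nbhs x) (nbhs v)); exact: open_nbhs_nbhs.
  apply: filterS nU => p Up; rewrite /G [in RHS](cE p.2).
  rewrite deriveE; last exact: df.
  rewrite linear_sum; apply: eq_bigr => i _.
  by rewrite linearZ deriveE //; exact: df.
apply: (near_eq_continuous fG).
apply: cvg_bigsum => i _ /=; apply: cvgZ.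
  by apply: (cvg_comp snd (c i)); [exact: cvg_snd|exact: cc].
apply: (cvg_comp fst ('D_(e i) f)); first exact: cvg_fst.
exact: cf.
Qed.

Lemma smooth_C1 E F (U : set E) (f : E -> F) : finite_basis E -> open U ->
  smooth_on U f -> C1 U f.
Proof. by move=> bE oU sf; apply: Ck1_C1 => //; exact: sf. Qed.

Lemma smooth_derive E F (U : set E) (f : E -> F) v : smooth_on U f -> smooth_on U ('D_v f).
Proof. by move=> sf k; have [_ /(_ v)] := sf k.+1. Qed.

Lemma smooth_differentiable E F (U : set E) (f : E -> F) x :
  smooth_on U f -> U x -> differentiable f x.
Proof. by move=> sf Ux; have [+ _] := sf 1%N; exact. Qed.

Lemma smooth_continuous E F (U : set E) (f : E -> F) x :
  smooth_on U f -> U x -> {for x, continuous f}.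
Proof. by move=> sf Ux; exact: (sf 0%N). Qed.

Lemma C1_differentiable E F (U : set E) (f : E -> F) x :
  C1 U f -> U x -> differentiable f x.
Proof. by move=> Uf /Uf[]. Qed.

Lemma C1_continuous E F (U : set E) (f : E -> F) x :
  C1 U f -> U x -> {for x, continuous f}.
Proof. by move=> Uf /Uf[df _]; exact: differentiable_continuous. Qed.

Lemma C1_comp E F K (U : set E) (V : set F) (f : E -> F) (g : F -> K) :
  C1 U f -> C1 V g -> (forall x, U x -> V (f x)) -> open U -> C1 U (g \o f).
Proof.
move=> Uf Vg UV oU x Ux; have [df cf] := Uf x Ux; have [dg cg] := Vg _ (UV x Ux).
split; first exact: differentiable_comp.
move=> v; pose G (p : E * E) := 'D_('D_(p.2) f p.1) g (f p.1).
have nU : \forall p \near (x, v), U p.1.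
  by apply: (@cvg_fst _ _ (nbhs x) (nbhs v)); exact: open_nbhs_nbhs.
have fG : \forall p \near (x, v), G p = 'D_(p.2) (g \o f) p.1.
  apply: filterS nU => p Up; have [dfp _] := Uf _ Up; have [dgp _] := Vg _ (UV _ Up).
  by have [_ ->] := derive_chain (diff_derivable (v := p.2) dfp) dgp.
apply: (near_eq_continuous fG).
apply: (@continuous_comp _ _ _ (fun p : E * E => (f p.1, 'D_(p.2) f p.1))
  (fun q : F * F => 'D_(q.2) g q.1)); last exact: cg.
apply: cvg_pair; last exact: cf.
apply: (@continuous_comp _ _ _ fst f); first exact: cvg_fst.
exact: differentiable_continuous.
Qed.

Lemma C1_pair E F K (U : set E) (f : E -> F) (g : E -> K) : open U ->
  C1 U f -> C1 U g -> C1 U (fun x => (f x, g x)).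
Proof.
move=> oU Uf Ug x Ux; have [df cf] := Uf x Ux; have [dg cg] := Ug x Ux.
split; first exact: differentiable_pair.
move=> v; pose G (p : E * E) := ('D_(p.2) f p.1, 'D_(p.2) g p.1).
have nU : \forall p \near (x, v), U p.1.
  by apply: (@cvg_fst _ _ (nbhs x) (nbhs v)); exact: open_nbhs_nbhs.
have fG : \forall p \near (x, v), G p = 'D_(p.2) (fun x => (f x, g x)) p.1.
  apply: filterS nU => p Up; have [dfp _] := Uf _ Up; have [dgp _] := Ug _ Up.
  by have [_ ->] := derive_pair (diff_derivable (v := p.2) dfp) (diff_derivable (v := p.2) dgp).
apply: (near_eq_continuous fG).
by apply: cvg_pair; [exact: cf|exact: cg].
Qed.

Lemma C1_linear E F (U : set E) (f : {linear E -> F}) : continuous f -> C1 U f.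
Proof.
move=> cf x Ux; have df y : differentiable f y by exact: linear_differentiable.
split=> // v.
have -> : (fun p : E * E => 'D_(p.2) f p.1) = f \o snd.
  by apply/funext => p /=; rewrite deriveE // diff_lin.
by apply: continuous_comp; [exact: cvg_snd|exact: cf].
Qed.

Lemma C1_cst E F (U : set E) (a : F) : C1 U (cst a).
Proof.
move=> x Ux; split=> // v.
have -> : (fun p : E * E => 'D_(p.2) (cst a) p.1) = (cst 0 : _ -> F).
  by apply/funext => p; rewrite derive_cst.
exact: cvg_cst.
Qed.

Lemma C1_id E (U : set E) : C1 U id.
Proof.
move=> x Ux; split=> // v.
have -> : (fun p : E * E => 'D_(p.2) id p.1) = snd.
  by apply/funext => p; rewrite derive_id.
exact: cvg_snd.
Qed.

Lemma C1_fst E F (U : set (E * F)) : C1 U fst.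
Proof. by apply: C1_linear => x; exact: cvg_fst. Qed.

Lemma C1_snd E F (U : set (E * F)) : C1 U snd.
Proof. by apply: C1_linear => x; exact: cvg_snd. Qed.

Lemma C1_coord n (U : set 'rV[R]_n) m : C1 U (fun v : 'rV[R]_n => v 0 m).
Proof.
move=> x Ux; split; first exact: differentiable_coord.
move=> v.
have -> : (fun p : 'rV[R]_n * 'rV[R]_n => 'D_(p.2) (fun z : 'rV[R]_n => z 0 m) p.1)
    = (fun z : 'rV[R]_n => z 0 m) \o snd.
  by apply/funext => p /=; rewrite -derive_row ?derive_id //; exact: derivable_id.
by apply: continuous_comp; [exact: cvg_snd|exact: coord_continuous].
Qed.

Lemma C1_add E (U : set E) (f g : E -> R) : open U ->
  C1 U f -> C1 U g -> C1 U (fun x => f x + g x).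
Proof.
move=> oU Uf Ug x Ux; have [df cf] := Uf x Ux; have [dg cg] := Ug x Ux.
split; first exact: differentiableD.
move=> v; pose G (p : E * E) := 'D_(p.2) f p.1 + 'D_(p.2) g p.1.
have nU : \forall p \near (x, v), U p.1.
  by apply: (@cvg_fst _ _ (nbhs x) (nbhs v)); exact: open_nbhs_nbhs.
have fG : \forall p \near (x, v), G p = 'D_(p.2) (fun x => f x + g x) p.1.
  apply: filterS nU => p Up; have [dfp _] := Uf _ Up; have [dgp _] := Ug _ Up.
  by rewrite [RHS]deriveD //; exact: diff_derivable.
apply: (near_eq_continuous fG).
by apply: cvgD; [exact: cf|exact: cg].
Qed.

Lemma C1_mul E (U : set E) (f g : E -> R) : open U ->
  C1 U f -> C1 U g -> C1 U (fun x => f x * g x).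
Proof.
move=> oU Uf Ug x Ux; have [df cf] := Uf x Ux; have [dg cg] := Ug x Ux.
split; first exact: differentiableM.
move=> v; pose G (p : E * E) := f p.1 * 'D_(p.2) g p.1 + g p.1 * 'D_(p.2) f p.1.
have nU : \forall p \near (x, v), U p.1.
  by apply: (@cvg_fst _ _ (nbhs x) (nbhs v)); exact: open_nbhs_nbhs.
have fG : \forall p \near (x, v), G p = 'D_(p.2) (fun x => f x * g x) p.1.
  apply: filterS nU => p Up; have [dfp _] := Uf _ Up; have [dgp _] := Ug _ Up.
  by rewrite [RHS]deriveM //; exact: diff_derivable.
apply: (near_eq_continuous fG).
have c1 h : {for x, continuous h} -> {for (x, v), continuous (fun p : E * E => h p.1 : R)}.
  by move=> ch; apply: (@continuous_comp _ _ _ fst h) => //; exact: cvg_fst.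
apply: cvgD; apply: cvgM; [exact/c1/differentiable_continuous|exact: cg|
  exact/c1/differentiable_continuous|exact: cf].
Qed.

Lemma C1_sum E (U : set E) n (f : 'I_n -> E -> R) : open U ->
  (forall i, C1 U (f i)) -> C1 U (fun x => \sum_(i < n) f i x).
Proof.
move=> oU; elim: n f => [|n IH] f Uf.
  by under eq_fun do rewrite big_ord0; exact: C1_cst.
under eq_fun do rewrite big_ord_recr /=.
by apply: C1_add => //; exact: IH.
Qed.

End C1.

Lemma continuous_pair (T U V : topologicalType) (f : T -> U) (g : T -> V) x :
  {for x, continuous f} -> {for x, continuous g} ->
  {for x, continuous (fun z => (f z, g z))}.
Proof. by move=> cf cg; exact: (cvg_pair cf cg). Qed.

Lemma close_to_equal (R : realType) (A B p q e : R) :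
  p = q -> `|B - p| < e / 2 -> `|A - q| < e / 2 -> `|A - B| <= e.
Proof.
move=> <- hB hA; rewrite -(subrKA p) (le_trans (ler_normD _ _)) // (splitr e) lerD //.
  exact: ltW.
by rewrite distrC ltW.
Qed.

(** * Symmetry of second derivatives *)

Section Schwarz.
Context {R : realType}.
Implicit Types E F : normedModType R.

Lemma is_derive_line E F (f : E -> F) (y v : E) (a : R) :
  derivable f (a *: v + y) v ->
  is_derive a 1 (fun b : R => f (b *: v + y)) ('D_v f (a *: v + y)).
Proof.
have e h : f ((h *: (1 : R) + a) *: v + y) = f (h *: v + (a *: v + y)).
  by rewrite (_ : h *: (1 : R) = h) ?scalerDl ?addrA //; exact: mulr1.
move=> df; apply: DeriveDef; first exact: (derivable_eq_along e df).
exact: (derive_eq_along e).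
Qed.

(** Mean value theorem twice: in the direction v for the increment of f over s w, then in the
    direction w for [fv] at the intermediate point found. *)
Lemma second_difference_mvt E (U : set E) (f fv fvw : E -> R) (v w x : E) (s : R) :
  0 < s -> (forall y, U y -> is_derive y v f (fv y)) ->
  (forall y, U y -> is_derive y w fv (fvw y)) ->
  (forall a b, 0 <= a <= s -> 0 <= b <= s -> U (a *: v + (b *: w + x))) ->
  exists a b, [/\ 0 <= a <= s, 0 <= b <= s &
   f (s *: v + (s *: w + x)) - f (s *: w + x) - (f (s *: v + x) - f x)
    = fvw (a *: v + (b *: w + x)) * s * s].
Proof.
move=> s0 df ddf Us.
have U1 a : 0 <= a <= s -> U (a *: v + (s *: w + x)).
  by move=> as0; apply: Us => //; rewrite lexx ltW.
have U0 a : 0 <= a <= s -> U (a *: v + x).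
  by move=> /Us/(_ (_ : 0 <= 0 <= s)); rewrite scale0r add0r; apply; rewrite lexx ltW.
have oocc (a : R) : a \in `]0, s[ -> 0 <= a <= s.
  by rewrite in_itv /= => /andP[/ltW -> /ltW ->].
have line (h dh : E -> R) u y a : is_derive (a *: u + y) u h (dh (a *: u + y)) ->
    is_derive a (1 : R) (fun a => h (a *: u + y)) (dh (a *: u + y)).
  by move=> [dd <-]; exact: is_derive_line.
pose phi (a : R) := f (a *: v + (s *: w + x)) - f (a *: v + x).
have dphi (a : R) : 0 <= a <= s ->
    is_derive a 1 phi (fv (a *: v + (s *: w + x)) - fv (a *: v + x)).
  by move=> as0; apply: is_deriveB; apply: line; apply: df; [exact: U1|exact: U0].
have [||a /oocc as0 ea] := @MVT R phi
    (fun a => fv (a *: v + (s *: w + x)) - fv (a *: v + x)) 0 s s0.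
- by move=> a /oocc; exact: dphi.
- apply: continuous_in_subspaceT => a; rewrite inE /= in_itv /= => as0.
  by apply/differentiable_continuous/derivable1_diffP; have [] := dphi _ as0.
pose psi (b : R) := fv (a *: v + (b *: w + x)).
have dpsi (b : R) : 0 <= b <= s ->
    is_derive b 1 psi (fvw (a *: v + (b *: w + x))).
  move=> bs0; rewrite /psi; under eq_fun do rewrite addrCA; rewrite addrCA.
  by apply: line; apply: ddf; rewrite addrCA; exact: Us.
have [||b /oocc bs0 eb] := @MVT R psi
    (fun b => fvw (a *: v + (b *: w + x))) 0 s s0.
- by move=> b /oocc; exact: dpsi.
- apply: continuous_in_subspaceT => b; rewrite inE /= in_itv /= => bs0.
  by apply/differentiable_continuous/derivable1_diffP; have [] := dpsi _ bs0.
exists a, b; split => //.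
move: ea eb; rewrite /phi /psi !scale0r !add0r !subr0 => ea eb.
by rewrite -eb -ea; ring.
Qed.

(** The second difference over a parallelogram is symmetric in v and w, so it equals both [fvw] at
    one of its points and [fwv] at another; shrinking it to x identifies the two. The derivatives
    are arguments, so that coordinates of a vector-valued derivative can be supplied. *)
Lemma mixed_derivatives E (U : set E) (f fv fw fvw fwv : E -> R) (v w x : E) :
  open U -> U x ->
  (forall y, U y -> is_derive y v f (fv y)) ->
  (forall y, U y -> is_derive y w f (fw y)) ->
  (forall y, U y -> is_derive y w fv (fvw y)) ->
  (forall y, U y -> is_derive y v fw (fwv y)) ->
  {for x, continuous fvw} -> {for x, continuous fwv} -> fvw x = fwv x.
Proof.
move=> oU Ux dv dw dvw dwv /cvgrPdist_lt cvw /cvgrPdist_lt cwv.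
apply/eqP; rewrite -subr_eq0 -normr_le0; apply/ler_addgt0Pl => e e0; rewrite addr0.
have e2 : 0 < e / 2 by rewrite divr_gt0.
have nU := open_nbhs_nbhs (conj oU Ux).
have [d /= d0 dP] := (@nbhs_ballP _ _ _ _).1 (filterI nU (filterI (cvw _ e2) (cwv _ e2))).
(* The summand 1 keeps k positive even if v = w = 0; with s = d / (2 k) the whole parallelogram of
   sides s v and s w stays in the ball of radius d. *)
pose k := `|v| + `|w| + 1.
have k0 : 0 < k by rewrite ltr_wpDl // addr_ge0.
pose s := d / (2 * k).
have s0 : 0 < s by rewrite divr_gt0 // mulr_gt0.
have P a b : 0 <= a <= s -> 0 <= b <= s -> ball x d (a *: v + (b *: w + x)).
  move=> /andP[a0 as_] /andP[b0 bs]; rewrite -ball_normE /ball_ /= addrA distrC addrK.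
  apply: (le_lt_trans (ler_normD _ _)); rewrite !normrZ (ger0_norm a0) (ger0_norm b0).
  apply: (@le_lt_trans _ _ (s * (`|v| + `|w|))).
    by rewrite mulrDr lerD // ler_wpM2r.
  apply: (@lt_trans _ _ (s * k)); first by rewrite ltr_pM2l // ltrDl.
  rewrite /s invfM mulrA -mulrA mulVf ?mulr1; last by rewrite gt_eqF.
  by rewrite ltr_pdivrMr // ltr_pMr // ltr1n.
have Pc a b : 0 <= a <= s -> 0 <= b <= s -> ball x d (a *: w + (b *: v + x)).
  by move=> ha hb; rewrite addrCA; exact: P.
have [a [b [ha hb ep]]] := second_difference_mvt s0 dv dvw (fun a b ha hb => (dP _ (P a b ha hb)).1).
have [a' [b' [ha' hb' eq']]] := second_difference_mvt s0 dw dwv (fun a b ha hb => (dP _ (Pc a b ha hb)).1).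
have [_ [/= hp _]] := dP _ (P _ _ ha hb).
have [_ [_ /= hq]] := dP _ (Pc _ _ ha' hb').
rewrite distrC.
apply: (close_to_equal _ hp hq).
apply: (mulIf (lt0r_neq0 s0)); apply: (mulIf (lt0r_neq0 s0)).
rewrite -ep -eq' (_ : s *: w + (s *: v + x) = s *: v + (s *: w + x)); last exact: addrCA.
by ring.
Qed.

Lemma schwarz E (U : set E) (f : E -> R) (v w x : E) : open U -> Ck 2 U f ->
  U x -> 'D_v ('D_w f) x = 'D_w ('D_v f) x.
Proof.
move=> oU [df d2f] Ux.
have D (h : E -> R) u y : differentiable h y -> is_derive y u h ('D_u h y).
  by move=> dh; apply/derivableP/diff_derivable.
have ddf u y : U y -> differentiable ('D_u f) y by have [+ _] := d2f u; exact.
have cddf u u' : {for x, continuous ('D_u' ('D_u f))}.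
  by have [_ /(_ u')] := d2f u; exact.
apply: (@mixed_derivatives E U f ('D_w f) ('D_v f) ('D_v ('D_w f)) ('D_w ('D_v f)) w v x oU Ux) => [y Uy|y Uy|y Uy|y Uy||].
- exact/D/df.
- exact/D/df.
- exact/D/ddf.
- exact/D/ddf.
- exact: cddf.
- exact: cddf.
Qed.

Lemma schwarz_row E n (U : set E) (f : E -> 'rV[R]_n) (v w x : E) : open U -> Ck 2 U f ->
  U x -> 'D_v ('D_w f) x = 'D_w ('D_v f) x.
Proof.
move=> oU [df d2f] Ux.
have D (h : E -> 'rV[R]_n) u y m : differentiable h y ->
    is_derive y u (fun z => h z 0 m) ('D_u h y 0 m).
  move=> dh; have d := diff_derivable (v := u) dh.
  by rewrite derive_row //; apply: derivableP; move/derivable_mxP: d; exact.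
have ddf u y : U y -> differentiable ('D_u f) y by have [+ _] := d2f u; exact.
have cddf u u' m : {for x, continuous (fun z => 'D_u' ('D_u f) z 0 m)}.
  have [_ /(_ u') c] := d2f u.
  apply: (@continuous_comp _ _ _ ('D_u' ('D_u f)) (fun z : 'rV[R]_n => z 0 m)).
    exact: c.
  exact: coord_continuous.
apply/rowP => m.
apply: (@mixed_derivatives E U (fun z => f z 0 m) (fun z => 'D_w f z 0 m)
  (fun z => 'D_v f z 0 m) (fun z => 'D_v ('D_w f) z 0 m)
  (fun z => 'D_w ('D_v f) z 0 m) w v x oU Ux) => [y Uy|y Uy|y Uy|y Uy||].
- exact/D/df.
- exact/D/df.
- exact/D/ddf.
- exact/D/ddf.
- exact: cddf.
- exact: cddf.
Qed.

End Schwarz.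

(** * Integrals over the unit interval and the unit square *)

Section Integrals.
Context {R : realType}.
Notation mu := (@lebesgue_measure R).

Lemma within_itv_continuous (f : R -> R) a b :
  (forall t, a <= t <= b -> {for t, continuous f}) -> {within `[a, b], continuous f}.
Proof.
by move=> cf; apply: continuous_in_subspaceT => t; rewrite inE /= in_itv /=; exact: cf.
Qed.

Lemma within_itv_integrable (f : R -> R) a b :
  {within `[a, b], continuous f} -> mu.-integrable `[a, b] (EFin \o f).
Proof.
by move=> cf; apply: continuous_compact_integrable => //; exact: segment_compact.
Qed.

Lemma itv_integrable (f : R -> R) a b :
  (forall t, a <= t <= b -> {for t, continuous f}) -> mu.-integrable `[a, b] (EFin \o f).
Proof. by move=> cf; apply/within_itv_integrable/within_itv_continuous. Qed.

Lemma Rintegral_FTC2 (f F : R -> R) a b : a < b ->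
  {within `[a, b], continuous f} -> {within `[a, b], continuous F} ->
  (forall t, a < t < b -> is_derive t (1 : R) F (f t)) ->
  \int[mu]_(t in `[a, b]) f t = F b - F a.
Proof.
move=> ab cf cF dF; rewrite /Rintegral (@continuous_FTC2 _ f F) //.
  have [_ Fa Fb] := (continuous_within_itvP F ab).1 cF.
  by split => // t; rewrite in_itv /= => /dF[].
by move=> t; rewrite in_itv /= derive1E => /dF[].
Qed.

(** One of the two integrals in F has an empty or degenerate interval, so F is the oriented integral
    from 0. Near t it differs by a constant from the integral started at - N, with N = |t| + 1 below
    all points concerned, and the fundamental theorem applies to that one. *)
Lemma primitive_exists (f : R -> R) : continuous f ->
  exists F : R -> R, forall t, is_derive t (1 : R) F (f t).
Proof.
move=> cf.
have ifab a b : mu.-integrable `[a, b] (EFin \o f) by apply: itv_integrable => t _; exact: cf.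
pose F x := \int[mu]_(t in `[0, x]) f t - \int[mu]_(t in `[x, 0]) f t.
exists F => t.
pose N := `|t| + 1.
have N0 : 0 < N by rewrite ltr_wpDl.
have [Nt tN] : - N < t /\ t < N.
  have : `|t| < N by rewrite ltrDl.
  by rewrite ltr_norml => /andP[].
pose G x := \int[mu]_(t in `[- N, x]) f t.
have [dG G't] : derivable G t 1 /\ G^`()%classic t = f t.
  by apply: (@continuous_FTC1_closed _ f (- N) t N) => //; exact: cf.
have FG x : - N <= x -> G x - G 0 = F x.
  move=> Nx; rewrite /F /G.
  have [x0|x0] := leP 0 x.
    rewrite (@Rintegral_itvB _ f (BLeft (- N)) (BRight x) 0) //; last first.
      by rewrite bnd_simp; rewrite oppr_le0 ltW.
    rewrite Rintegral_itv_obnd_cbnd; last first.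
      by apply: integrableS (ifab 0 x) => //; exact: subset_itv_oc_cc.
    move: x0; rewrite le_eqVlt => /predU1P[<-|x0].
      by rewrite set_itv1 !Rintegral_set1 subrr.
    by rewrite [in X in _ - X]set_itv_ge ?Rintegral_set0 ?subr0 // bnd_simp -ltNge.
  rewrite -opprB (@Rintegral_itvB _ f (BLeft (- N)) (BRight 0) x) //; last first.
    by rewrite bnd_simp ltW.
  rewrite Rintegral_itv_obnd_cbnd; last first.
    by apply: integrableS (ifab x 0) => //; exact: subset_itv_oc_cc.
  by rewrite [in X in X - _]set_itv_ge ?Rintegral_set0 ?sub0r // bnd_simp -ltNge.
apply: (@near_eq_is_derive _ _ _ (fun x => G x - G 0)).
  have : \forall x \near t, - N < x by exact: lt_nbhsr.
  by apply: filterS => x /ltW; exact: FG.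
rewrite -G't derive1E -[X in is_derive _ _ _ X]subr0.
by apply: is_deriveB; exact: DeriveDef.
Qed.

Lemma derive0_cst (f : R -> R) (a b : R) : a <= b ->
  (forall t, a <= t <= b -> is_derive t (1 : R) f 0) -> f a = f b.
Proof.
rewrite le_eqVlt => /predU1P[-> //|ab] df.
have [||c _] := @MVT R f (fun=> 0) a b ab.
- by move=> t; rewrite in_itv /= => /andP[/ltW at_ /ltW tb]; apply: df; rewrite at_ tb.
- apply: within_itv_continuous => t /df[dt _].
  exact/differentiable_continuous/derivable1_diffP.
- by rewrite mul0r => /eqP; rewrite subr_eq0 => /eqP.
Qed.


(** Retraction of the line onto [a, b]. Composition with it extends a function continuous at the
    points of a closed interval or rectangle to one that is continuous everywhere. *)
Definition clamp (a b x : R) : R := Num.max a (Num.min x b).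

Lemma clamp_itv a b x : a <= b -> a <= clamp a b x <= b.
Proof. by move=> ab; rewrite /clamp le_max lexx /= ge_max ab ge_min lexx orbT. Qed.

Lemma clamp_id a b x : a <= x <= b -> clamp a b x = x.
Proof. by move=> /andP[ax xb]; rewrite /clamp (min_idPl xb) (max_idPr ax). Qed.

Lemma continuous_clamp a b : continuous (clamp a b).
Proof.
move=> x; have := @continuous_max R R (cst a) (fun x => Num.min x b) x; apply.
  exact: cvg_cst.
by have := @continuous_min R R id (cst b) x; apply; [exact: cvg_id|exact: cvg_cst].
Qed.

Lemma rectangle_bounded (f : R * R -> R) a b :
  (forall s t : R, a <= s <= b -> 0 <= t <= 1 -> {for (s, t), continuous f}) ->
  exists2 K : R, 0 <= K & forall s t, a <= s <= b -> 0 <= t <= 1 -> `|f (s, t)| <= K.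
Proof.
move=> cf; pose A : set (R * R) := `[a, b] `*` `[0, 1].
have cA : compact A by apply: compact_setX; exact: segment_compact.
have wA : {within A, continuous f}.
  apply: continuous_in_subspaceT => -[s t]; rewrite inE /A /= !in_itv /= => -[sab t01].
  exact: cf.
have [M [_ MP]] := compact_bounded (continuous_compact wA cA).
exists (`|M| + 1); first by rewrite addr_ge0.
move=> s t sab t01; apply: (MP (`|M| + 1)).
  by rewrite (le_lt_trans (ler_norm M)) // ltrDl.
by exists (s, t) => //; rewrite /A /= !in_itv.
Qed.

Lemma integral_parameter_continuous (f : R * R -> R) a b : a <= b ->
  (forall s t : R, a <= s <= b -> 0 <= t <= 1 -> {for (s, t), continuous f}) ->
  {within `[a, b], continuous (fun s => \int[mu]_(t in `[0, 1]) f (s, t))}.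
Proof.
move=> ab cf.
pose h (s t : R) := f (clamp a b s, clamp 0 1 t).
have hf s t : a <= s <= b -> 0 <= t <= 1 -> h s t = f (s, t).
  by move=> sab t01; rewrite /h !clamp_id.
have ch : continuous (fun p : R * R => h p.1 p.2).
  move=> p; apply: (@continuous_comp _ _ _
    (fun p : R * R => (clamp a b p.1, clamp 0 1 p.2)) f); last first.
    by apply: cf; exact: clamp_itv.
  apply: continuous_pair.
    by apply: (@continuous_comp _ _ _ fst (clamp a b)); [exact: cvg_fst|exact: continuous_clamp].
  by apply: (@continuous_comp _ _ _ snd (clamp 0 1)); [exact: cvg_snd|exact: continuous_clamp].
have [K K0 bK] := rectangle_bounded cf.
have bh s t : `|h s t| <= K by apply: bK; exact: clamp_itv.
pose E s := \int[mu]_(t in `[0, 1]) h s t.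
have cE : {in `](a - 1), (b + 1)[%classic, continuous E}.
  apply: (@continuity_under_integral R _ (measurableTypeR R) mu h `[0, 1]%classic _
    (a - 1) (b + 1) _ _ (cst K)) => //.
  - move=> s _; apply: itv_integrable => t _.
    apply: (@continuous_comp _ _ _ (fun t => (s, t)) (fun p : R * R => h p.1 p.2)); last exact: ch.
    by apply: continuous_pair; [exact: cvg_cst|exact: cvg_id].
  - apply: aeW => t _ s _.
    apply: (@continuous_comp _ _ _ (fun s => (s, t)) (fun p : R * R => h p.1 p.2)); last exact: ch.
    by apply: continuous_pair; [exact: cvg_id|exact: cvg_cst].
  - by apply: itv_integrable => t _; exact: cvg_cst.
  - by move=> s _; apply: aeW => t _; exact: bh.
apply: (@subspace_eq_continuous _ _ _ E).
  move=> s; rewrite inE /= in_itv /= => sab; apply: eq_Rintegral => t.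
  by rewrite inE /= in_itv /=; exact: hf.
apply: within_itv_continuous => s /andP[as_ sb]; apply: cE.
by rewrite inE /= in_itv /= ltrBlDr (le_lt_trans as_) ?ltrDl // (le_lt_trans sb) // ltrDl.
Qed.

Lemma Leibniz_rule (f df : R * R -> R) a b :
  (forall s t : R, a <= s <= b -> 0 <= t <= 1 -> {for (s, t), continuous f}) ->
  (forall s t : R, a <= s <= b -> 0 <= t <= 1 -> {for (s, t), continuous df}) ->
  (forall s t : R, a <= s <= b -> 0 <= t <= 1 ->
     is_derive s (1 : R) (fun s => f (s, t)) (df (s, t))) ->
  forall s, a < s < b ->
  is_derive s (1 : R) (fun s => \int[mu]_(t in `[0, 1]) f (s, t))
    (\int[mu]_(t in `[0, 1]) df (s, t)).
Proof.
move=> cf cdf d s sab.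
have [K K0 bK] := rectangle_bounded cdf.
have oocc x : `]a, b[%classic x -> a <= x <= b.
  by rewrite /= in_itv /= => /andP[/ltW -> /ltW ->].
have If x : `]a, b[%classic x ->
    mu.-integrable `[0, 1] (EFin \o (fun t => f (x, t))).
  move=> /oocc xab; apply: itv_integrable => t t01.
  apply: (@continuous_comp _ _ _ (fun t => (x, t)) f); last exact: cf.
  by apply: continuous_pair; [exact: cvg_cst|exact: cvg_id].
have Df x t : `]a, b[%classic x -> `[0, 1]%classic t ->
    derivable (fun x => f (x, t)) x 1.
  by move=> /oocc xab; rewrite /= in_itv /= => t01; have [] := d _ _ xab t01.
have IK : mu.-integrable `[0, 1] (EFin \o (cst K : R -> R)).
  by apply: itv_integrable => t _; exact: cvg_cst.
have bd x t : `]a, b[%classic x -> `[0, 1]%classic t ->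
    `|partial1of2 (fun x t => f (x, t)) x t| <= K.
  move=> /oocc xab; rewrite /= in_itv /= => t01.
  by rewrite partial1of2E; have [_ ->] := d _ _ xab t01; exact: bK.
have Is : `]a, b[%classic s by rewrite /= in_itv.
have m01 : measurable (`[0, 1]%classic : set (measurableTypeR R)) by [].
apply: DeriveDef.
  exact: (@derivable_under_integral R _ (measurableTypeR R) mu
    (fun x t => f (x, t)) _ m01 s a b Is If Df (cst K) (fun=> K0) IK bd).
rewrite -derive1E (@differentiation_under_integral R _ (measurableTypeR R) mu
    (fun x t => f (x, t)) _ m01 s a b Is If Df (cst K) (fun=> K0) IK bd).
apply: eq_Rintegral => t; rewrite inE /= in_itv /= => t01.
by rewrite partial1of2E; have [_ ->] := d _ _ (oocc _ Is) t01.
Qed.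

Lemma continuous_slice1 (f : R * R -> R) (s t : R) :
  {for (s, t), continuous f} -> {for t, continuous (fun t => f (s, t))}.
Proof.
move=> cf; apply: (@continuous_comp _ _ _ (fun t => (s, t)) f) => //.
by apply: continuous_pair; [exact: cvg_cst|exact: cvg_id].
Qed.

Lemma continuous_slice2 (f : R * R -> R) (s t : R) :
  {for (s, t), continuous f} -> {for s, continuous (fun s => f (s, t))}.
Proof.
move=> cf; apply: (@continuous_comp _ _ _ (fun s => (s, t)) f) => //.
by apply: continuous_pair; [exact: cvg_id|exact: cvg_cst].
Qed.

(** No exchange of integrals is involved: s |-> the integral of f (s, t) over t has the inner
    integral as its derivative, by differentiation under the integral sign, and the fundamental
    theorem is applied to it. *)
Lemma square_integral_dx (U : set (R * R)) (f : R * R -> R) :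
  C1 U f -> unit_square `<=` U ->
  \int[mu]_(s in `[0, 1]) \int[mu]_(t in `[0, 1]) dx f (s, t)
  = \int[mu]_(t in `[0, 1]) (f (1, t) - f (0, t)).
Proof.
move=> Uf sU.
have US (s t : R) : 0 <= s <= 1 -> 0 <= t <= 1 -> U (s, t) by move=> *; exact: sU.
have cf (s t : R) : 0 <= s <= 1 -> 0 <= t <= 1 -> {for (s, t), continuous f}.
  by move=> *; apply: (C1_continuous Uf); exact: US.
have cdf (s t : R) : 0 <= s <= 1 -> 0 <= t <= 1 -> {for (s, t), continuous (dx f)}.
  by move=> *; apply: (C1_cont Uf); exact: US.
have d (s t : R) : 0 <= s <= 1 -> 0 <= t <= 1 ->
     is_derive s (1 : R) (fun s => f (s, t)) (dx f (s, t)).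
  move=> hs ht; have df := C1_differentiable Uf (US _ _ hs ht).
  apply: DeriveDef; last exact: derive_fst.
  exact/diff_derivable/differentiable_fst_line.
have H1 := integral_parameter_continuous ler01 cdf.
have H2 := integral_parameter_continuous ler01 cf.
have H3 := Leibniz_rule cf cdf d.
apply: (etrans (Rintegral_FTC2 ltr01 H1 H2 H3)).
rewrite RintegralB // ; apply: itv_integrable => t t01.
  by apply: continuous_slice1; apply: cf => //; rewrite ler01 lexx.
by apply: continuous_slice1; apply: cf => //; rewrite ler01 lexx.
Qed.

Lemma square_integral_dy (U : set (R * R)) (f : R * R -> R) :
  C1 U f -> unit_square `<=` U ->
  \int[mu]_(s in `[0, 1]) \int[mu]_(t in `[0, 1]) dy f (s, t)
  = \int[mu]_(s in `[0, 1]) (f (s, 1) - f (s, 0)).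
Proof.
move=> Uf sU; apply: eq_Rintegral => s; rewrite inE /= in_itv /= => s01.
have US (t : R) : 0 <= t <= 1 -> U (s, t) by move=> *; exact: sU.
apply: (@Rintegral_FTC2 (fun t => dy f (s, t)) (fun t => f (s, t)) 0 1 ltr01).
- apply: within_itv_continuous => t t01; apply: continuous_slice1.
  exact: (C1_cont Uf (US _ t01)).
- apply: within_itv_continuous => t t01; apply: continuous_slice1.
  exact: (C1_continuous Uf (US _ t01)).
- move=> t /andP[/ltW t0 /ltW t1].
  have df : differentiable f (s, t) by apply: (C1_differentiable Uf); apply: US; rewrite t0.
  apply: DeriveDef; last exact: derive_snd.
  exact/diff_derivable/differentiable_snd_line.
Qed.

End Integrals.

(** * Stokes' theorem for cut surfaces *)

Section LineIntegrals.
Context {R : realType} {n : nat}.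
Notation mu := (@lebesgue_measure R).
Notation param := 'rV[R]_n.
Variables (L : set param) (M : param -> 'I_n -> R).
Hypotheses (oL : open L) (CM : forall m, C1 L (M ^~ m)).

Definition line_integral (c : R -> param) : R :=
  \int[mu]_(t in `[0, 1]) \sum_(m < n) M (c t) m * ('D_1 c t) 0 m.

Definition C1_arc (c : R -> param) :=
  (exists V : set R, [/\ open V, (forall t, 0 <= t <= 1 -> V t) & C1 V c]) /\
  forall t, 0 <= t <= 1 -> L (c t).

Lemma line_integrand_continuous c t : C1_arc c -> 0 <= t <= 1 ->
  {for t, continuous (fun t => \sum_(m < n) M (c t) m * ('D_1 c t) 0 m)}.
Proof.
move=> [[V [oV V01 Vc]] Lc] t01; apply: cvg_bigsum => m _; apply: cvgM.
  apply: (@continuous_comp _ _ _ c (M ^~ m)).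
    exact: C1_continuous Vc (V01 _ t01).
  exact: C1_continuous (CM m) (Lc _ t01).
apply: (@continuous_comp _ _ _ ('D_1 c) (fun v : param => v 0 m)).
  exact: C1_cont Vc (V01 _ t01).
exact: coord_continuous.
Qed.

(** Arcs are compared on [0, 1] only, and their extensions may differ outside. Agreement of the
    two-sided derivatives is therefore read off in the open interval, and the endpoints have measure
    zero. *)
Lemma Rintegral_oo_eq (f h : R -> R) :
  (forall t : R, 0 <= t <= 1 -> {for t, continuous f}) ->
  (forall t : R, 0 <= t <= 1 -> {for t, continuous h}) ->
  (forall t : R, 0 < t < 1 -> f t = h t) ->
  \int[mu]_(t in `[0, 1]) f t = \int[mu]_(t in `[0, 1]) h t.
Proof.
have oo u : (forall t : R, 0 <= t <= 1 -> {for t, continuous u}) ->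
    \int[mu]_(t in `[0, 1]) u t = \int[mu]_(t in `]0, 1[) u t.
  move=> cu; have iu := itv_integrable cu.
  rewrite -Rintegral_itv_obnd_cbnd; last first.
    by apply: integrableS iu => //; exact: subset_itv_oc_cc.
  rewrite -Rintegral_itv_bndo_bndc //.
  by apply: integrableS iu => //; exact: subset_itv_oo_cc.
move=> cf ch fh; rewrite (oo f cf) (oo h ch); apply: eq_Rintegral => t.
by rewrite inE /= in_itv /=; exact: fh.
Qed.

Lemma near_itv_oo (P : R -> Prop) (t : R) : 0 < t < 1 ->
  (forall t, 0 <= t <= 1 -> P t) -> \forall z \near t, P z.
Proof.
move=> t01 H; have t01' : t \in `]0, 1[ by rewrite in_itv.
apply: filterS (near_in_itvoo t01') => z; rewrite in_itv /= => /andP[/ltW z0 /ltW z1].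
by apply: H; rewrite z0.
Qed.

Lemma line_integral_eq c c' : C1_arc c -> C1_arc c' ->
  (forall t, 0 <= t <= 1 -> c t = c' t) -> line_integral c = line_integral c'.
Proof.
move=> hc hc' cc'; apply: Rintegral_oo_eq.
- by move=> t; exact: (@line_integrand_continuous c _ hc).
- by move=> t; exact: (@line_integrand_continuous c' _ hc').
move=> t t01; have E := near_itv_oo t01 cc'.
by rewrite (near_eq_derive _ E) (nbhs_singleton E).
Qed.

Lemma Rintegral_reverse (f h : R -> R) :
  (forall t : R, 0 <= t <= 1 -> {for t, continuous f}) ->
  (forall t : R, 0 <= t <= 1 -> {for t, continuous h}) ->
  (forall t : R, 0 < t < 1 -> f t = - h (1 - t)) ->
  \int[mu]_(t in `[0, 1]) f t = - \int[mu]_(t in `[0, 1]) h t.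
Proof.
move=> cf ch fh.
have Wt (t : R) : 0 <= t <= 1 -> 0 <= 1 - t <= 1.
  by move=> /andP[t0 t1]; rewrite subr_ge0 t1 lerBlDr lerDl.
have c1 (t : R) : 0 <= t <= 1 -> {for t, continuous (fun t : R => h (1 - t))}.
  move=> t01; apply: (@continuous_comp _ _ _ (fun t : R => 1 - t) h).
    by apply: cvgB; [exact: cvg_cst|exact: cvg_id].
  exact/ch/Wt.
have := @Rintegration_by_substitution_onem R _ 1 _ (within_itv_continuous ch).
rewrite ler01 lexx unstable.onem1 => /(_ isT) ->.
rewrite -[RHS]mulN1r -RintegralZl //; last exact: itv_integrable.
apply: Rintegral_oo_eq => //.
  by move=> t t01; apply: cvgM; [exact: cvg_cst|exact: c1].
by move=> t t01; rewrite mulN1r; exact: fh.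
Qed.

Lemma line_integral_reverse c c' : C1_arc c -> C1_arc c' ->
  (forall t, 0 <= t <= 1 -> c t = c' (1 - t)) -> line_integral c = - line_integral c'.
Proof.
move=> hc hc' cc'; apply: Rintegral_reverse.
- by move=> t; exact: (@line_integrand_continuous c _ hc).
- by move=> t; exact: (@line_integrand_continuous c' _ hc').
move=> t t01; have E' := near_itv_oo t01 cc'.
have tcc : 0 <= 1 - t <= 1.
  by case/andP: t01 => /ltW t0 /ltW t1; rewrite subr_ge0 t1 lerBlDr lerDl.
have D : 'D_1 c t = - 'D_1 c' (1 - t).
  rewrite (near_eq_derive _ E').
  have [[V [oV V01 Vc]] _] := hc'.
  have dc := C1_differentiable Vc (V01 _ tcc).
  have [dd D1] : is_derive t (1 : R) (fun t : R => 1 - t) (-1).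
    by rewrite -[X in is_derive _ _ _ X]sub0r; apply: is_deriveB.
  have [_ ->] := derive_chain dd dc.
  by rewrite D1 !(deriveE _ dc) linearN.
rewrite D (nbhs_singleton E') -sumrN.
by apply: eq_bigr => m _; rewrite mxE mulrN.
Qed.

Lemma line_integral_cst c z : C1_arc c ->
  (forall t, 0 <= t <= 1 -> c t = z) -> line_integral c = 0.
Proof.
move=> hc cz; rewrite -[RHS](Rintegral_set0 mu (cst 0)).
rewrite (_ : line_integral c = \int[mu]_(t in `[0, 1]) 0).
  by rewrite Rintegral_cst // mul0r Rintegral_set0.
apply: Rintegral_oo_eq.
- by move=> t; exact: (@line_integrand_continuous c _ hc).
- by move=> t _; exact: cvg_cst.
move=> t t01; have E' := near_itv_oo t01 cz.
have D : 'D_1 c t = 0 by rewrite (near_eq_derive _ E') derive_cst.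
rewrite D big1 // => m _.
by rewrite mxE mulr0.
Qed.

Lemma C1_arc_comp (U : set (R * R)) (s : R * R -> param) (a : R -> R * R) :
  open U -> unit_square `<=` U -> C1 U s -> (forall z, unit_square z -> L (s z)) ->
  C1 setT a -> (forall t, 0 <= t <= 1 -> unit_square (a t)) -> C1_arc (s \o a).
Proof.
move=> oU sU Us Ls Ca sa; split; last by move=> t t01; exact: Ls (sa t t01).
exists (a @^-1` U); split.
- apply: open_comp => // t _.
  exact: (C1_continuous Ca).
- by move=> t t01; apply: sU; exact: sa.
- apply: (@C1_comp _ _ _ _ _ U) => //; first exact: C1_sub Ca.
  apply: open_comp => // t _; exact: (C1_continuous Ca).
Qed.


Lemma derive_rowE (f : param -> R) (x v : param) : differentiable f x ->
  'D_v f x = \sum_(m < n) 'D_(delta_mx 0 m) f x * v 0 m.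
Proof.
move=> df; rewrite {1}(row_sum_delta v) deriveE // linear_sum; apply: eq_bigr => m _.
by rewrite linearZ -deriveE // mulrC.
Qed.

Lemma C1_side (s : R * R -> param) (U : set (R * R)) e :
  open U -> unit_square `<=` U -> C1 U s -> (forall z, unit_square z -> L (s z)) ->
  C1_arc (side s e).
Proof.
move=> oU sU Us Ls.
have Copp : C1 setT (fun t : R => 1 - t).
  have -> : (fun t : R => 1 - t) = (fun t => cst 1 t + cst (-1) t * id t).
    by apply/funext => t /=; rewrite mulN1r.
  apply: C1_add; [exact: openT|exact: C1_cst|].
  by apply: C1_mul; [exact: openT|exact: C1_cst|exact: C1_id].
have pairC (a b : R -> R) : C1 setT a -> C1 setT b -> C1 setT (fun t => (a t, b t)).
  by move=> Ca Cb; apply: C1_pair; [exact: openT|exact: Ca|exact: Cb].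
have r (t : R) : 0 <= t <= 1 -> 0 <= 1 - t <= 1.
  by move=> /andP[t0 t1]; rewrite subr_ge0 t1 lerBlDr lerDl.
case: e => [[|[|[|[|//]]]] He].
- apply: (@C1_arc_comp U s (fun t => (t, 0))) => //.
    by apply: pairC; [exact: C1_id|exact: C1_cst].
  by move=> t t01; rewrite /unit_square /= lexx ler01.
- apply: (@C1_arc_comp U s (fun t => (1, t))) => //.
    by apply: pairC; [exact: C1_cst|exact: C1_id].
  by move=> t t01; rewrite /unit_square /= lexx ler01.
- apply: (@C1_arc_comp U s (fun t => (1 - t, 1))) => //.
    by apply: pairC; [exact: Copp|exact: C1_cst].
  by move=> t t01; rewrite /unit_square /= lexx ler01; split => //; exact: r.
- apply: (@C1_arc_comp U s (fun t => (0, 1 - t))) => //.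
    by apply: pairC; [exact: C1_cst|exact: Copp].
  by move=> t t01; rewrite /unit_square /= lexx ler01; split => //; exact: r.
Qed.

Lemma green_square (V : set (R * R)) (P Q : R * R -> R) : unit_square `<=` V ->
  C1 V P -> C1 V Q ->
  (\int[mu]_(t in `[0, 1]) P (t, 0)) + ((\int[mu]_(t in `[0, 1]) Q (1, t))
    + (- (\int[mu]_(t in `[0, 1]) P (t, 1)) - (\int[mu]_(t in `[0, 1]) Q (0, t))))
  = \int[mu]_(a in `[0, 1]) \int[mu]_(b in `[0, 1]) (dx Q (a, b) - dy P (a, b)).
Proof.
move=> sV CP CQ.
have cW (W : R * R -> R) (a b : R) : C1 V W -> 0 <= a <= 1 -> 0 <= b <= 1 -> {for (a, b), continuous W}.
  by move=> CW ha hb; apply: (C1_continuous CW); exact: sV.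
have IX : \int[mu]_(t in `[0, 1]) Q (1, t) - \int[mu]_(t in `[0, 1]) Q (0, t)
   = \int[mu]_(a in `[0, 1]) \int[mu]_(b in `[0, 1]) dx Q (a, b).
  rewrite (square_integral_dx CQ sV) RintegralB //; apply: itv_integrable => t t01;
  by apply: continuous_slice1; apply: cW => //; rewrite lexx ler01.
have IY : \int[mu]_(t in `[0, 1]) P (t, 1) - \int[mu]_(t in `[0, 1]) P (t, 0)
   = \int[mu]_(a in `[0, 1]) \int[mu]_(b in `[0, 1]) dy P (a, b).
  rewrite (square_integral_dy CP sV) RintegralB //; apply: itv_integrable => t t01;
  by apply: continuous_slice2; apply: cW => //; rewrite lexx ler01.
have A (p0 q1 p1 q0 : R) : p0 + (q1 + (- p1 - q0)) = (q1 - q0) - (p1 - p0) by ring.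
rewrite A IX IY.
have cdx (a b : R) : 0 <= a <= 1 -> 0 <= b <= 1 -> {for (a, b), continuous (dx Q)}.
  by move=> ha hb; apply: (C1_cont CQ); exact: sV.
have cdy (a b : R) : 0 <= a <= 1 -> 0 <= b <= 1 -> {for (a, b), continuous (dy P)}.
  by move=> ha hb; apply: (C1_cont CP); exact: sV.
rewrite -RintegralB; first last.
- exact/within_itv_integrable/(integral_parameter_continuous ler01 cdy).
- exact/within_itv_integrable/(integral_parameter_continuous ler01 cdx).
- by [].
apply: eq_Rintegral => a; rewrite inE /= in_itv /= => a01.
rewrite -RintegralB //.
- by apply: itv_integrable => b b01; apply: continuous_slice1; exact: cdx.
- by apply: itv_integrable => b b01; apply: continuous_slice1; exact: cdy.
Qed.

(** Here [c] and [c'] are the two mixed second derivatives of a patch: by symmetry their terms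
    cancel, and renaming indices in the rest leaves the antisymmetric part of [d], the exterior
    derivative of the form. *)
Lemma antisymmetrized_sum (d : 'I_n -> 'I_n -> R) (N : 'I_n -> R) (a b c c' : param) :
  c = c' ->
  \sum_(m < n) ((\sum_(k < n) d m k * a 0 k) * b 0 m + N m * c 0 m)
  - \sum_(m < n) ((\sum_(k < n) d m k * b 0 k) * a 0 m + N m * c' 0 m)
  = \sum_(m < n) \sum_(k < n) (d k m - d m k) * a 0 m * b 0 k.
Proof.
move=> <-; rewrite !big_split /= opprD addrACA subrr addr0.
under eq_bigr do rewrite big_distrl /=.
under [X in _ - X]eq_bigr do rewrite big_distrl /=.
rewrite exchange_big /= -sumrN -big_split /=; apply: eq_bigr => m _.
rewrite -sumrN -big_split /=; apply: eq_bigr => k _.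
by rewrite !mulrBl; congr (_ - _); rewrite mulrAC.
Qed.

Lemma sum_I4 (l : 'I_4 -> R) :
  \sum_e l e = l ord0 + (l (lift ord0 ord0) + (l (inord 2) + l (inord 3))).
Proof.
rewrite !big_ord_recl big_ord0 addr0; congr (_ + (_ + (_ + _))); congr l;
  by apply: val_inj; rewrite /= inordK.
Qed.

Lemma sum_opposite_pairs q (l : 'I_q * bool -> R) :
  (forall j, l (j, true) = - l (j, false)) -> \sum_x l x = 0.
Proof.
move=> lN; rewrite (eq_bigr (fun x => l (x.1, x.2))); last by move=> [].
rewrite -(pair_bigA _ (fun j b => l (j, b))) big1 // => j _.
by rewrite big_bool /= lN addNr.
Qed.

(** * Green's formula for one patch *)

Section Patch.
Variables (s : R * R -> param) (U : set (R * R)).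
Hypotheses (oU : open U) (sU : unit_square `<=` U) (sms : smooth_on U s)
  (Ls : forall z, unit_square z -> L (s z)).

(** The extension [s] may leave [L] off the square, and [M] is controlled on [L] only; [V] is the
    open set where both can be differentiated. *)
Let V := U `&` s @^-1` L.

Let Us : C1 U s.
Proof. by apply: smooth_C1 => //; apply: finite_basis_pair; exact: finite_basis_R. Qed.

Let Ds u : C1 U ('D_u s).
Proof.
apply: smooth_C1 => //; first by apply: finite_basis_pair; exact: finite_basis_R.
exact: smooth_derive.
Qed.

Let oV : open V.
Proof.
rewrite openE => z [Uz Lz]; apply: filterI; first exact: open_nbhs_nbhs.
by apply: (C1_continuous Us Uz); exact: open_nbhs_nbhs.
Qed.

Let VU : V `<=` U. Proof. by move=> z []. Qed.

(** For u = (1, 0) and u = (0, 1) these are the coefficients P and Q of the pullback P da + Q db of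
    [M] to the square. *)
Definition pulled_form u z := \sum_(m < n) M (s z) m * ('D_u s z) 0 m.

Let VM m : C1 V (fun z => M (s z) m).
Proof. by apply: (C1_comp (C1_sub VU Us) (CM m)) => // z []. Qed.

Let VD u m : C1 V (fun z => ('D_u s z) 0 m).
Proof. exact: (C1_comp (C1_sub VU (Ds u)) (C1_coord (U := setT) m)). Qed.

Lemma C1_pulled_form u : C1 V (pulled_form u).
Proof.
apply: C1_sum; first exact: oV.
by move=> m; apply: C1_mul; [exact: oV|exact: VM|exact: VD].
Qed.

Lemma derive_pulled_form u v z : V z -> 'D_v (pulled_form u) z = \sum_(m < n)
   ((\sum_(k < n) dpar (M ^~ m) k (s z) * ('D_v s z) 0 k) * ('D_u s z) 0 m
    + M (s z) m * ('D_v ('D_u s) z) 0 m).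
Proof.
move=> Vz.
have dM m : differentiable (fun z => M (s z) m) z by exact: C1_differentiable (VM m) Vz.
have dD m : differentiable (fun z => ('D_u s z) 0 m) z by exact: C1_differentiable (VD u m) Vz.
have -> : pulled_form u = \sum_(m < n) (fun z => M (s z) m * ('D_u s z) 0 m).
  by apply/funext => y; rewrite fct_sumE.
rewrite derive_sum; last by move=> m; exact/diff_derivable/differentiableM.
apply: eq_bigr => m _.
have -> := deriveM (diff_derivable (v := v) (dM m)) (diff_derivable (v := v) (dD m)).
have <- := derive_row m (diff_derivable (v := v) (C1_differentiable (Ds u) (VU Vz))).
have dMs := C1_differentiable (CM m) Vz.2.
have [_ ->] := derive_chain (diff_derivable (v := v) (C1_differentiable Us (VU Vz))) dMs.
by rewrite (derive_rowE _ dMs) addrC; congr (_ + _); exact: mulrC.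
Qed.

Lemma green_integrand z : V z ->
  dx (pulled_form (0, 1)) z - dy (pulled_form (1, 0)) z =
   \sum_(m < n) \sum_(k < n) (dpar (M ^~ k) m (s z) - dpar (M ^~ m) k (s z))
        * ('D_((1, 0) : R * R) s z) 0 m * ('D_((0, 1) : R * R) s z) 0 k.
Proof.
move=> Vz; have S := schwarz_row ((1, 0) : R * R) ((0, 1) : R * R) oU (sms 2) (VU Vz).
have Ex := derive_pulled_form (0, 1) (1, 0) Vz.
have Ey := derive_pulled_form (1, 0) (0, 1) Vz.
apply: (etrans (congr2 (fun a b => a - b) Ex Ey)).
exact: (antisymmetrized_sum _ _ _ _ S).
Qed.

Lemma green_patch :
  \sum_(e < 4) line_integral (side s e) =
  \int[mu]_(a in `[0, 1]) \int[mu]_(b in `[0, 1])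
   \sum_(m < n) \sum_(k < n) (dpar (M ^~ k) m (s (a, b)) - dpar (M ^~ m) k (s (a, b)))
        * ('D_((1, 0) : R * R) s (a, b)) 0 m * ('D_((0, 1) : R * R) s (a, b)) 0 k.
Proof.
have sV : unit_square `<=` V by move=> z sz; split; [exact: sU|exact: Ls].
have arc e : C1_arc (side s e) by exact: C1_side Us Ls.
have up (b : R) : line_integral (fun t => s (t, b)) = \int[mu]_(t in `[0, 1]) pulled_form (1, 0) (t, b).
  apply: eq_Rintegral => t _.
  by apply: eq_bigr => m _; rewrite derive_fst.
have right (a : R) : line_integral (fun t => s (a, t)) = \int[mu]_(t in `[0, 1]) pulled_form (0, 1) (a, t).
  apply: eq_Rintegral => t _.
  by apply: eq_bigr => m _; rewrite derive_snd.
have arch (b : R) : 0 <= b <= 1 -> C1_arc (fun t => s (t, b)).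
  move=> b01; apply: (C1_arc_comp (a := fun t => (t, b)) oU sU Us Ls) => //.
  by apply: C1_pair; [exact: openT|exact: C1_id|exact: C1_cst].
have arcv (b : R) : 0 <= b <= 1 -> C1_arc (fun t => s (b, t)).
  move=> b01; apply: (C1_arc_comp (a := fun t => (b, t)) oU sU Us Ls) => //.
  by apply: C1_pair; [exact: openT|exact: C1_cst|exact: C1_id].
have h0 : 0 <= (0 : R) <= 1 by rewrite lexx ler01.
have h1 : 0 <= (1 : R) <= 1 by rewrite lexx ler01.
(* In the counterclockwise order the top and the left side run against the coordinates, which
   produces the two minus signs of Green's formula. *)
have E2 : line_integral (side s (inord 2)) = - line_integral (fun t => s (t, 1)).
  apply: line_integral_reverse; [exact: arc|exact: arch|].
  by move=> t t01; rewrite /side (inordK _ : val (inord _) = _).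
have E3 : line_integral (side s (inord 3)) = - line_integral (fun t => s (0, t)).
  apply: line_integral_reverse; [exact: arc|exact: arcv|].
  by move=> t t01; rewrite /side (inordK _ : val (inord _) = _).
have K (a b c d a' b' c' d' : R) : a = a' -> b = b' -> c = c' -> d = d' ->
  a + (b + (c + d)) = a' + (b' + (c' + d')) by move=> -> -> -> ->.
have E0 : line_integral (side s ord0) = \int[mu]_(t in `[0, 1]) pulled_form (1, 0) (t, 0) := up 0.
have E1 : line_integral (side s (lift ord0 ord0)) = \int[mu]_(t in `[0, 1]) pulled_form (0, 1) (1, t) := right 1.
rewrite up in E2; rewrite right in E3.
apply: (etrans (sum_I4 _)).
apply: (etrans (K _ _ _ _ _ _ _ _ E0 E1 E2 E3)).
apply: (etrans (green_square sV (@C1_pulled_form _) (@C1_pulled_form _))).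
apply: eq_Rintegral => a; rewrite inE /= in_itv /= => a01.
apply: eq_Rintegral => b; rewrite inE /= in_itv /= => b01.
have Vab : V (a, b) by apply: sV; exact: (conj a01 b01).
exact (green_integrand Vab).
Qed.

End Patch.

(** Green's formula on each patch turns the surface integral into a sum over all sides of all
    patches, which the inverse of the bijection in [bounds] regroups by the role of the side: the
    arcs of [C] remain, glued sides cancel in pairs, degenerate sides contribute nothing. *)
Lemma stokes k (C : 'I_k -> R -> param) p (S : 'I_p -> R * R -> param) :
  closed_curve L C -> surface L S -> bounds C S ->
  curve_integral C M =
  surface_integral S (fun lam m k => dpar (M ^~ k) m lam - dpar (M ^~ m) k lam).
Proof.
move=> hC hS [q [r [c [z [h [hbij hside]]]]]].
have arcC i : C1_arc (C i).
  have [[U [oU sU Us]] LC _] := hC i; split=> //; exists U; split => //.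
  by apply: smooth_C1; [exact: finite_basis_R|exact: oU|exact: Us].
have arcS i e : C1_arc (side (S i) e).
  have [[U [oU sU Us]] LS] := hS i; apply: (C1_side e oU sU _ LS).
  apply: smooth_C1; [|exact: oU|exact: Us].
  by apply: finite_basis_pair; exact: finite_basis_R.
have -> : surface_integral S (fun lam m k => dpar (M ^~ k) m lam - dpar (M ^~ m) k lam)
    = \sum_(i < p) \sum_(e < 4) line_integral (side (S i) e).
  apply: eq_bigr => i _; have [[U [oU sU Us]] LS] := hS i.
  by rewrite (green_patch oU sU Us LS).
rewrite pair_big /=.
have [h' hK h'K] := hbij.
rewrite (reindex h') /=; last by exists h => x _; [exact: h'K|exact: hK].
have sideh x t : 0 <= t <= 1 -> side (S (h' x).1) (h' x).2 t =
      match x with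
      | inl (inl i) => C i t
      | inl (inr (j, b)) => c j (if b then 1 - t else t)
      | inr d => z d
      end.
  by move=> t01; have := hside (h' x) t t01; rewrite h'K.
rewrite !big_sumType /=.
rewrite [X in _ + X]big1 ?addr0; last first.
  move=> d _; apply: (line_integral_cst (z := z d)) => //.
  by move=> t t01; rewrite sideh.
rewrite [X in _ + X](_ : _ = 0) ?addr0; last first.
  apply: (sum_opposite_pairs (l := fun x => line_integral (side (S (h' (inl (inr x))).1) (h' (inl (inr x))).2))) => j.
  apply: line_integral_reverse; [exact: arcS|exact: arcS|] => t t01.
  rewrite sideh // sideh //.
  by case/andP: t01 => t0 t1; rewrite subr_ge0 t1 lerBlDr lerDl.
apply: eq_bigr => i _; apply: line_integral_eq => // t t01.
by rewrite sideh.
Qed.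

End LineIntegrals.

(** * Streamlines and action-angle variables *)

Section PlaneDerivatives.
Context {R : realType}.
Notation plane := (R * R)%type.

Lemma derive_plane (W : normedModType R) (f : plane -> W) x (a b : R) :
  differentiable f x ->
  'D_((a, b) : plane) f x = a *: 'D_((1, 0) : plane) f x + b *: 'D_((0, 1) : plane) f x.
Proof.
move=> df; rewrite -(derive_linear_dir _ _ _ _ df); congr ('D_ _ _ _).
rewrite [RHS]surjective_pairing /= !scaler0 addr0 add0r.
by congr (_, _); exact: (esym (mulr1 _)).
Qed.

Lemma derive_dxdy (f : plane -> R) x (a b : R) : differentiable f x ->
  'D_((a, b) : plane) f x = a * dx f x + b * dy f x.
Proof. exact: derive_plane. Qed.

Lemma enorm_eq0 (v : plane) : (enorm v == 0) = (v == 0).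
Proof.
rewrite /enorm sqrtr_eq0 le_eqVlt ltNge addr_ge0 ?sqr_ge0 // orbF.
rewrite paddr_eq0 ?sqr_ge0 // !sqrf_eq0; case: v => a b.
by apply/idP/idP => [/andP[/eqP /= -> /eqP /= ->]|/eqP[-> ->]]; rewrite eqxx.
Qed.

Lemma enormZ (a : R) (v : plane) : enorm (a *: v) = `|a| * enorm v.
Proof.
rewrite /enorm /= -sqrtr_sqr -sqrtrM ?sqr_ge0 //; congr Num.sqrt.
by rewrite /GRing.scale /=; ring.
Qed.

Lemma enorm_nperp (f : plane -> R) x : enorm (nperp f x) = enorm (grad f x).
Proof. by rewrite /enorm /nperp /grad /= sqrrN addrC. Qed.

(** Fermat's rule along every line through z; the factor s = 1 or -1 treats maxima and minima
    together. *)
Lemma grad_eq0_extremum (D : set plane) (f : plane -> R) z (s : R) : open D -> D z ->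
  (forall y, D y -> differentiable f y) ->
  (forall y, D y -> s * f y <= s * f z) -> s != 0 -> grad f z = 0.
Proof.
move=> oD Dz df fz s0.
have dir v : 'D_v f z = 0.
  pose c (h : R) := h *: v + z.
  have c0 : c 0 = z by rewrite /c scale0r add0r.
  have cc : continuous c.
    by move=> h; apply: cvgD; [exact: (cvgZl cvg_id)|exact: cvg_cst].
  have nD : \forall h \near (0 : R), D (c h).
    by apply: cc; rewrite c0; exact: open_nbhs_nbhs.
  have [d /= d0 dD] := (@nbhs_ballP _ _ _ _).1 nD.
  have dDc (t : R) : t \in `](- d), d[ -> D (c t).
    rewrite in_itv /= => /andP[t1 t2]; apply: dD.
    by rewrite -ball_normE /ball_ /= sub0r normrN ltr_norml t1.
  have dfc (t : R) : t \in `](- d), d[ -> derivable (fun h => s * f (c h)) t 1.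
    move=> /dDc Dt; apply: derivableM; first exact: derivable_cst.
    by have [] := is_derive_line (diff_derivable (v := v) (df _ Dt)).
  have := @derive1_at_max R (fun h => s * f (c h)) (- d) d 0 _ dfc _ _.
  case=> //.
  - by rewrite ge0_cp // ltW.
  - by rewrite in_itv /= oppr_lt0 d0.
  - by move=> t /dDc Dt; rewrite c0; exact: fz.
  move=> _ D0.
  have d0z : derivable f (0 *: v + z) v by rewrite scale0r add0r; exact/diff_derivable/df.
  have L := is_derive_line d0z.
  have [_ Z] := is_deriveZ s L.
  rewrite scale0r add0r in Z.
  have : s * 'D_v f z = 0 by rewrite -[LHS]Z -[RHS]D0.
  by move/eqP; rewrite mulf_eq0 (negbTE s0) => /eqP.
by rewrite /grad /dx /dy !dir.
Qed.

End PlaneDerivatives.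

(** * The critical point and its action *)

Section CriticalPoint.
Context {R : realType}.
Notation plane := (R * R)%type.

Lemma bounded_closure_compact (D : set plane) : bounded_set D -> compact (closure D).
Proof.
move=> [M [_ MD]]; pose K := `|M| + 1.
have DK : D `<=` `[- K, K]%classic `*` `[- K, K]%classic.
  move=> x Dx; have := MD K _ x Dx.
  rewrite /K (le_lt_trans (ler_norm M)) ?ltrDl // => /(_ isT).
  rewrite /= prod_normE ge_max !ler_norml => /andP[x1 x2].
  by split; rewrite /= in_itv.
have cK : compact (`[- K, K]%classic `*` `[- K, K]%classic : set plane).
  by apply: compact_setX; exact: segment_compact.
apply: (subclosed_compact _ cK); first exact: closed_closure.
have : closed (`[- K, K]%classic `*` `[- K, K]%classic : set plane).
  apply: compact_closed cK; exact: norm_hausdorff.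
by move/closure_id => ->; exact: closure_subset.
Qed.

(** If a second point had the value of x0, no extremum over the closure could lie inside: it would
    be critical, hence x0, and the second point would then be an extremum too, hence critical. So
    maximum and minimum sit on the boundary, where psi = 0; then psi vanishes identically and x0 is
    an interior maximum after all. *)
Lemma critical_level_set (D : set plane) (psi : plane -> R) x0 :
  open D -> bounded_set D ->
  (forall x, closure D x -> differentiable psi x) ->
  (forall x, boundary D x -> psi x = 0) ->
  D x0 -> (forall x, D x -> grad psi x = 0 -> x = x0) ->
  forall x, D x -> psi x = psi x0 -> x = x0.
Proof.
move=> oD bD dpsi psi0 Dx0 uniq x Dx ex; apply/eqP; apply: contraT => /eqP xx0.
have cD := bounded_closure_compact bD.
have sD : D `<=` closure D by exact: subset_closure.
have cpsi : {within closure D, continuous psi}.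
  apply: continuous_in_subspaceT => y; rewrite inE => /dpsi.
  exact: differentiable_continuous.
have nD : closure D !=set0 by exists x0; exact: sD.
have iD : interior D = D by exact/interior_id.
have ext c s : closure D c -> s != 0 -> (forall y, closure D y -> s * psi y <= s * psi c) -> ~ D c.
  move=> Dc s0 H Dc'; have crit z : D z -> (forall y, D y -> s * psi y <= s * psi z) -> z = x0.
    move=> Dz Hz; apply: uniq => //.
    by apply: (grad_eq0_extremum oD Dz _ Hz s0) => y /sD; exact: dpsi.
  have cx0 : c = x0 by apply: crit => // y /sD; exact: H.
  by apply: xx0; apply: crit => // y /sD Dy; rewrite ex -cx0; exact: H.
have bdr c : closure D c -> ~ D c -> psi c = 0 by move=> Dc nDc; apply: psi0; split=> //; rewrite iD.
have [c cc cmax] := compact_EVT_max nD cD cpsi.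
have [d dd dmin] := compact_EVT_min nD cD cpsi.
rewrite inE in cc; rewrite inE in dd.
have c0 : psi c = 0.
  apply: bdr => //; apply: (ext _ 1) => // y Dy.
  by rewrite !mul1r; apply: cmax; rewrite inE.
have d0 : psi d = 0.
  apply: bdr => //; apply: (ext _ (-1)) => //.
  move=> y Dy; rewrite !mulN1r lerN2; apply: dmin; rewrite inE //.
have z y : closure D y -> psi y = 0.
  move=> Dy; apply/eqP; rewrite eq_le -{1}c0 -d0.
  by rewrite cmax ?inE // dmin ?inE.
have := ext x0 1 (sD _ Dx0) (oner_neq0 _) _ Dx0; case=> // y Dy.
by rewrite (z y) // (z x0) //; exact: sD.
Qed.

(** From any x other than x0 the ray pointing away from x0 avoids x0, is connected and unbounded, so
    the component of x in the complement is unbounded. *)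
Lemma enclosed_point (x0 : plane) : enclosed [set x0] = set0.
Proof.
rewrite -subset0 => x [] /= xx0 [M [_ MB]].
pose r (t : R) := x + t *: (x - x0).
have v0 : x - x0 != 0 by rewrite subr_eq0; apply/eqP.
have cr : continuous r.
  by move=> t; apply: cvgD; [exact: cvg_cst|exact: (cvgZl cvg_id)].
have cA : connected (r @` `[0, +oo[%classic).
  apply: connected_continuous_connected.
    by apply/connected_intervalP; exact: interval_is_interval.
  exact: continuous_subspaceT.
have sA : r @` `[0, +oo[%classic `<=` ~` [set x0].
  move=> _ [t /= + <-]; rewrite in_itv /= andbT => t0 e.
  have : (1 + t) *: (x - x0) = 0.
    by rewrite scalerDl scale1r addrAC -/(r t) e subrr.
  by move/eqP; rewrite scaler_eq0 (negbTE v0) orbF gt_eqF // ltr_pwDl.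
have Ax : (r @` `[0, +oo[%classic) x.
  by exists 0; [rewrite /= in_itv /= lexx|rewrite /r scale0r addr0].
have AB := connected_component_max Ax sA cA.
have vp : 0 < `|x - x0| by rewrite normr_gt0.
(* Chosen so that t (x - x0) has norm |M| + 2 + |x|, which pushes r t beyond the assumed bound |M| +
   1. *)
pose t := (`|M| + 1 + 1 + `|x|) / `|x - x0|.
have t0 : 0 <= t by rewrite divr_ge0 // !addr_ge0.
have := MB (`|M| + 1) _ (r t) (AB _ _).
rewrite (le_lt_trans (ler_norm M)) ?ltrDl // => /(_ isT).
have At : (r @` `[0, +oo[%classic) (r t) by exists t => //=; rewrite in_itv /= t0.
move=> /(_ At); apply/negP; rewrite -ltNge.
have : `|t *: (x - x0)| <= `|r t| + `|x|.
  by rewrite -[t *: _](addKr x) addrC -/(r t); exact: ler_normB.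
rewrite normrZ (ger0_norm t0) /t divfK; last by rewrite gt_eqF.
by rewrite lerD2r => H; apply: (lt_le_trans _ H); rewrite ltrDl.
Qed.

Lemma action_critical (D : set plane) (psi : plane -> R) x0 :
  D x0 -> (forall x, D x -> psi x = psi x0 -> x = x0) -> action D psi x0 = 0.
Proof.
move=> Dx0 lev; rewrite /action.
have -> : streamline D psi x0 = [set x0].
  by apply/seteqP; split => [y [Dy /lev]|y ->//]; exact.
by rewrite enclosed_point /area measure0 mul0r.
Qed.

End CriticalPoint.

(** * Periodic primitives and continuation along the line *)

Section PeriodicPrimitive.
Context {R : realType}.

Lemma periodic_primitive_nat (H w : R -> R) T : (forall t, is_derive t (1 : R) H (w t)) ->
  (forall t, w (t + T) = w t) -> forall x (j : nat), H (x + j%:R * T) - H x = j%:R * (H T - H 0).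
Proof.
move=> dH wT.
have K x : H (x + T) - H x = H T - H 0.
  rewrite -[in H T](add0r T).
  apply: (@is_derive_0_is_cst R (fun x => H (x + T) - H x)) => t.
  rewrite -(subrr (w t)) -{1}wT; apply: is_deriveB.
  have e h : H ((h *: (1 : R) + t) + T) = H (h *: (1 : R) + (t + T)) by rewrite addrA.
  have [d D1] := dH (t + T).
  apply: DeriveDef; first exact: derivable_eq_along e d.
  by rewrite -D1; exact: derive_eq_along e.
move=> x; elim=> [|j IH]; first by rewrite !mul0r addr0 subrr.
rewrite -natr1 !mulrDl !mul1r addrA -(subrKA (H (x + j%:R * T))) K IH addrC.
by [].
Qed.

Lemma periodic_primitive (H w : R -> R) T : (forall t, is_derive t (1 : R) H (w t)) ->
  (forall t, w (t + T) = w t) ->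
  forall x (j : int), H (x + j%:~R * T) - H x = j%:~R * (H T - H 0).
Proof.
move=> dH wT x [j|j]; first exact: (periodic_primitive_nat dH wT).
have := periodic_primitive_nat dH wT (x + (Negz j)%:~R * T) j.+1.
rewrite NegzE mulrNz !mulNr subrK => E.
by rewrite -opprB E.
Qed.

(** Applied to the velocity of a curve in a level set of the action, (p, q) being the gradient: the
    explicit factor is the angular speed, and its formula shows that it is continuous. *)
Lemma orthogonal_parallel (a p q : R) (b : R) : a * p + b * q = 0 -> (p, q) != 0 ->
  (a, b) = ((b * p - a * q) / (p ^+ 2 + q ^+ 2)) *: ((- q, p) : R * R) /\ 0 < p ^+ 2 + q ^+ 2.
Proof.
move=> o n0.
have n1 : 0 < p ^+ 2 + q ^+ 2.
  rewrite lt_def addr_ge0 ?sqr_ge0 // andbT paddr_eq0 ?sqr_ge0 // !sqrf_eq0.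
  by apply: contra n0 => /andP[/eqP -> /eqP ->].
split=> //; have n2 := lt0r_neq0 n1.
rewrite [RHS]surjective_pairing /= /GRing.scale /=; congr (_, _); apply: (mulIf n2).
  rewrite mulrAC divfK // mulrN.
  have -> : a * (p ^+ 2 + q ^+ 2) = (a * p + b * q) * p - (b * p - a * q) * q by ring.
  by rewrite o mul0r sub0r.
rewrite mulrAC divfK //.
have -> : b * (p ^+ 2 + q ^+ 2) = (a * p + b * q) * q + (b * p - a * q) * p by ring.
by rewrite o mul0r add0r.
Qed.

Lemma continuous_angular_speed (a b p q : R -> R) t :
  {for t, continuous a} -> {for t, continuous b} ->
  {for t, continuous p} -> {for t, continuous q} -> 0 < p t ^+ 2 + q t ^+ 2 ->
  {for t, continuous (fun t => (b t * p t - a t * q t) / (p t ^+ 2 + q t ^+ 2))}.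
Proof.
move=> ca cb cp cq pq; apply: cvgM.
  by apply: cvgB; [exact: (cvgM cb cp)|exact: (cvgM ca cq)].
apply: cvgV; first exact: lt0r_neq0.
by apply: cvgD; [exact: (cvgM cp cp)|exact: (cvgM cq cq)].
Qed.

Lemma near_neq (T : topologicalType) (V : normedModType R) (f c : T -> V) t :
  {for t, continuous f} -> {for t, continuous c} -> f t <> c t ->
  \forall z \near t, f z <> c z.
Proof.
move=> cf cc ft.
have cfn : (fun z => `|f z - c z|) @ t --> `|f t - c t| by exact: cvg_norm (cvgB cf cc).
have np : 0 < `|f t - c t| by rewrite normr_gt0 subr_eq0; apply/eqP.
have S : nbhs `|f t - c t| [set y : R | 0 < y] by exact: lt_nbhsr.
have N : nbhs t [set z | 0 < `|f z - c z|] := cfn _ S.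
by apply: filterS N => z /=; rewrite normr_gt0 subr_eq0 => /eqP.
Qed.

(** Connectedness of the line as a continuation principle: the indicator function of P is locally
    constant, so its derivative is 0 everywhere. *)
Lemma clopen_line (P : R -> Prop) :
  (forall t, P t -> \forall z \near t, P z) ->
  (forall t, ~ P t -> \forall z \near t, ~ P z) -> P 0 -> forall t, P t.
Proof.
move=> opn cls P0 t; pose g t : R := if `[< P t >] then 1 else 0.
have dcst (a z : R) : (\forall y \near z, cst a y = g y) -> is_derive z (1 : R) g 0.
  have d : is_derive z (1 : R) (cst a : R -> R) (0 : R) by exact: is_derive_cst.
  by move=> e; exact: near_eq_is_derive e d.
have dg z : is_derive z (1 : R) g 0.
  have [e|e] := pselect (P z); [apply: (dcst 1)|apply: (dcst 0)].
    by apply: filterS (opn z e) => y ey; rewrite /g /=; case: asboolP.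
  by apply: filterS (cls z e) => y ey; rewrite /g /=; case: asboolP.
have := is_derive_0_is_cst t 0 dg; rewrite /g; case: asboolP => // _.
by case: asboolP => // _ /eqP; rewrite eq_sym oner_eq0.
Qed.

End PeriodicPrimitive.

(** * Streamline averages as angle means, at a fixed parameter *)

Section Streamlines.
Context {R : realType}.
Notation plane := (R * R)%type.
Notation mu := (@lebesgue_measure R).
Variables (D : set plane) (psi : plane -> R) (X : plane -> plane) (Imax : R).
Let I := action D psi.
Let D' := [set x | D x /\ grad psi x != 0].
Hypotheses (dpsi : forall x, D x -> differentiable psi x)
  (Icrit : forall x, D x -> grad psi x = 0 -> I x = 0)
  (dI : forall x, D' x -> [/\ differentiable I x, {for x, continuous (dx I)} & {for x, continuous (dy I)}])
  (dX : forall p : plane, 0 < p.1 < Imax -> differentiable X p)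
  (XD : forall p : plane, 0 < p.1 < Imax -> D (X p) /\ I (X p) = p.1)
  (surjX : forall x, D' x -> 0 < I x < Imax /\ exists th, X (I x, th) = x)
  (perX : forall J th th', 0 < J < Imax ->
     X (J, th) = X (J, th') <-> exists j : int, th' = th + j%:~R * (2 * pi))
  (branch : forall x th0, D' x -> X (I x, th0) = x ->
     exists th : plane -> R, exists U : set plane,
      [/\ open U /\ U x, U `<=` D', (forall y, U y -> differentiable th y), th x = th0
        & forall y, U y -> X (I y, th y) = y /\ bracket I th y = 1]).

Lemma streamline_regular p : 0 < p.1 < Imax -> D' (X p).
Proof.
move=> hp; have [Dx Ix] := XD hp; split => //; apply/eqP => g0.
by move: hp; rewrite -Ix (Icrit Dx g0) ltxx.
Qed.

Lemma derive_nperp_action (th : plane -> R) x : differentiable th x ->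
  'D_(nperp I x) th x = bracket I th x.
Proof.
by move=> dth; rewrite derive_dxdy // /bracket /nperp; ring.
Qed.

Lemma derive_nperp_self x : differentiable I x -> 'D_(nperp I x) I x = 0.
Proof. by move=> d; rewrite derive_dxdy // /nperp; ring. Qed.

(** Hamilton's equation for the angle. Near x the identity y = X (I y, th y) holds with a local
    branch th; differentiated along the rotated gradient of I, where I has derivative 0 and th has
    derivative [I, th] = 1, it leaves only the theta-derivative of X. *)
Lemma derive_angle p : 0 < p.1 < Imax -> 'D_((0, 1) : plane) X p = nperp I (X p).
Proof.
case: p => J th0 hp; have [Dx Ix] := XD hp; have D'x := streamline_regular hp.
set x := X (J, th0) in Dx Ix D'x *.
rewrite /= in Ix.
have [|th [U [[oU Ux] UD' dth thx UX]]] := branch D'x (th0 := th0); first by rewrite Ix.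
have [dIx _ _] := dI D'x.
have dthx := dth _ Ux.
have nU : \forall y \near x, U y by exact: open_nbhs_nbhs.
have E : \forall y \near x, y = (X \o (fun y => (I y, th y))) y.
  by apply: filterS nU => y /UX[].
have H := near_eq_derive (nperp I x) E.
have H0 : 'D_(nperp I x) (fun y => y) x = nperp I x := derive_id _ _.
have dxx : differentiable X ((fun y => (I y, th y)) x) by rewrite /= Ix; exact: dX.
have dpair := differentiable_pair dIx dthx.
have [_ H1] := derive_chain (diff_derivable (v := nperp I x) dpair) dxx.
have [_ H2] := derive_pair (diff_derivable (v := nperp I x) dIx) (diff_derivable (v := nperp I x) dthx).
have H3 : ('D_(nperp I x) I x, 'D_(nperp I x) th x) = (0, 1) :> plane.
  congr (_, _); first exact: derive_nperp_self.
  by have := derive_nperp_action dthx; have [_ ->] := UX _ Ux.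
have H4 : 'D_((0, 1) : plane) X (I x, th x) = nperp I x.
  have H5 := congr1 (fun w => 'D_w X (I x, th x)) (esym (etrans H2 H3)).
  exact (etrans H5 (etrans (esym H1) (etrans (esym H) H0))).
by move: H4; rewrite Ix thx.
Qed.

Lemma grad_action_neq0 p : 0 < p.1 < Imax -> grad I (X p) != 0.
Proof.
case: p => J th0 hp; have [Dx Ix] := XD hp; have D'x := streamline_regular hp.
have [|th [U [[oU Ux] UD' dth thx UX]]] := branch D'x (th0 := th0); first by rewrite Ix.
have [_] := UX _ Ux; rewrite /bracket => b; apply/eqP => -[d1 d2].
move: b; rewrite d1 d2 mul0r mulr0 subr0 => /eqP.
by rewrite eq_sym oner_eq0.
Qed.

Lemma derivable_streamline J th : 0 < J < Imax ->
  is_derive th (1 : R) (fun th => X (J, th)) (nperp I (X (J, th))).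
Proof.
move=> hJ; have hp : 0 < ((J, th) : plane).1 < Imax by [].
have d := dX hp; apply: DeriveDef.
  exact/diff_derivable/differentiable_snd_line.
by rewrite derive_snd derive_angle.
Qed.

Lemma continuous_streamline J : 0 < J < Imax -> continuous (fun th => X (J, th)).
Proof.
move=> hJ th; have [d _] := derivable_streamline th hJ.
exact/differentiable_continuous/derivable1_diffP.
Qed.

Lemma differentiable_streamfunction p : 0 < p.1 < Imax -> differentiable (psi \o X) p.
Proof.
by move=> hp; apply: differentiable_comp; [exact: dX|exact/dpsi/(XD hp).1].
Qed.

Lemma action_of_level x y : psi x = psi y -> I x = I y.
Proof. by move=> e; rewrite /I /action /streamline e. Qed.

(* Otherwise the intermediate value theorem in th produces points with different
   actions on one level set of psi. *)
Lemma streamfunction_derive_angle J th : 0 < J < Imax ->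
  'D_1 (fun th => psi (X (J, th))) th = 0.
Proof.
move=> hJ; pose f th := psi (X (J, th)).
have dfX (K t : R) : 0 < K < Imax -> differentiable (psi \o X) (K, t).
  by move=> hK; exact: differentiable_streamfunction.
have cfX (K : R) : 0 < K < Imax -> continuous (fun t => psi (X (K, t))).
  by move=> hK t; exact/differentiable_continuous/(differentiable_snd_line (dfX K t hK)).
have df : derivable f th 1.
  exact/diff_derivable/(differentiable_snd_line (dfX J th hJ)).
apply/eqP; apply: contraT => s0; exfalso.
set s := 'D_1 f th in s0; pose v := f th.
have : (fun h => h^-1 *: (f (h *: 1 + th) - f th)) @ 0^' --> s by exact: df.
move/cvgr_dist_lt => /(_ `|s|); rewrite normr_gt0 => /(_ s0) N.
(* A number closer to s than |s| has the sign of s; the product with s makes the two possible signs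
   one case. *)
have {}N : \forall h \near 0^', 0 < h^-1 * (f (h + th) - v) * s.
  apply: filterS N => h; rewrite [h *: (1 : R)]mulr1.
  set q := h^-1 *: _ => hq.
  change (0 < q * s).
  have [sp|sn|e] := ltrgtP 0 s; last by rewrite -e eqxx in s0.
    rewrite pmulr_lgt0 //; move: hq; rewrite (gtr0_norm sp) ltr_norml => /andP[_].
    by rewrite ltrBlDr ltrDl.
  rewrite nmulr_lgt0 //; move: hq; rewrite (ltr0_norm sn) ltr_norml opprK => /andP[+ _].
  by rewrite ltrBrDr gtrDl.
have [d /= d0 dN] := (@nbhs_ballP _ _ _ _).1 N.
pose e := d / 2.
have e0 : 0 < e by rewrite divr_gt0.
have ed : e < d by rewrite /e ltr_pdivrMr // ltr_pMr // ltr1n.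
have eN h : `|h| = e -> 0 < h^-1 * (f (h + th) - v) * s.
  move=> he; apply: dN; last by rewrite -normr_eq0 he gt_eqF.
  by rewrite -ball_normE /ball_ /= sub0r normrN he.
have Fp : 0 < (f (e + th) - v) * s.
  have := eN e (gtr0_norm e0); rewrite -mulrA pmulr_rgt0 // invr_gt0 //.
have Fm : (f (- e + th) - v) * s < 0.
  have := eN (- e); rewrite normrN (gtr0_norm e0) => /(_ erefl).
  by rewrite -mulrA nmulr_rgt0 // invr_lt0 oppr_lt0.
have cJ t : {for J, continuous (fun K => psi (X (K, t)))}.
  exact/differentiable_continuous/(differentiable_fst_line (dfX J t hJ)).
pose Fs K t := (psi (X (K, t)) - v) * s.
have cF t : {for J, continuous (fun K => Fs K t)}.
  by apply: cvgM; [apply: cvgB; [exact: cJ|exact: cvg_cst]|exact: cvg_cst].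
have n1 : \forall K \near J, 0 < Fs K (e + th) := cF (e + th) _ (lt_nbhsr Fp).
have n2 : \forall K \near J, Fs K (- e + th) < 0 := cF (- e + th) _ (lt_nbhsl Fm).
have J1 : J \in `]0, Imax[ by rewrite in_itv.
have n3 := near_in_itvoo J1.
have [r /= r0 rP] := (@nbhs_ballP _ _ _ _).1 (filterI n1 (filterI n2 n3)).
(* A neighbouring action, so close to J that psi - v still changes sign between the angles th - e
   and th + e. The value v = psi (X (J, th)) is thus taken at action K, although equal values of psi
   force equal actions. *)
pose K := J + r / 2.
have r2 : 0 < r / 2 by rewrite divr_gt0.
have [K1 [K2 K3]] : (fun K => 0 < Fs K (e + th) /\ (Fs K (- e + th) < 0 /\ K \in `]0, Imax[)) K.
  apply: rP; rewrite -ball_normE /ball_ /= /K opprD addrA subrr sub0r normrN gtr0_norm //.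
  by rewrite ltr_pdivrMr // ltr_pMr // ltr1n.
have hK : 0 < K < Imax by move: K3; rewrite in_itv.
have W : {within `[- e + th, e + th], continuous (Fs K)}.
  apply: continuous_subspaceT => t.
  by apply: cvgM; [apply: cvgB; [exact: cfX|exact: cvg_cst]|exact: cvg_cst].
have le : - e + th <= e + th by rewrite lerD2r ge0_cp // ltW.
have [|c _ /eqP] := IVT (v := 0) le W.
  by rewrite ge_min le_max (ltW K1) (ltW K2) orbT.
rewrite /Fs mulf_eq0 (negbTE s0) orbF subr_eq0 => /eqP ec.
have := action_of_level ec.
rewrite (XD (p := (K, c)) hK).2 (XD (p := (J, th)) hJ).2 /= /K => /eqP.
by rewrite -subr_eq0 addrC addKr gt_eqF.
Qed.

Lemma streamfunction_cst J th th' : 0 < J < Imax -> psi (X (J, th)) = psi (X (J, th')).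
Proof.
move=> hJ; apply: (@is_derive_0_is_cst R (fun th => psi (X (J, th)))) => t.
apply: DeriveDef; last exact: streamfunction_derive_angle.
exact/diff_derivable/(differentiable_snd_line (differentiable_streamfunction (p := (J, t)) hJ)).
Qed.

(** Since psi is constant in theta, it is locally k o I with k K = psi (X (K, 0)). The ratio of the
    gradients is therefore k' (J), the same at every angle, and comes out of integrals along the
    streamline. *)
Lemma grad_streamfunction J : 0 < J < Imax ->
  exists2 k : R, k != 0 & forall th, grad psi (X (J, th)) = k *: grad I (X (J, th)).
Proof.
move=> hJ; pose k (K : R) := psi (X (K, 0)).
have dk : differentiable k J.
  exact: differentiable_fst_line (differentiable_streamfunction (p := (J, 0)) hJ).
have E th : grad psi (X (J, th)) = 'D_1 k J *: grad I (X (J, th)).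
  have D'x := streamline_regular (p := (J, th)) hJ.
  have Ix := (XD (p := (J, th)) hJ).2; rewrite /= in Ix.
  set x := X (J, th) in D'x Ix *.
  have [|_ [U [[oU Ux] UD' _ _ _]]] := branch D'x (th0 := th); first by rewrite Ix.
  have nU : \forall y \near x, U y by exact: open_nbhs_nbhs.
  have Ek : \forall y \near x, psi y = (k \o I) y.
    apply: filterS nU => y /UD'/surjX[hy [t yt]].
    by rewrite -[in LHS]yt; exact: streamfunction_cst.
  have [dIx _ _] := dI D'x.
  have dkx : differentiable k (I x) by rewrite Ix.
  have Dv v : 'D_v psi x = 'D_1 k J * 'D_v I x.
    rewrite (near_eq_derive _ Ek).
    have [_ ->] := derive_chain (diff_derivable (v := v) dIx) dkx.
    rewrite Ix deriveE // -[X in 'd _ _ X]mulr1 linearZ -deriveE // mulrC.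
    by [].
  by rewrite /grad /dx /dy !Dv.
exists ('D_1 k J) => //; apply/eqP => k0.
have [_] := streamline_regular (p := (J, 0)) hJ.
by rewrite E k0 scale0r eqxx.
Qed.

(** Points on one level of psi have the same action J. As J > 0 while critical points have action 0,
    they are regular and hence reached by X at action J. *)
Lemma streamline_eq J th : 0 < J < Imax ->
  streamline D psi (X (J, th)) = range (fun th => X (J, th)).
Proof.
move=> hJ; apply/seteqP; split=> [y [Dy ey]|_ [t _ <-]]; last first.
  by split; [exact: (XD (p := (J, t)) hJ).1|exact: streamfunction_cst].
have Iy : I y = J by rewrite (action_of_level ey) (XD (p := (J, th)) hJ).2.
have D'y : D' y.
  split=> //; apply/eqP => g0; have := Icrit Dy g0; rewrite Iy => J0.
  by move: hJ; rewrite J0 ltxx.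
by have [_ [t]] := surjX D'y; rewrite Iy => yt; exists t.
Qed.

(** [arclength_integral] picks a parametrization with a default value; exhibiting one guarantees
    that the picked one is genuine. *)
Lemma streamline_param J : 0 < J < Imax ->
  closed_curve_param (range (fun th => X (J, th))) (fun t => X (J, 2 * pi * t)).
Proof.
move=> hJ; pose c t := X (J, 2 * pi * t).
have pi2 : 2 * pi != 0 :> R by rewrite mulf_neq0 // gt_eqF // pi_gt0.
have dm (t : R) : is_derive t (1 : R) (fun t : R => 2 * pi * t) (2 * pi).
  rewrite -[X in is_derive _ _ _ X](mulr1 (2 * pi)).
  exact: (is_deriveZ (2 * pi) (is_derive_id t 1)).
have dc t : differentiable c t.
  have [d1 _] := dm t; have [d2 _] := derivable_streamline (2 * pi * t) hJ.
  apply: (@differentiable_comp _ _ _ _ (fun t : R => 2 * pi * t) (fun th => X (J, th))).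
    exact/derivable1_diffP.
  exact/derivable1_diffP.
have D1c t : 'D_1 c t = (2 * pi) *: nperp I (c t).
  have [d1 E1] := dm t; have [d2 E2] := derivable_streamline (2 * pi * t) hJ.
  have d2' : differentiable (fun th => X (J, th)) (2 * pi * t) by exact/derivable1_diffP.
  have [_ H] := derive_chain d1 d2'.
  apply: (etrans H); rewrite E1 deriveE // -[X in 'd _ _ X]mulr1 linearZ -deriveE // E2.
  by [].
have cc : continuous c by move=> t; exact: differentiable_continuous.
have D'c t : D' (c t) by exact: (streamline_regular (p := (J, 2 * pi * t))).
have cn : continuous (fun t => nperp I (c t)).
  move=> t; have [_ c1 c2] := dI (D'c t).
  apply: (@continuous_pair _ _ _ (fun t => - dy I (c t)) (fun t => dx I (c t)) t).
    by apply: cvgN; exact: (@continuous_comp _ _ _ c (dy I) t (cc t) c2).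
  exact: (@continuous_comp _ _ _ c (dx I) t (cc t) c1).
have per1 t : c (t + 1) = c t.
  by apply/esym/(perX _ _ hJ); exists 1; rewrite mulrDr mulr1 mul1r.
split.
- split=> [t _|v t _]; first exact: dc.
  rewrite (_ : 'D_v c = fun t => v *: ((2 * pi) *: nperp I (c t))).
    exact: (cvgZ (cvg_cst _) (cvgZ (cvg_cst _) (cn t))).
  apply/funext => y; rewrite -D1c deriveE // -[in LHS](mulr1 v) linearZ -deriveE //.
- exact: per1.
- move=> t; rewrite D1c scaler_eq0 (negbTE pi2) /= -enorm_eq0 enorm_nperp enorm_eq0.
  exact: (grad_action_neq0 (p := (J, 2 * pi * t))).
- move=> t t'; rewrite !in_itv /= => /andP[t0 t1] /andP[t0' t1'].
  move=> /(perX _ _ hJ)[j /eqP].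
  rewrite [_%:~R * _]mulrC -mulrDr => /eqP/(mulfI pi2) e.
  suff j0 : j = 0 by rewrite e j0 addr0.
  have j1 : j%:~R < (1 : R) by rewrite -(ltrD2l t) -e (lt_le_trans t1') // lerDr.
  have jm1 : - (1 : R) < j%:~R by rewrite -(ltrD2l t) -e (lt_le_trans _ t0') // subr_lt0.
  have {}j1 : (j < 1)%R by rewrite -(ltr_int R).
  have {}jm1 : (-1 < j)%R by rewrite -(ltr_int R) mulrN1z.
  by apply/eqP; rewrite eq_le -ltzD1 add0r j1 /= -(addNr (1 : int)) lezD1.
- apply/seteqP; split=> [_ [t _ <-]|_ [th _ <-]]; first by exists (2 * pi * t).
  by exists (th / (2 * pi)) => //; rewrite mulrCA divff // mulr1.
Qed.

(** I is constant along c, so the velocity of c is orthogonal to grad I and equals tau times the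
    Hamiltonian field of I. Integrating tau from an angle of c 0 gives a candidate phi; the set of
    times where X (J, phi t) = c t is open and closed, and contains 0. *)
Lemma angle_lift J c : 0 < J < Imax ->
  closed_curve_param (range (fun th => X (J, th))) c ->
  exists phi tau : R -> R,
    [/\ forall t, is_derive t (1 : R) phi (tau t), continuous tau, forall t, tau t != 0,
        forall t, X (J, phi t) = c t & forall t, 'D_1 c t = tau t *: nperp I (c t)].
Proof.
move=> hJ [[dc cdc] c1 dc0 _ rc].
have cX t : exists th, X (J, th) = c t.
  have : range c (c t) by exists t.
  by rewrite rc => -[th _ e]; exists th.
have Ic t : I (c t) = J by have [th <-] := cX t; exact: (XD (p := (J, th)) hJ).2.
have D'c t : D' (c t) by have [th <-] := cX t; exact: (streamline_regular (p := (J, th))).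
have g0 t : grad I (c t) != 0.
  by have [th <-] := cX t; exact: (grad_action_neq0 (p := (J, th))).
have dct t : derivable c t 1 by exact/diff_derivable/dc.
have cc : continuous c by move=> t; exact/differentiable_continuous/dc.
have orth t : ('D_1 c t).1 * dx I (c t) + ('D_1 c t).2 * dy I (c t) = 0.
  have [dIc _ _] := dI (D'c t).
  have [_ H] := derive_chain (dct t) dIc.
  have Ej : I \o c = cst J by apply/funext => y /=; exact: Ic.
  have H0 : 'D_('D_1 c t) I (c t) = 0 by rewrite -[LHS]H Ej derive_cst.
  by have := derive_dxdy ('D_1 c t).1 ('D_1 c t).2 dIc; rewrite -surjective_pairing H0 => <-.
pose tau t := (('D_1 c t).2 * dx I (c t) - ('D_1 c t).1 * dy I (c t))
   / (dx I (c t) ^+ 2 + dy I (c t) ^+ 2).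
have P t := orthogonal_parallel (orth t) (g0 t).
have D1c t : 'D_1 c t = tau t *: nperp I (c t).
  by rewrite [LHS]surjective_pairing; exact: (P t).1.
have tau0 t : tau t != 0.
  by apply/eqP => t0; have := dc0 t; rewrite D1c t0 scale0r eqxx.
have ctau : continuous tau.
  move=> t; have [_ cx cy] := dI (D'c t).
  have cx' := @continuous_comp _ _ _ c (dx I) t (cc t) cx.
  have cy' := @continuous_comp _ _ _ c (dy I) t (cc t) cy.
  have cD := cdc 1 t Logic.I.
  have cD1 : {for t, continuous (fun t => ('D_1 c t).1)}.
    by apply: (@continuous_comp _ _ _ ('D_1 c) fst); [exact: cD|exact: cvg_fst].
  have cD2 : {for t, continuous (fun t => ('D_1 c t).2)}.
    by apply: (@continuous_comp _ _ _ ('D_1 c) snd); [exact: cD|exact: cvg_snd].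
  exact (continuous_angular_speed cD1 cD2 cx' cy' (P t).2).
have [phi1 dphi1] := primitive_exists ctau.
have [th0 eth0] := cX 0.
pose phi t := phi1 t + (th0 - phi1 0).
have dphi t : is_derive t (1 : R) phi (tau t).
  by rewrite -[tau t]addr0; apply: is_deriveD.
have cphi : continuous phi.
  by move=> t; have [d _] := dphi t; exact/differentiable_continuous/derivable1_diffP.
pose f t := X (J, phi t).
have cf : continuous f.
  move=> t; apply: (@continuous_comp _ _ _ phi (fun th => X (J, th))); first exact: cphi.
  exact: continuous_streamline.
have opn t : f t = c t -> \forall z \near t, f z = c z.
  move=> ft; have [|th [U [[oU Ux] UD' dth thx UX]]] := branch (D'c t) (th0 := phi t).
    by rewrite Ic.
  have nU : \forall z \near t, U (c z) by apply: cc; exact: open_nbhs_nbhs.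
  have [d /= d0 dU] := (@nbhs_ballP _ _ _ _).1 nU.
  (* Both the local branch along c and phi grow at the rate tau, so their difference stays at its
     value 0 at t. *)
  pose k z := th (c z) - phi z.
  have dk z : ball t d z -> is_derive z (1 : R) k 0.
    move=> /dU Uz; rewrite -(subrr (tau z)); apply: is_deriveB.
    have [dd D1] := derive_chain (dct z) (dth _ Uz).
    apply: DeriveDef; first exact: dd.
    apply: (etrans D1); rewrite D1c deriveE; last exact: dth.
    rewrite linearZ -deriveE; last exact: dth.
    rewrite derive_nperp_action; last exact: dth.
    by rewrite (UX _ Uz).2; exact: mulr1.
  have kt : k t = 0 by rewrite /k thx subrr.
  have bt : ball t d t by exact: ballxx.
  near=> z.
  have bz : ball t d z by near: z; exact: nbhsx_ballx.
  have kz : k z = 0.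
    have bI y : Num.min t z <= y <= Num.max t z -> ball t d y.
      move: bz; rewrite -!ball_normE /ball_ /= => bz /andP[y1 y2].
      move: bz y1 y2; rewrite !ltr_norml ltrBlDr ltrBrDr => /andP[b1 b2].
      by case: (leP t z) => tz y1 y2; apply/andP; split; lra.
    have [tz|zt] := leP t z.
      rewrite -kt; apply/esym/(derive0_cst tz) => y yz; apply/dk/bI.
      by rewrite (min_idPl tz) (max_idPr tz).
    rewrite -kt; apply: (derive0_cst (ltW zt)) => y yz; apply/dk/bI.
    by rewrite (min_idPr (ltW zt)) (max_idPl (ltW zt)).
  have phz : phi z = th (c z) by apply/esym/eqP; rewrite -subr_eq0 -/(k z) kz.
  by rewrite /f phz -(Ic z); have [] := UX _ (dU _ bz).
have cls t : f t <> c t -> \forall z \near t, f z <> c z.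
  exact: near_neq (cf t) (cc t).
have all t : f t = c t.
  apply: (clopen_line (P := fun t => f t = c t)) => //.
  by rewrite /f /phi addrC subrK.
by exists phi, tau.
Unshelve. all: by end_near. Qed.

(* The weight m contains the winding number of c and the ratio |grad I| / |grad psi|;
   neither has to be known, since m cancels in averages. *)
Lemma closed_curve_weight J c : 0 < J < Imax ->
  closed_curve_param (range (fun th => X (J, th))) c ->
  exists2 m : R, m != 0 & forall u : plane -> R,
    (forall th, {for X (J, th), continuous u}) ->
    \int[mu]_(t in `[0, 1]) (u (c t) / enorm (grad psi (c t)) * enorm ('D_1 c t))
    = m * \int[mu]_(th in `[0, 2 * pi]) u (X (J, th)).
Proof.
move=> hJ hc; have [phi [tau [dphi ctau tau0 Xphi D1c]]] := angle_lift hJ hc.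
have [k k0 gk] := grad_streamfunction hJ.
have [_ c1 _ _ _] := hc.
have cphi : continuous phi.
  by move=> t; have [d _] := dphi t; exact/differentiable_continuous/derivable1_diffP.
have [j phij] : exists j : int, phi 1 = phi 0 + j%:~R * (2 * pi).
  by apply/(perX _ _ hJ); rewrite !Xphi -[in RHS](add0r 1) c1.
have W01 (h : R -> R) : continuous h -> {within `[0, 1], continuous h}.
  by move=> ch; exact: continuous_subspaceT.
(* Winding number 0 would give phi equal values at 0 and 1, hence a zero of the angular speed. *)
have j0 : j%:~R != 0 :> R.
  have [z _ e] := MVT ltr01 (fun t _ => dphi t) (W01 _ cphi).
  apply/eqP => j0; move: e; rewrite phij j0 mul0r addr0 subrr subr0 mulr1 => e.
  by have := tau0 z; rewrite -e eqxx.
(* A continuous function without zeros keeps its sign, so the absolute value in the arclength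
   element is a constant factor. *)
have [s s0 stau] : exists2 s : R, s != 0 & forall t, 0 <= t <= 1 -> `|tau t| = s * tau t.
  have same t : 0 <= t <= 1 -> 0 < tau 0 * tau t.
    move=> /andP[t0 t1]; rewrite lt_def mulf_neq0 //= leNgt; apply/negP => neg.
    have [|z _ z0] := IVT (f := tau) (v := 0) t0 (continuous_subspaceT ctau).
      rewrite ge_min le_max; have [a0|a0] := ltP 0 (tau 0).
        by move: neg; rewrite pmulr_rlt0 // => /ltW ->; rewrite (ltW a0) orbT.
      have a1 : tau 0 < 0 by rewrite lt_neqAle tau0.
      by move: neg; rewrite nmulr_rlt0 // => /ltW ->; rewrite orbT.
    by have := tau0 z; rewrite z0 eqxx.
  exists (Num.sg (tau 0)); first by rewrite sgr_eq0.
  move=> t /same; have [p|n|e] := ltrgtP 0 (tau 0); last by rewrite -e mul0r ltxx.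
    by rewrite pmulr_rgt0 // => /gtr0_norm ->; rewrite gtr0_sg // mul1r.
  by rewrite nmulr_rgt0 // => /ltr0_norm ->; rewrite ltr0_sg // mulN1r.
(* The arclength element is s tau |grad I| dt and the density is 1 / (|k| |grad I|), which leaves s
   / |k| times tau dt; the substitution phi then covers j periods of the angle. *)
exists (s / `|k| * j%:~R).
  by rewrite !mulf_neq0 // invr_eq0 normr_eq0.
move=> u cu; pose w th := u (X (J, th)).
have cw : continuous w.
  move=> th; apply: (@continuous_comp _ _ _ (fun th => X (J, th)) u); last exact: cu.
  exact: continuous_streamline.
have [H dH] := primitive_exists cw.
have cH : continuous H.
  by move=> t; have [d _] := dH t; exact/differentiable_continuous/derivable1_diffP.
have wper t : w (t + 2 * pi) = w t.
  congr u; apply/esym/(perX _ _ hJ); exists 1; by rewrite mul1r.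
have pi20 : 0 < 2 * pi :> R by rewrite mulr_gt0 // pi_gt0.
have IH : \int[mu]_(th in `[0, 2 * pi]) w th = H (2 * pi) - H 0.
  apply: Rintegral_FTC2 => //.
    exact: continuous_subspaceT.
  exact: continuous_subspaceT.
have Hj : H (phi 1) - H (phi 0) = j%:~R * \int[mu]_(th in `[0, 2 * pi]) w th.
  by rewrite IH phij; exact: periodic_primitive dH wper _ _.
have dHphi t : is_derive t (1 : R) (H \o phi) (w (phi t) * tau t).
  have [d1 e1] := dphi t; have [d2 e2] := dH (phi t).
  have d2' : differentiable H (phi t) by exact/derivable1_diffP.
  have [dd e] := derive_chain d1 d2'.
  apply: DeriveDef; first exact: dd.
  apply: (etrans e); rewrite e1 deriveE // -[X in 'd _ _ X]mulr1 linearZ -deriveE // e2.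
  exact: mulrC.
have cint : continuous (fun t => w (phi t) * tau t).
  move=> t; apply: cvgM; last exact: ctau.
  by apply: (@continuous_comp _ _ _ phi w); [exact: cphi|exact: cw].
have I1 : \int[mu]_(t in `[0, 1]) (w (phi t) * tau t) = H (phi 1) - H (phi 0).
  apply: (Rintegral_FTC2 (F := H \o phi)) => //.
    exact: W01.
  apply: W01 => t; apply: (@continuous_comp _ _ _ phi H); [exact: cphi|exact: cH].
rewrite -mulrA -Hj -I1 -RintegralZl //; last by apply: itv_integrable => t _; exact: cint.
apply: eq_Rintegral => t; rewrite inE /= in_itv /= => t01.
rewrite D1c enormZ enorm_nperp -Xphi gk enormZ stau // /w.
have g0 : enorm (grad I (X (J, phi t))) != 0.
  by rewrite enorm_eq0; exact: (grad_action_neq0 (p := (J, phi t))).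
rewrite invfM.
have -> : forall a b c d e : R, e != 0 -> a * (b * e^-1) * (c * d * e) = c * b * (a * d).
  by move=> a b c' d e e0; field.
  by [].
exact: g0.
Qed.

(** The nonzero weight m appears in both integrals of the quotient and cancels; the denominator
    leaves the length 2 pi of a period. *)
Lemma average_angle_mean J th u : 0 < J < Imax ->
  (forall th, {for X (J, th), continuous u}) ->
  average D psi u (X (J, th)) = angle_mean (fun th => u (X (J, th))).
Proof.
move=> hJ cu; have [_ g0] := streamline_regular (p := (J, th)) hJ.
rewrite /average (negbTE g0) /streamline_integral /arclength_integral streamline_eq //.
have hc := xgetPex (cst 0) (ex_intro _ _ (streamline_param hJ)).
set c := xget _ _ in hc *.
have [m m0 Hm] := closed_curve_weight hJ hc.
rewrite (Hm u cu) (Hm (cst 1)); last by move=> t; exact: cvg_cst.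
have pi20 : 0 < 2 * pi :> R by rewrite mulr_gt0 // pi_gt0.
have c1 a : \int[mu]_(th in `[0, 2 * pi]) cst 1 (a th : plane) = 2 * pi :> R.
  have W1 : {within `[0, 2 * pi], continuous (cst 1 : R -> R)}.
    by apply: within_itv_continuous => t _; exact: cvg_cst.
  have W2 : {within `[0, 2 * pi], continuous (id : R -> R)}.
    by apply: within_itv_continuous => t _; exact: cvg_id.
  have W3 t : 0 < t < 2 * pi -> is_derive t (1 : R) id (cst 1 t : R).
    by move=> _; exact: is_derive_id.
  exact: (etrans (Rintegral_FTC2 pi20 W1 W2 W3) (subr0 _)).
by rewrite c1 /angle_mean -mulf_div divff // mul1r mulrC.
Qed.

End Streamlines.

(** * The natural connection *)

Local Opaque derive.

(** * The form dS - x dy and transport of functions *)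

Section PlaneValued.
Context {R : realType}.
Implicit Types E : normedModType R.
Notation plane := (R * R)%type.

Lemma is_derive_component1 E (f : E -> plane) x v : derivable f x v ->
  is_derive x v (fun z => (f z).1) ('D_v f x).1.
Proof.
move=> df; have dl : differentiable (fst : plane -> R) (f x).
  by apply: linear_differentiable => z; exact: cvg_fst.
have [d e] := derive_chain df dl; apply: DeriveDef; first exact: d.
apply: (etrans e); rewrite deriveE // diff_lin //.
by move=> z; exact: cvg_fst.
Qed.

Lemma is_derive_component2 E (f : E -> plane) x v : derivable f x v ->
  is_derive x v (fun z => (f z).2) ('D_v f x).2.
Proof.
move=> df; have dl : differentiable (snd : plane -> R) (f x).
  by apply: linear_differentiable => z; exact: cvg_snd.
have [d e] := derive_chain df dl; apply: DeriveDef; first exact: d.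
apply: (etrans e); rewrite deriveE // diff_lin //.
by move=> z; exact: cvg_snd.
Qed.

Lemma schwarz_plane E (U : set E) (f : E -> plane) (v w x : E) : open U -> Ck 2 U f ->
  U x -> 'D_v ('D_w f) x = 'D_w ('D_v f) x.
Proof.
move=> oU [df d2f] Ux.
have D1 (h : E -> plane) u y : differentiable h y ->
    is_derive y u (fun z => (h z).1) ('D_u h y).1.
  by move=> dh; exact/is_derive_component1/diff_derivable.
have D2 (h : E -> plane) u y : differentiable h y ->
    is_derive y u (fun z => (h z).2) ('D_u h y).2.
  by move=> dh; exact/is_derive_component2/diff_derivable.
have ddf u y : U y -> differentiable ('D_u f) y by have [+ _] := d2f u; exact.
have cddf u u' : {for x, continuous ('D_u' ('D_u f))}.
  by have [_ /(_ u') c] := d2f u; exact: c.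
have cddf1 u u' : {for x, continuous (fun z => ('D_u' ('D_u f) z).1)}.
  by apply: (@continuous_comp _ _ _ ('D_u' ('D_u f)) fst); [exact: cddf|exact: cvg_fst].
have cddf2 u u' : {for x, continuous (fun z => ('D_u' ('D_u f) z).2)}.
  by apply: (@continuous_comp _ _ _ ('D_u' ('D_u f)) snd); [exact: cddf|exact: cvg_snd].
have pair_eq (p q : plane) : p.1 = q.1 -> p.2 = q.2 -> p = q.
  by case: p q => [a b] [a' b'] /= -> ->.
apply: pair_eq.
  apply: (@mixed_derivatives R E U (fun z => (f z).1) (fun z => ('D_w f z).1)
   (fun z => ('D_v f z).1) (fun z => ('D_v ('D_w f) z).1)
   (fun z => ('D_w ('D_v f) z).1) w v x oU Ux) => [y Uy|y Uy|y Uy|y Uy||].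
  - exact/D1/df.
  - exact/D1/df.
  - exact/D1/ddf.
  - exact/D1/ddf.
  - exact: cddf1.
  - exact: cddf1.
apply: (@mixed_derivatives R E U (fun z => (f z).2) (fun z => ('D_w f z).2)
   (fun z => ('D_v f z).2) (fun z => ('D_v ('D_w f) z).2)
   (fun z => ('D_w ('D_v f) z).2) w v x oU Ux) => [y Uy|y Uy|y Uy|y Uy||].
- exact/D2/df.
- exact/D2/df.
- exact/D2/ddf.
- exact/D2/ddf.
- exact: cddf2.
- exact: cddf2.
Qed.

Lemma is_derive_submul E (f a b : E -> R) q v (df da db : R) :
  is_derive q v f df -> is_derive q v a da -> is_derive q v b db ->
  is_derive q v (fun z => f z - a z * b z) (df - (a q * db + b q * da)).
Proof. by move=> hf ha hb; apply: is_deriveB; exact: is_deriveM. Qed.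

(* The one-form dS - x dy. *)
Definition generating_form E (X : E -> plane) (S : E -> R) (v : E) (q : E) : R :=
  'D_v S q - (X q).1 * ('D_v X q).2.

Lemma is_derive_generating_form E (O : set E) (X : E -> plane) (S : E -> R) v w q :
  smooth_on O X -> smooth_on O S -> O q ->
  is_derive q v (generating_form X S w)
    ('D_v ('D_w S) q - ((X q).1 * ('D_v ('D_w X) q).2 + ('D_w X q).2 * ('D_v X q).1)).
Proof.
move=> sX sS Oq.
have d1 := diff_derivable (v := v) (smooth_differentiable (smooth_derive w sS) Oq).
have d2 := diff_derivable (v := v) (smooth_differentiable sX Oq).
have d3 := diff_derivable (v := v) (smooth_differentiable (smooth_derive w sX) Oq).
exact: (is_derive_submul (derivableP d1) (is_derive_component1 d2) (is_derive_component2 d3)).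
Qed.

(** This is d(dS - x dy) = -dx /\ dy on the directions v and w: the second derivatives of S and of y
    drop out by symmetry. *)
Lemma generating_form_closed E (O : set E) (X : E -> plane) (S : E -> R) v w q : open O ->
  smooth_on O X -> smooth_on O S -> O q ->
  'D_v (generating_form X S w) q - 'D_w (generating_form X S v) q
  = ('D_w X q).1 * ('D_v X q).2 - ('D_v X q).1 * ('D_w X q).2.
Proof.
move=> oO sX sS Oq.
have [_ e1] := is_derive_generating_form v w sX sS Oq.
have [_ e2] := is_derive_generating_form w v sX sS Oq.
have h1 := schwarz v w oO (sS 2) Oq.
have h2 := schwarz_plane v w oO (sX 2) Oq.
apply: (etrans (congr2 (fun a b => a - b) e1 e2)).
have A (a b c d1 d2 d3 d4 p q' : R) : a = b -> p = q' ->
  a - (c * p + d1 * d2) - (b - (c * q' + d3 * d4)) = d4 * d3 - d2 * d1.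
  by move=> -> ->; ring.
by apply: A; [exact: h1|exact: (congr1 snd h2)].
Qed.

Lemma C1_generating_form E (O : set E) (X : E -> plane) (S : E -> R) v :
  finite_basis E -> open O -> smooth_on O X -> smooth_on O S ->
  C1 O (generating_form X S v).
Proof.
move=> fE oO sX sS.
have CX : C1 O X by exact: smooth_C1.
have CDX : C1 O ('D_v X) by apply: smooth_C1 => //; exact: smooth_derive.
have CDS : C1 O ('D_v S) by apply: smooth_C1 => //; exact: smooth_derive.
have C1X : C1 O (fun q => (X q).1).
  exact: (C1_comp CX (C1_fst (U := setT)) (fun _ _ => Logic.I) oO).
have C2X : C1 O (fun q => ('D_v X q).2).
  exact: (C1_comp CDX (C1_snd (U := setT)) (fun _ _ => Logic.I) oO).
have -> : generating_form X S v = fun q => 'D_v S q + cst (-1) q * ((X q).1 * ('D_v X q).2).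
  by apply/funext => q; rewrite /generating_form /= mulN1r.
apply: C1_add; [exact: oO|exact: CDS|].
apply: C1_mul; [exact: oO|exact: C1_cst|].
by apply: C1_mul; [exact: oO|exact: C1X|exact: C2X].
Qed.

(** The first term is the derivative at fixed x, the bracketed terms the convection by X; this is
    the passage from fixed x to fixed action and angle. *)
Lemma is_derive_transport E (f : E * plane -> R) (X : E * plane -> plane) v q :
  differentiable X q -> differentiable f (q.1, X q) ->
  is_derive q v (fun q => f (q.1, X q))
    ('D_(v.1) (fun z => f (z, X q)) q.1
     + (('D_v X q).1 * dx (fun x => f (q.1, x)) (X q)
        + ('D_v X q).2 * dy (fun x => f (q.1, x)) (X q))).
Proof.
move=> dX df.
have d1 : differentiable (fst : E * plane -> E) q.
  by apply: linear_differentiable => z; exact: cvg_fst.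
have e1 : 'D_v (fst : E * plane -> E) q = v.1.
  by rewrite deriveE // diff_lin // => z; exact: cvg_fst.
have [dp ep] := derive_pair (diff_derivable (v := v) d1) (diff_derivable (v := v) dX).
have [dc ec] := derive_chain dp df.
apply: DeriveDef; first exact: dc.
apply: (etrans ec); rewrite ep e1.
apply: (etrans (derive_pairD _ _ df)); rewrite -derive_fst -derive_snd.
congr (_ + _); rewrite [X in 'D_X _ _]surjective_pairing; apply: derive_dxdy.
exact: differentiable_snd_line.
Qed.

End PlaneValued.

(** * Openness of the family of domains *)

Section OpenFamily.
Context {R : realType}.
Notation plane := (R * R)%type.

Lemma segment_in_ball (V : normedModType R) (x y z : V) (e t : R) :
  ball x e y -> ball x e z -> 0 <= t <= 1 -> ball x e (y + t *: (z - y)).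
Proof.
rewrite -!ball_normE /ball_ /= => hy hz /andP[t0 t1].
have -> : x - (y + t *: (z - y)) = (1 - t) *: (x - y) + t *: (x - z).
  have -> : (1 - t) *: (x - y) + t *: (x - z) = (x - y) + t *: ((x - z) - (x - y)).
    by rewrite scalerBl scale1r addrAC -addrA -scalerBr.
  by rewrite opprB [x - z + _]addrC subrKA opprD addrA -scalerN opprB.
rewrite (le_lt_trans (ler_normD _ _)) // !normrZ (ger0_norm t0) ger0_norm ?subr_ge0 //.
have [->|tp] := eqVneq t 0; first by rewrite subr0 mul1r mul0r addr0.
have tgt : 0 < t by rewrite lt_def tp.
have -> : e = (1 - t) * e + t * e by rewrite -mulrDl subrK mul1r.
rewrite ler_ltD // ?ltr_pM2l // ler_wpM2l ?subr_ge0 // ltW //.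
Qed.

(** Along the segment from y to z, membership in A is an open condition, and a closed one as long as
    no boundary point is met. The parameter is clamped so that the path is defined on the whole
    line. *)
Lemma ball_sub_open (A : set plane) (x y : plane) (e : R) : open A ->
  ball x e y -> A y -> (forall z, ball x e z -> ~ boundary A z) -> ball x e `<=` A.
Proof.
move=> oA hy Ay nb z hz.
have iA : interior A = A by exact/interior_id.
pose c (t : R) := y + clamp 0 1 t *: (z - y).
have cl (t : R) : 0 <= clamp 0 1 t <= 1 by exact: clamp_itv.
have cb t : ball x e (c t) by exact: segment_in_ball.
have cc : continuous c.
  move=> t; apply: cvgD; first exact: cvg_cst.
  by apply: cvgZ; [exact: continuous_clamp|exact: cvg_cst].
have P0 : A (c 0).
  by rewrite /c clamp_id ?lexx ?ler01 // scale0r addr0.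
have H : forall t, A (c t).
  apply: clopen_line => // t At; first by apply: cc; exact: open_nbhs_nbhs.
  have nc : ~ closure A (c t).
    by move=> cA; apply: (nb (c t) (cb t)); split=> //; rewrite iA.
  have NA : nbhs (c t) (~` closure A).
    by apply: open_nbhs_nbhs; split=> //; apply: closed_openC; exact: closed_closure.
  have Nt : nbhs t (c @^-1` (~` closure A)) := cc t _ NA.
  by apply: filterS Nt => s /= nA As; apply: nA; exact: subset_closure.
by have := H 1; rewrite /c clamp_id ?lexx ?ler01 // scale1r addrC subrK.
Qed.

(** Near (lam0, x0) the function B has no zeros, so a whole ball around x0 misses the boundary of D
    lam for lam near lam0. That alone could place the ball outside D lam; but g lam y, with y the
    preimage of x0 at lam0, lies in D lam and stays in the ball. *)
Lemma family_open n (L : set 'rV[R]_n) (D : 'rV[R]_n -> set plane) B g ginv :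
  open L -> L 0 -> domain_family L D B -> diffeo_family L D g ginv -> open (family_set L D).
Proof.
move=> oL L0 [hD _ sB bB _] [sg _ _ gK _].
rewrite openE => -[lam0 x0] [/= Ll0 Dx0].
have oD lam : L lam -> open (D lam) by move=> /hD[].
have nbd lam x : L lam -> D lam x -> ~ boundary (D lam) x.
  move=> Ll Dx [_]; have -> // : interior (D lam) = D lam by exact/interior_id/oD.
have B0 : B lam0 x0 != 0.
  apply/eqP => b0; apply: (nbd lam0 x0) => //.
  by rewrite bB.
have cB : {for (lam0, x0), continuous (fun q => `|curry2 B q|)}.
  apply: cvg_norm; apply: (smooth_continuous sB); by split.
have SB : nbhs `|curry2 B (lam0, x0)| [set r : R | 0 < r].
  by apply: lt_nbhsr; rewrite normr_gt0.
have N1 : nbhs (lam0, x0) [set q | 0 < `|curry2 B q|] := cB _ SB.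
have N2 : nbhs lam0 L by exact: open_nbhs_nbhs.
have [_ gK2] := gK _ Ll0; have [Dy gy] := gK2 _ Dx0.
set y := ginv lam0 x0 in Dy gy.
have [U [oU sU Ug]] := sg.
have Uy : U (lam0, y) by apply: sU; split => //=; exact: subset_closure.
have cg : {for lam0, continuous (fun lam => g lam y)}.
  exact: differentiable_continuous (differentiable_fst_line (smooth_differentiable Ug Uy)).
have [e /= e0 eP] := (@nbhs_ballP _ _ _ _).1 N1.
have Sg : nbhs (g lam0 y) (ball x0 e) by rewrite gy; exact: nbhsx_ballx.
have N3 : nbhs lam0 [set lam | ball x0 e (g lam y)] := cg _ Sg.
have N4 : nbhs lam0 (ball lam0 e) by exact: nbhsx_ballx.
have N5 : nbhs lam0 (L `&` ([set lam | ball x0 e (g lam y)] `&` ball lam0 e)).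
  by apply: filterI => //; exact: filterI.
exists (L `&` ([set lam | ball x0 e (g lam y)] `&` ball lam0 e), ball x0 e).
  by split => //=; exact: nbhsx_ballx.
move=> [lam x] [/= [Ll [hg hl]] hx]; split => //=.
apply: (ball_sub_open (y := g lam y) (oD _ Ll) hg) => //.
  by have [/(_ y Dy)[]] := gK _ Ll.
move=> z hz; rewrite bB //= => bz.
have bl : ball (lam0, x0) e (lam, z) by split.
by have := eP _ bl; rewrite /= /curry2 /= bz normr0 ltxx.
Qed.

End OpenFamily.

(** * Algebra of means and brackets *)

Section Algebra.
Context {R : realType}.

Lemma angle_mean_affine (f h : R -> R) (a : R) :
  continuous f -> continuous h ->
  angle_mean (fun t => f t + (a - h t)) = angle_mean f - angle_mean h + a.
Proof.
move=> cf ch; rewrite /angle_mean.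
have pi20 : 0 < 2 * pi :> R by rewrite mulr_gt0 // pi_gt0.
have If : lebesgue_measure.-integrable `[0, 2 * pi] (EFin \o f) by apply: itv_integrable => t _; exact: cf.
have Ih : lebesgue_measure.-integrable `[0, 2 * pi] (EFin \o h) by apply: itv_integrable => t _; exact: ch.
have Ia : lebesgue_measure.-integrable `[0, 2 * pi] (EFin \o (cst a : R -> R)).
  by apply: itv_integrable => t _; exact: cvg_cst.
have Iah : lebesgue_measure.-integrable `[0, 2 * pi] (EFin \o (fun t => a - h t)).
  by apply: itv_integrable => t _; apply: cvgB; [exact: cvg_cst|exact: ch].
rewrite RintegralD // RintegralB //.
have -> : \int[lebesgue_measure]_(t in `[0, 2 * pi]) a = 2 * pi * a.
  have W1 : {within `[0, 2 * pi], continuous (cst a : R -> R)}.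
    by apply: within_itv_continuous => t _; exact: cvg_cst.
  have dI (t : R) : is_derive t (1 : R) (fun t => t * a) a.
    rewrite -[X in is_derive _ _ _ X]addr0 -[X in is_derive _ _ _ (X + _)]mul1r.
    have := is_deriveM (is_derive_id t (1 : R)) (is_derive_cst a t (1 : R)).
    by move=> [d e]; apply: DeriveDef; [exact: d|apply: (etrans e); rewrite /GRing.scale /=; ring].
  have W2 : {within `[0, 2 * pi], continuous (fun t : R => t * a)}.
    by apply: within_itv_continuous => t _; have [d _] := dI t; exact/differentiable_continuous/derivable1_diffP.
  have := Rintegral_FTC2 pi20 W1 W2 (fun t _ => dI t).
  by rewrite mul0r subr0.
by rewrite mulrDr mulrBr mulKf ?gt_eqF // addrA addrAC.
Qed.

(** Two plane vectors orthogonal to the same nonzero w are parallel. With w tangent to the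
    streamline and u, v gradients of components of N - Phi, this makes their bracket vanish. *)
Lemma orthogonal_cross (w1 w2 u1 u2 v1 v2 : R) : w1 * u1 + w2 * u2 = 0 ->
  w1 * v1 + w2 * v2 = 0 -> (w1, w2) != 0 -> u1 * v2 = v1 * u2.
Proof.
move=> hu hv w0; apply/eqP; rewrite -subr_eq0.
have e1 : w1 * (u1 * v2 - v1 * u2) = 0.
  have -> : w1 * (u1 * v2 - v1 * u2) = (w1 * u1 + w2 * u2) * v2 - (w1 * v1 + w2 * v2) * u2 by ring.
  by rewrite hu hv !mul0r subrr.
have e2 : w2 * (u1 * v2 - v1 * u2) = 0.
  have -> : w2 * (u1 * v2 - v1 * u2) = (w1 * v1 + w2 * v2) * u1 - (w1 * u1 + w2 * u2) * v1 by ring.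
  by rewrite hu hv !mul0r subrr.
apply/negPn/negP => n0; case/negP: w0.
move/eqP: e1; rewrite mulf_eq0 (negbTE n0) orbF => /eqP ->.
by move/eqP: e2; rewrite mulf_eq0 (negbTE n0) orbF => /eqP ->.
Qed.

(** Here (am, bm) and (pm, qm) are the gradients of N_m and Phi_m, and likewise for k; P and Q are
    derivatives at fixed x, g1 and g2 those of dS - x dy. The first hypothesis is
    [N_m - Phi_m, N_k - Phi_k] = 0. The factor 1/2 compensates that the bracket wedge counts
    [N_m, N_k] twice. *)
Lemma curvature_algebra (P Q am bm ak bk pm qm pk qk g1 g2 : R) :
  (am - pm) * (bk - qk) = (ak - pk) * (bm - qm) ->
  g1 - g2 = - qk * pm - (- qm) * pk ->
  P - Q + 2^-1 * ((am * bk - ak * bm) - (ak * bm - am * bk))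
  = (P + (- qm * ak + pm * bk) + g1) - (Q + (- qk * am + pk * bm) + g2).
Proof.
move=> h hg; have -> : g1 = g2 + (- qk * pm - (- qm) * pk) by rewrite -hg addrC subrK.
have -> : (am * bk - ak * bm) - (ak * bm - am * bk) = 2 * (am * bk - ak * bm) by ring.
rewrite mulKf ?pnatr_eq0 //.
have -> : am * bk - ak * bm = ((am - pm) * (bk - qk) - (ak - pk) * (bm - qm))
  + (am * qk + pm * bk - pm * qk - ak * qm - pk * bm + pk * qm) by ring.
by rewrite h subrr; ring.
Qed.

Lemma zero_not_positive (r s : R) : r = 0 -> ~ (0 < r < s).
Proof. by move=> ->; rewrite ltxx. Qed.

End Algebra.

(** * Curvature in action-angle variables and the geometric angle *)

Section Family.
Context {R : realType} {n : nat}.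
Notation param := 'rV[R]_n.
Notation plane := (R * R)%type.
Variables (L : set param) (D : param -> set plane) (B psi : param -> plane -> R)
  (G F : param -> R -> R) (g ginv : param -> plane -> plane)
  (Phi beta Psi : param -> 'I_n -> plane -> R)
  (X : param -> plane -> plane) (Shat : param -> plane -> R).
Hypotheses (hL : open L) (hL0 : L 0)
  (hD : domain_family L D B)
  (hpsi : steady_family L D psi G F)
  (hg : diffeo_family L D g ginv)
  (hH1 : forall lam, L lam -> elliptic_stable (D lam) (psi lam) (G lam))
  (hPhi : generator_form L D g Phi)
  (hPsi : first_order_form L D psi F Phi beta Psi)
  (hsmooth : smooth_on (family_set L D)
     (fun p => \row_m natural_form D psi Phi Psi p.1 m p.2))
  (hX : action_angle L D psi g X)
  (hS : generating_function L D X Shat).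

Let N := natural_form D psi Phi Psi.
Let O : set (param * plane) := family_set L (fun=> action_angle_set D).
(** [em m] moves the parameter at fixed (I, theta), and [et] moves theta alone; treating all
    variables as one puts Hamilton's equations and the symmetry of second derivatives on the same
    footing. *)
Let em (m : 'I_n) : param * plane := (delta_mx 0 m, 0).
Let et : param * plane := (0, (0, 1)).
Let I lam := action (D lam) (psi lam).
Let D' lam := [set x | D lam x /\ grad (psi lam) x != 0].

Lemma finite_basis_family : finite_basis (param * plane)%type.
Proof.
apply: finite_basis_pair; first exact: finite_basis_row.
by apply: finite_basis_pair; exact: finite_basis_R.
Qed.

Lemma open_action_angle : open (action_angle_set D).
Proof.
rewrite openE => -[J th] /= hJ; rewrite /action_angle_set /= in hJ.
have J1 : J \in `]0, action_max D[ by rewrite in_itv.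
have NJ : nbhs J [set y | 0 < y < action_max D].
  by apply: filterS (near_in_itvoo J1) => y; rewrite in_itv.
have c : (fst : plane -> R) @ (J, th) --> J by exact: cvg_fst.
exact: (c _ NJ).
Qed.

Lemma open_action_angle_family : open O.
Proof.
rewrite openE => -[lam p] [/= Ll Ap].
exists (L, action_angle_set D); last by move=> [l q] [].
split; apply: open_nbhs_nbhs; split => //; exact: open_action_angle.
Qed.

Lemma smooth_X : smooth_on O (curry2 X). Proof. by have [[]] := hX. Qed.

Lemma smooth_Shat : smooth_on O (curry2 Shat). Proof. by have [] := hS. Qed.

Lemma open_domain lam : L lam -> open (D lam).
Proof. by have [H _ _ _ _] := hD; move=> /H[]. Qed.

Lemma differentiable_psi lam x : L lam -> closure (D lam) x -> differentiable (psi lam) x.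
Proof.
have [[U [oU sU Us]] _ _ _ _] := hpsi; move=> Ll Dx.
have Ux : U (lam, x) by apply: sU.
exact: differentiable_snd_line (smooth_differentiable Us Ux).
Qed.

Lemma unique_critical lam x y : L lam -> D lam x -> D lam y ->
  grad (psi lam) x = 0 -> grad (psi lam) y = 0 -> x = y.
Proof.
by move=> Ll Dx Dy gx gy; have [[x0 [_ _ _ u]] _] := hH1 Ll; rewrite (u x) // (u y).
Qed.

(** The level set through the critical point is that point alone, and a point encloses nothing. *)
Lemma action_critical_point lam x : L lam -> D lam x -> grad (psi lam) x = 0 -> I lam x = 0.
Proof.
move=> Ll Dx gx; apply: action_critical => //.
have [H _ _ _ _] := hD; have [_ _ _ bD _] := H _ Ll.
have [_ _ _ b0 _] := hpsi.
apply: (critical_level_set (open_domain Ll) bD) => //.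
- by move=> y; exact: differentiable_psi.
- by move=> y; exact: b0.
- by move=> y Dy gy; exact: unique_critical gy gx.
Qed.

Lemma derivatives_action lam x : L lam -> D' lam x ->
  [/\ differentiable (I lam) x, {for x, continuous (dx (I lam))} & {for x, continuous (dy (I lam))}].
Proof.
move=> Ll D'x; have [[sI _] _ _ _ _] := hX.
have Ux : family_set L D' (lam, x) by [].
have c (v : param * plane) : {for x, continuous (fun y => 'D_v (curry2 I) (lam, y))}.
  have d := smooth_differentiable (smooth_derive v sI) Ux.
  exact: differentiable_continuous (differentiable_snd_line d).
split.
- exact: differentiable_snd_line (smooth_differentiable sI Ux).
- have -> : dx (I lam) = fun y => 'D_((0, (1, 0)) : param * plane) (curry2 I) (lam, y).
    by apply/funext => y; exact: (derive_snd (curry2 I)).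
  exact: c.
- have -> : dy (I lam) = fun y => 'D_((0, (0, 1)) : param * plane) (curry2 I) (lam, y).
    by apply/funext => y; exact: (derive_snd (curry2 I)).
  exact: c.
Qed.

Lemma differentiable_curryX lam p : L lam -> 0 < p.1 < action_max D ->
  differentiable (curry2 X) (lam, p).
Proof.
move=> Ll hp; have Oq : O (lam, p) by [].
exact: (smooth_differentiable smooth_X Oq).
Qed.

Lemma differentiable_X lam p : L lam -> 0 < p.1 < action_max D -> differentiable (X lam) p.
Proof. by move=> Ll hp; exact: differentiable_snd_line (differentiable_curryX Ll hp). Qed.

Lemma X_domain lam p : L lam -> 0 < p.1 < action_max D -> D lam (X lam p) /\ I lam (X lam p) = p.1.
Proof. by move=> Ll hp; have [_ H _ _ _] := hX; have [] := H _ _ Ll hp. Qed.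

Lemma X_surjective lam x : L lam -> D' lam x ->
  0 < I lam x < action_max D /\ exists th, X lam (I lam x, th) = x.
Proof. by have [_ _ H _ _] := hX; exact: H. Qed.

Lemma X_period lam : L lam -> forall J th th', 0 < J < action_max D ->
  X lam (J, th) = X lam (J, th') <-> exists j : int, th' = th + j%:~R * (2 * pi).
Proof. by have [_ _ _ H _] := hX => Ll J th th' hJ; exact: H. Qed.

Lemma X_branch lam : L lam -> forall x th0, D' lam x -> X lam (I lam x, th0) = x ->
  exists th : plane -> R, exists U : set plane,
   [/\ open U /\ U x, U `<=` D' lam, (forall y, U y -> differentiable th y), th x = th0
     & forall y, U y -> X lam (I lam y, th y) = y /\ bracket (I lam) th y = 1].
Proof.
move=> Ll x th0 D'x ex; have [_ _ _ _ H] := hX.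
have [th [U [oU UD' st thx HU]]] := H _ _ _ Ll D'x ex.
by exists th, U; split=> // y; exact: smooth_differentiable.
Qed.

Lemma average_X lam J th u : L lam -> 0 < J < action_max D ->
  (forall th, {for X lam (J, th), continuous u}) ->
  average (D lam) (psi lam) u (X lam (J, th)) = angle_mean (fun th => u (X lam (J, th))).
Proof.
move=> Ll hJ cu; apply: (@average_angle_mean _ (D lam) (psi lam) (X lam) (action_max D)) => //.
- by move=> x Dx; apply: differentiable_psi => //; exact: subset_closure.
- by move=> x; exact: action_critical_point.
- by move=> x; exact: derivatives_action.
- by move=> p; exact: differentiable_X.
- by move=> p; exact: X_domain.
- by move=> x; exact: X_surjective.
- exact: X_period.
- exact: X_branch.
Qed.

Lemma derive_theta_X lam p : L lam -> 0 < p.1 < action_max D ->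
  'D_et (curry2 X) (lam, p) = nperp (I lam) (X lam p) /\ grad (I lam) (X lam p) != 0.
Proof.
move=> Ll hp; split.
  have := @derive_angle _ (D lam) (psi lam) (X lam) (action_max D)
    (fun x => @action_critical_point lam x Ll) (fun x => @derivatives_action lam x Ll)
    (fun p => @differentiable_X lam p Ll) (fun p => @X_domain lam p Ll)
    (X_branch Ll) p hp => <-.
  by rewrite (derive_snd (curry2 X)).
exact: (@grad_action_neq0 _ (D lam) (psi lam) (X lam) (action_max D)
    (fun x => @action_critical_point lam x Ll) (fun p => @X_domain lam p Ll)
    (X_branch Ll) p hp).
Qed.

(** At fixed (I, theta) the point is carried by g: X lam p = g lam (X 0 p) on a neighbourhood of
    lam, so its velocity is the Hamiltonian field of Phi. *)
Lemma derive_param_X lam p m : L lam -> 0 < p.1 < action_max D ->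
  'D_(em m) (curry2 X) (lam, p) = nperp (Phi lam m) (X lam p).
Proof.
move=> Ll hp; rewrite -(derive_fst (curry2 X)).
have [_ H _ _ _] := hX; have [_ dg] := hPhi.
have E : \forall l \near lam, X l p = g l (X 0 p).
  have nL : \forall l \near lam, L l by exact: open_nbhs_nbhs.
  by apply: filterS nL => l Ll'; have [] := H _ _ Ll' hp.
have [DX0 _ _] := H _ _ hL0 hp.
apply: (etrans (near_eq_derive _ E)); apply: (etrans (dg _ _ _ Ll DX0)).
by rewrite -(nbhs_singleton E).
Qed.

(** Away from the folds this is the chain rule for S (I, Y) at fixed I with S_y = x; at the folds
    the relation is part of the definition of the generating function. *)
Lemma derive_Shat lam p : L lam -> 0 < p.1 < action_max D ->
  dy (Shat lam) p = (X lam p).1 * dy (fun p => (X lam p).2) p.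
Proof.
move=> Ll hp; have [_ H1 H2] := hS.
have [d0|d1] := eqVneq (dy (fun p => (X lam p).2) p) 0.
  by have [_] := H2 _ _ Ll hp d0.
have [S [U [[V [oV sV SV]] [oU Up UO HU]]]] := H1 _ _ Ll hp d1.
pose Y p := (X lam p).2.
have Vq : V (lam, (p.1, Y p)) by apply: sV; exists (lam, p).
have dS : differentiable (S lam) (p.1, Y p).
  exact: differentiable_snd_line (smooth_differentiable SV Vq).
have nU : \forall q \near p, U (lam, q).
  have c : {for p, continuous (fun q => (lam, q))}.
    by apply: differentiable_continuous; apply: differentiable_pair.
  by apply: c; exact: open_nbhs_nbhs.
have E : \forall q \near p, Shat lam q = (S lam \o (fun q => (q.1, Y q))) q.
  by apply: filterS nU => q /HU[].
have [_ e1 e2] := HU _ _ Up.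
have df : differentiable (fst : plane -> R) p.
  by apply: linear_differentiable => z; exact: cvg_fst.
have dXp := diff_derivable (v := ((0, 1) : plane)) (differentiable_X Ll hp).
have [dYp eY] := is_derive_component2 dXp.
have [dpr epr] := derive_pair (diff_derivable (v := ((0, 1) : plane)) df) dYp.
have [dc ec] := derive_chain dpr dS.
apply: (etrans (near_eq_derive _ E)); apply: (etrans ec).
rewrite epr derive_dxdy // e1 e2.
have -> : 'D_((0, 1) : plane) (fst : plane -> R) p = 0.
  by rewrite deriveE // diff_lin // => z; exact: cvg_fst.
by rewrite mul0r add0r mulrC.
Qed.

Lemma generating_form_theta q : O q ->
  generating_form (curry2 X) (curry2 Shat) et q = 0.
Proof.
case: q => lam p [/= Ll hp].
have dXp := diff_derivable (v := ((0, 1) : plane)) (differentiable_X Ll hp).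
have [_ e2] := is_derive_component2 dXp.
rewrite /generating_form -(derive_snd (curry2 Shat)) -(derive_snd (curry2 X)).
have -> : 'D_((0, 1) : plane) (fun z => curry2 Shat (lam, z)) p = dy (Shat lam) p by [].
rewrite derive_Shat // /dy e2 /=.
by rewrite subrr.
Qed.

Lemma form_component_C1 (U : set (param * plane)) (A : param -> 'I_n -> plane -> R) m :
  open U -> smooth_on U (fun p => \row_m A p.1 m p.2) -> C1 U (fun q => A q.1 m q.2).
Proof.
move=> oU sA.
have CA := smooth_C1 finite_basis_family oU sA.
have := C1_comp CA (C1_coord (U := setT) m) (fun _ _ => Logic.I) oU.
have -> // : (fun v : 'rV[R]_n => v 0 m) \o (fun p : param * plane => \row_m A p.1 m p.2)
   = fun q => A q.1 m q.2.
by apply/funext => q /=; rewrite mxE.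
Qed.

Lemma open_domain_family : open (family_set L D).
Proof. exact: (family_open hL hL0 hD hg). Qed.

Lemma N_C1 m : C1 (family_set L D) (fun q => N q.1 m q.2).
Proof. exact: form_component_C1 open_domain_family hsmooth. Qed.

Lemma differentiable_near_form (A : param -> 'I_n -> plane -> R) m lam x :
  smooth_near (family_set L (fun lam => closure (D lam))) (fun p => \row_m A p.1 m p.2) ->
  L lam -> D lam x -> differentiable (fun q => A q.1 m q.2) (lam, x).
Proof.
move=> [U [oU sU sA]] Ll Dx; apply: (C1_differentiable (form_component_C1 m oU sA)).
by apply: sU; split => //=; exact: subset_closure.
Qed.

Lemma differentiable_Phi m lam x : L lam -> D lam x ->
  differentiable (fun q => Phi q.1 m q.2) (lam, x).
Proof. by have [sP _] := hPhi; exact: differentiable_near_form. Qed.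

Lemma differentiable_Psi m lam x : L lam -> D lam x ->
  differentiable (fun q => Psi q.1 m q.2) (lam, x).
Proof. by have [sP _ _] := hPsi; exact: differentiable_near_form. Qed.

Lemma differentiable_N m lam x : L lam -> D lam x ->
  differentiable (fun q => N q.1 m q.2) (lam, x).
Proof. by move=> Ll Dx; apply: (C1_differentiable (N_C1 m)). Qed.

(** [gf m] is the component of dS - x dy along the parameter; adding Phi or N carried to (I, theta)
    gives [Phi_hat m], the form e of the overview, and [N_hat m], which will turn out to be the mean
    form. *)
Let gf m := generating_form (curry2 X) (curry2 Shat) (em m).
Let Phi_hat m (q : param * plane) := Phi q.1 m (curry2 X q) + gf m q.
Let N_hat m (q : param * plane) := N q.1 m (curry2 X q) + gf m q.

Lemma derivable_gf m v q : O q -> derivable (gf m) q v.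
Proof. by move=> Oq; have [] := is_derive_generating_form v (em m) smooth_X smooth_Shat Oq. Qed.

Lemma is_derive_form_hat (A : param -> 'I_n -> plane -> R) m v lam p :
  L lam -> 0 < p.1 < action_max D ->
  differentiable (fun q => A q.1 m q.2) (lam, X lam p) ->
  is_derive (lam, p) v (fun q => A q.1 m (curry2 X q) + gf m q)
   ('D_(v.1) (fun l => A l m (X lam p)) lam
     + (('D_v (curry2 X) (lam, p)).1 * dx (A lam m) (X lam p)
        + ('D_v (curry2 X) (lam, p)).2 * dy (A lam m) (X lam p))
     + 'D_v (gf m) (lam, p)).
Proof.
move=> Ll hp dA; apply: is_deriveD; last first.
  by apply: derivableP; apply: derivable_gf.
exact: (is_derive_transport v (differentiable_curryX Ll hp) dA).
Qed.

(** The theta-component of dS - x dy is 0 on an open set, so the theta-derivative of [gf m] is just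
    the value of -dx /\ dy on the directions theta and Lambda_m. As the latter moves X by the
    rotated gradient of Phi, that value is minus the theta-derivative of Phi along the
    streamline. *)
Lemma derive_theta_Phi_hat m lam p : L lam -> 0 < p.1 < action_max D ->
  is_derive (lam, p) et (Phi_hat m) 0.
Proof.
move=> Ll hp; have Oq : O (lam, p) by [].
have [d e] := is_derive_form_hat et Ll hp (differentiable_Phi m Ll (X_domain Ll hp).1).
apply: DeriveDef; first exact: d.
apply: (etrans e); rewrite derive0 add0r.
have E : \forall q \near (lam, p), generating_form (curry2 X) (curry2 Shat) et q = cst 0 q.
  have := open_nbhs_nbhs (conj open_action_angle_family Oq).
  by apply: filterS => q; exact: generating_form_theta.
have D0 := near_eq_derive (em m) E.
rewrite derive_cst in D0.
have C := generating_form_closed et (em m) open_action_angle_family smooth_X smooth_Shat Oq.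
have gm := etrans (esym (etrans (congr1 (fun z => 'D_et (gf m) (lam, p) - z) D0) (subr0 _))) C.
have A (a b xm ym xt yt c : R) : xm = - b -> ym = a -> c = xm * yt - xt * ym ->
  xt * a + yt * b + c = 0 by move=> -> -> ->; ring.
have Dp := derive_param_X m Ll hp.
exact (A _ _ _ _ _ _ _ (congr1 fst Dp) (congr1 snd Dp) gm).
Qed.

Lemma is_derive_theta (f : param * plane -> R) lam J th df :
  is_derive (lam, (J, th)) et f df ->
  is_derive th (1 : R) (fun t => f (lam, (J, t))) df.
Proof.
move=> [d e].
have E h : f (lam, (J, h *: (1 : R) + th)) = f (h *: et + (lam, (J, th))).
  congr f; rewrite [RHS]surjective_pairing /= scaler0 add0r; congr (_, _).
  by rewrite [RHS]surjective_pairing /= scaler0 add0r.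
apply: DeriveDef; first exact: derivable_eq_along E d.
by rewrite -e; exact: derive_eq_along E.
Qed.

Lemma Phi_hat_cst m lam J th th' : L lam -> 0 < J < action_max D ->
  Phi_hat m (lam, (J, th)) = Phi_hat m (lam, (J, th')).
Proof.
move=> Ll hJ; apply: (@is_derive_0_is_cst R (fun t => Phi_hat m (lam, (J, t)))) => t.
exact/is_derive_theta/derive_theta_Phi_hat.
Qed.

Lemma continuous_on_streamline (A : param -> 'I_n -> plane -> R) m lam J th :
  (forall x, D lam x -> differentiable (fun q => A q.1 m q.2) (lam, x)) ->
  L lam -> 0 < J < action_max D -> {for X lam (J, th), continuous (A lam m)}.
Proof.
move=> dA Ll hJ; have dx := dA _ (X_domain (p := (J, th)) Ll hJ).1.
exact: differentiable_continuous (differentiable_snd_line dx).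
Qed.

(** Streamline averages become means over the angle, so on a streamline N and Phi differ by a
    quantity free of theta. *)
Lemma natural_form_X m lam J th : L lam -> 0 < J < action_max D ->
  N lam m (X lam (J, th)) = Phi lam m (X lam (J, th))
    + (angle_mean (fun th => Psi lam m (X lam (J, th)))
       - angle_mean (fun th => Phi lam m (X lam (J, th)))).
Proof.
move=> Ll hJ.
have cP t : {for X lam (J, t), continuous (Phi lam m)}.
  by apply: continuous_on_streamline => // x; exact: differentiable_Phi.
have cQ t : {for X lam (J, t), continuous (Psi lam m)}.
  by apply: continuous_on_streamline => // x; exact: differentiable_Psi.
have A (a b c d e : R) : d = b -> e = c -> a - d + e = a + (c - b) by move=> -> ->; ring.
exact: (A _ _ _ _ _ (average_X th Ll hJ cP) (average_X th Ll hJ cQ)).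
Qed.

Lemma dpar_Shat m lam p : dpar (Shat ^~ p) m lam = 'D_(em m) (curry2 Shat) (lam, p).
Proof. exact: (derive_fst (curry2 Shat)). Qed.

Lemma dpar_Y m lam p : L lam -> 0 < p.1 < action_max D ->
  dpar (fun l => (X l p).2) m lam = ('D_(em m) (curry2 X) (lam, p)).2.
Proof.
move=> Ll hp.
have d := diff_derivable (v := delta_mx 0 m) (differentiable_fst_line (differentiable_curryX Ll hp)).
have [_ e] := is_derive_component2 d.
exact (etrans e (congr1 snd (derive_fst (curry2 X) lam p (delta_mx 0 m)))).
Qed.

(** The integrand is Psi - Phi plus [Phi_hat], and the last is constant in the angle. Its mean is
    thus <Psi> - <Phi> plus [Phi_hat] at any chosen angle, which [natural_form_X] recognizes as
    [N_hat] there. *)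
Lemma mean_angle_form_X m lam J th : L lam -> 0 < J < action_max D ->
  mean_angle_form Psi X Shat J lam m = N_hat m (lam, (J, th)).
Proof.
move=> Ll hJ; have hp t : 0 < ((J, t) : plane).1 < action_max D by [].
have E t : Psi lam m (X lam (J, t)) + dpar (Shat ^~ (J, t)) m lam
    - (X lam (J, t)).1 * dpar (fun l => (X l (J, t)).2) m lam
  = Psi lam m (X lam (J, t)) + (Phi_hat m (lam, (J, th)) - Phi lam m (X lam (J, t))).
  have gE : gf m (lam, (J, t)) = dpar (Shat ^~ (J, t)) m lam
      - (X lam (J, t)).1 * dpar (fun l => (X l (J, t)).2) m lam.
    by rewrite dpar_Shat (dpar_Y m Ll (hp t)).
  have PE : Phi_hat m (lam, (J, th)) = Phi lam m (X lam (J, t)) + gf m (lam, (J, t)).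
    exact: Phi_hat_cst.
  rewrite PE gE.
  have A (a b c d : R) : a + b - c = a + (d + (b - c) - d) by ring.
  exact: A.
rewrite /mean_angle_form.
have -> : (fun t => Psi lam m (X lam (J, t)) + dpar (Shat ^~ (J, t)) m lam
    - (X lam (J, t)).1 * dpar (fun l => (X l (J, t)).2) m lam)
  = (fun t => Psi lam m (X lam (J, t)) + (Phi_hat m (lam, (J, th)) - Phi lam m (X lam (J, t)))).
  exact/funext.
have cX : continuous (fun t => X lam (J, t)).
  move=> t; apply: differentiable_continuous.
  exact: differentiable_snd_line (differentiable_X Ll (hp t)).
rewrite angle_mean_affine; last 2 first.
- move=> t; apply: (@continuous_comp _ _ _ (fun t => X lam (J, t)) (Psi lam m)); first exact: cX.
  by apply: continuous_on_streamline => // x; exact: differentiable_Psi.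
- move=> t; apply: (@continuous_comp _ _ _ (fun t => X lam (J, t)) (Phi lam m)); first exact: cX.
  by apply: continuous_on_streamline => // x; exact: differentiable_Phi.
rewrite /N_hat /= /curry2 /= natural_form_X // /Phi_hat /curry2 /=.
by ring.
Qed.

Lemma N_hat_C1 m : C1 O (N_hat m).
Proof.
apply: C1_add; first exact: open_action_angle_family.
  have CX := smooth_C1 finite_basis_family open_action_angle_family smooth_X.
  have CP := C1_pair open_action_angle_family (C1_fst (U := O)) CX.
  apply: (C1_comp CP (N_C1 m)) open_action_angle_family => -[lam p] [/= Ll hp].
  by split => //=; exact: (X_domain Ll hp).1.
exact: C1_generating_form finite_basis_family open_action_angle_family smooth_X smooth_Shat.
Qed.

Lemma derive_theta_N_hat m lam p : L lam -> 0 < p.1 < action_max D ->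
  'D_et (N_hat m) (lam, p) = 0.
Proof.
case: p => J th Ll hp.
have d : is_derive (lam, (J, th)) et (N_hat m) ('D_et (N_hat m) (lam, (J, th))).
  apply/derivableP/diff_derivable; apply: (C1_differentiable (N_hat_C1 m)).
  by split.
have [_ <-] := is_derive_theta d.
have -> : (fun t => N_hat m (lam, (J, t))) = cst (N_hat m (lam, (J, th))).
  by apply/funext => t; rewrite -(mean_angle_form_X m t Ll hp) (mean_angle_form_X m th Ll hp).
exact: derive_cst.
Qed.

(* N - Phi is constant along the streamlines. *)
Lemma derive_theta_difference m lam p : L lam -> 0 < p.1 < action_max D ->
  (nperp (I lam) (X lam p)).1 * (dx (N lam m) (X lam p) - dx (Phi lam m) (X lam p))
  + (nperp (I lam) (X lam p)).2 * (dy (N lam m) (X lam p) - dy (Phi lam m) (X lam p)) = 0.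
Proof.
move=> Ll hp; have [Dx _] := X_domain Ll hp.
have [_ e1] := is_derive_form_hat et Ll hp (differentiable_N m Ll Dx).
have [_ e2] := is_derive_form_hat et Ll hp (differentiable_Phi m Ll Dx).
have [_ f2] := derive_theta_Phi_hat m Ll hp.
have f1 := derive_theta_N_hat m Ll hp.
have [w _] := derive_theta_X Ll hp.
have g1 := etrans (esym e1) f1; have g2 := etrans (esym e2) f2.
rewrite w !derive0 !add0r in g1 g2.
have A (w1 w2 a b c d z : R) : w1 * a + w2 * b + z = 0 -> w1 * c + w2 * d + z = 0 ->
  w1 * (a - c) + w2 * (b - d) = 0.
  move=> h1 h2.
  have -> : w1 * (a - c) + w2 * (b - d) = (w1 * a + w2 * b + z) - (w1 * c + w2 * d + z) by ring.
  by rewrite h1 h2 subrr.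
exact: A g1 g2.
Qed.

Lemma curvature_X m k lam p : L lam -> 0 < p.1 < action_max D ->
  curvature N lam m k (X lam p) = 'D_(em m) (N_hat k) (lam, p) - 'D_(em k) (N_hat m) (lam, p).
Proof.
move=> Ll hp; have Oq : O (lam, p) by [].
have [Dx _] := X_domain Ll hp.
have [_ ek] := is_derive_form_hat (em m) Ll hp (differentiable_N k Ll Dx).
have [_ ekm] := is_derive_form_hat (em k) Ll hp (differentiable_N m Ll Dx).
apply: (etrans _ (esym (congr2 (fun a b => a - b) ek ekm))).
have C := generating_form_closed (em m) (em k) open_action_angle_family smooth_X smooth_Shat Oq.
rewrite (derive_param_X m Ll hp) (derive_param_X k Ll hp) in C *.
have [_ g0] := derive_theta_X Ll hp.
have n0 : ((nperp (I lam) (X lam p)).1, (nperp (I lam) (X lam p)).2) != 0.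
  by rewrite -surjective_pairing -enorm_eq0 enorm_nperp enorm_eq0.
have h := orthogonal_cross (derive_theta_difference m Ll hp) (derive_theta_difference k Ll hp) n0.
exact: (curvature_algebra _ _ h C).
Qed.

(** The mean form without its integral, for actions in the open range: differentiability in the
    parameter and the action is inherited from [N_hat]. The angle 0 is an arbitrary choice. *)
Definition mean_form J lam m := N_hat m (lam, (J, 0)).

Lemma curvature_mean_form m k lam J th : L lam -> 0 < J < action_max D ->
  curvature N lam m k (X lam (J, th))
  = dpar (mean_form J ^~ k) m lam - dpar (mean_form J ^~ m) k lam.
Proof.
move=> Ll hJ.
have E k' : \forall l \near lam, N_hat k' (l, (J, th)) = mean_form J l k'.
  have nL : \forall l \near lam, L l by exact: open_nbhs_nbhs.
  apply: filterS nL => l Ll'.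
  by rewrite /mean_form -(mean_angle_form_X k' th Ll' hJ) (mean_angle_form_X k' 0 Ll' hJ).
have D1 m' k' : 'D_(em m') (N_hat k') (lam, (J, th)) = dpar (mean_form J ^~ k') m' lam.
  by apply: (etrans (esym (derive_fst (N_hat k') lam _ _))); exact: near_eq_derive (E k').
apply: (etrans (curvature_X m k Ll (p := (J, th)) hJ)).
exact (congr2 (fun a b => a - b) (D1 m k) (D1 k m)).
Qed.

Lemma C1_mean_form J m : 0 < J < action_max D -> C1 L (mean_form J ^~ m).
Proof.
move=> hJ; have CP := C1_pair hL (C1_id (U := L)) (C1_cst (U := L) ((J, 0) : plane)).
exact: (C1_comp CP (N_hat_C1 m) (fun l Ll => conj Ll hJ) hL).
Qed.

(** The witness for kappa: the curvature at any point of action J. The default point 0 is reached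
    only when J is not the action of a point of the domain. *)
Definition action_curvature lam m k J :=
  curvature N lam m k (xget 0 [set x | D lam x /\ I lam x = J]).

(** Regular points have positive action and the critical point has action 0, so the mixed cases are
    void; two critical points coincide, and at two regular points both curvatures are the exterior
    derivative of the same mean form. *)
Lemma curvature_level m k lam x y : L lam -> D lam x -> D lam y -> I lam x = I lam y ->
  curvature N lam m k x = curvature N lam m k y.
Proof.
move=> Ll Dx Dy Ixy.
have [gx|gx] := eqVneq (grad (psi lam) x) 0; have [gy|gy] := eqVneq (grad (psi lam) y) 0.
- by rewrite (unique_critical Ll Dx Dy gx gy).
- have [h _] := X_surjective Ll (conj Dy gy).
  have I0 := etrans (esym Ixy) (action_critical_point Ll Dx gx).
  by case: (zero_not_positive I0 h).
- have [h _] := X_surjective Ll (conj Dx gx).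
  have I0 := etrans Ixy (action_critical_point Ll Dy gy).
  by case: (zero_not_positive I0 h).
have [hx [t xt]] := X_surjective Ll (conj Dx gx).
have [hy [t' yt]] := X_surjective Ll (conj Dy gy).
have ex := curvature_mean_form m k t Ll hx.
have ey := curvature_mean_form m k t' Ll hy.
rewrite xt in ex; rewrite yt in ey.
apply: (etrans ex); apply: (etrans _ (esym ey)).
exact: (congr1 (fun J => dpar (mean_form J ^~ k) m lam - dpar (mean_form J ^~ m) k lam) Ixy).
Qed.

Lemma curvature_action m k lam x : L lam -> D lam x ->
  curvature N lam m k x = action_curvature lam m k (I lam x).
Proof.
move=> Ll Dx.
have [Dy Iy] := @xgetPex _ 0 [set y | D lam y /\ I lam y = I lam x] (ex_intro _ x (conj Dx erefl)).
exact: curvature_level Ll Dx Dy (esym Iy).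
Qed.

Lemma action_curvature_mean_form m k lam J : L lam -> 0 < J < action_max D ->
  action_curvature lam m k J = dpar (mean_form J ^~ k) m lam - dpar (mean_form J ^~ m) k lam.
Proof.
move=> Ll hJ; have [Dx Ix] := X_domain (p := (J, 0)) Ll hJ.
rewrite /= in Ix; rewrite -{1}Ix -(curvature_action m k Ll Dx).
exact: curvature_mean_form.
Qed.

Lemma geo_stokes k (C : 'I_k -> R -> param) p (S : 'I_p -> R * R -> param) J :
  closed_curve L C -> surface L S -> bounds C S -> 0 < J < action_max D ->
  curve_integral C (mean_angle_form Psi X Shat J) = curve_integral C (mean_form J) /\
  curve_integral C (mean_angle_form Psi X Shat J) =
    surface_integral S (fun lam m j => action_curvature lam m j J).
Proof.
move=> hC hS' hb hJ.
have e1 : curve_integral C (mean_angle_form Psi X Shat J) = curve_integral C (mean_form J).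
  apply: eq_bigr => i _; apply: eq_Rintegral => t; rewrite inE /= in_itv /= => t01.
  have [_ LC _] := hC i; apply: eq_bigr => m _; congr (_ * _).
  exact: mean_angle_form_X (LC t t01) hJ.
split=> //; apply: (etrans e1).
apply: (etrans (stokes hL (fun m => C1_mean_form m hJ) hC hS' hb)).
apply: eq_bigr => i _; apply: eq_Rintegral => s; rewrite inE /= in_itv /= => s01.
apply: eq_Rintegral => t; rewrite inE /= in_itv /= => t01.
have [_ LS] := hS' i; have Ls := LS (s, t) (conj s01 t01).
apply: eq_bigr => m _; apply: eq_bigr => j _; congr (_ * _ * _).
exact: (esym (action_curvature_mean_form m j Ls hJ)).
Qed.

(** In terms of [mean_form] the integrand is C1 jointly in the action and the time along each arc,
    so differentiation passes under the integral. *)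
Lemma derivable_curve_integral k (C : 'I_k -> R -> param) J :
  closed_curve L C -> 0 < J < action_max D ->
  derivable (fun J => curve_integral C (mean_form J)) J 1.
Proof.
move=> hC hJ.
pose l i J := \int[lebesgue_measure]_(t in `[0, 1])
    \sum_(m < n) mean_form J (C i t) m * ('D_1 (C i) t) 0 m.
have -> : (fun J => curve_integral C (mean_form J)) = \sum_(i < k) (l i).
  by apply/funext => y; rewrite fct_sumE.
apply: derivable_sum => i.
have [[U [oU sU CU]] LC _] := hC i.
have CC : C1 U (C i) by apply: smooth_C1 => //; exact: finite_basis_R.
have CD : C1 U ('D_1 (C i)).
  by apply: smooth_C1; [exact: finite_basis_R|exact: oU|exact: smooth_derive].
pose V := [set q : R * R | 0 < q.1 < action_max D /\ (U q.2 /\ L (C i q.2))].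
have oV : open V.
  rewrite openE => -[K t] [/= hK [Ut Lt]].
  have K1 : K \in `]0, action_max D[ by rewrite in_itv.
  have nL : nbhs t (C i @^-1` L).
    by apply: (C1_continuous CC Ut); exact: open_nbhs_nbhs.
  exists ([set y | 0 < y < action_max D], U `&` C i @^-1` L); last by move=> [a b] [].
  split; last by apply: filterI => //; exact: open_nbhs_nbhs.
  by apply: filterS (near_in_itvoo K1) => y; rewrite in_itv.
have C2 : C1 V snd by exact: C1_snd.
have C2U q : V q -> U q.2 by move=> [_ []].
have CCV : C1 V (fun q => C i q.2) := C1_comp C2 CC C2U oV.
have CJ : C1 V (fun q : R * R => (q.1, 0 : R)).
  by apply: C1_pair; [exact: oV|exact: C1_fst|exact: C1_cst].
have CQ := C1_pair oV CCV CJ.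
pose f (q : R * R) := \sum_(m < n) mean_form q.1 (C i q.2) m * ('D_1 (C i) q.2) 0 m.
have Cf : C1 V f.
  apply: C1_sum; first exact: oV.
  move=> m; apply: C1_mul; first exact: oV.
    by apply: (C1_comp CQ (N_hat_C1 m)) oV => q [h [_ h']]; split.
  exact: (C1_comp (C1_comp C2 CD C2U oV) (C1_coord (U := setT) m) (fun _ _ => Logic.I) oV).
have [J0 J1] := andP hJ.
(* Midpoints between J and the ends of the range of actions: the closed interval between them
   contains J inside and stays within the open range. *)
pose a := J / 2; pose b := (J + action_max D) / 2.
have aJb : a < J < b by rewrite /a /b; apply/andP; split; lra.
have sV s t : a <= s <= b -> 0 <= t <= 1 -> V (s, t).
  move=> /andP[s1 s2] t01; split; last by split; [exact: sU|exact: LC].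
  by move: s1 s2; rewrite /a /b /= => s1 s2; apply/andP; split; lra.
have H1 s t : a <= s <= b -> 0 <= t <= 1 -> {for (s, t), continuous f}.
  by move=> hs ht; exact: C1_continuous Cf (sV _ _ hs ht).
have H2 s t : a <= s <= b -> 0 <= t <= 1 -> {for (s, t), continuous (dx f)}.
  by move=> hs ht; exact: C1_cont Cf (sV _ _ hs ht).
have H3 s t : a <= s <= b -> 0 <= t <= 1 -> is_derive s (1 : R) (fun s => f (s, t)) (dx f (s, t)).
  move=> hs ht; have df := C1_differentiable Cf (sV _ _ hs ht).
  apply: DeriveDef; last exact: derive_fst.
  exact/diff_derivable/differentiable_fst_line.
by have [] := Leibniz_rule H1 H2 H3 aJb.
Qed.

(** Stokes' theorem holds at every action of the open range, so angle integral and flux agree on a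
    neighbourhood of J; differentiability and derivative pass from one to the other. *)
Lemma geometric_angle k (C : 'I_k -> R -> param) p (S : 'I_p -> R * R -> param) :
  closed_curve L C -> surface L S -> bounds C S ->
  let geo J := curve_integral C (mean_angle_form Psi X Shat J) in
  let flux J := surface_integral S (fun lam m j => action_curvature lam m j J) in
  forall J : R, 0 < J < action_max D ->
    [/\ derivable geo J 1, derivable flux J 1 & derive1 geo J = derive1 flux J].
Proof.
move=> hC hS' hb geo flux J hJ.
have J1 : J \in `]0, action_max D[ by rewrite in_itv.
have E (f h : R -> R) : (forall K, 0 < K < action_max D -> f K = h K) -> \forall K \near J, f K = h K.
  by move=> fh; apply: filterS (near_in_itvoo J1) => K; rewrite in_itv; exact: fh.
have E1 : \forall K \near J, curve_integral C (mean_form K) = geo K.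
  by apply: E => K hK; have [e _] := geo_stokes hC hS' hb hK; exact: esym e.
have E2 : \forall K \near J, geo K = flux K.
  by apply: E => K hK; have [_ e] := geo_stokes hC hS' hb hK.
have d1 : derivable geo J 1 by exact: near_eq_derivable E1 (derivable_curve_integral hC hJ).
split; first exact: d1.
  exact: near_eq_derivable E2 d1.
by rewrite !derive1E; exact: near_eq_derive.
Qed.

End Family.

Unset Implicit Arguments.

Theorem mainTheorem2 (R : realType) (n : nat) (L : set 'rV[R]_n)
  (D : 'rV[R]_n -> set (R * R)) (B psi : 'rV[R]_n -> R * R -> R)
  (G F : 'rV[R]_n -> R -> R) (g ginv : 'rV[R]_n -> R * R -> R * R)
  (Phi beta Psi : 'rV[R]_n -> 'I_n -> R * R -> R)
  (X : 'rV[R]_n -> R * R -> R * R) (Shat : 'rV[R]_n -> R * R -> R)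
  (hL : open L) (hL0 : L 0)
  (hD : domain_family L D B)
  (hpsi : steady_family L D psi G F)
  (hg : diffeo_family L D g ginv)
  (hvort : vorticity_transported L D psi ginv)
  (hH1 : forall lam, L lam -> elliptic_stable (D lam) (psi lam) (G lam))
  (hH2 : forall lam, L lam -> bounded_periods (D lam) (psi lam))
  (hPhi : generator_form L D g Phi)
  (hbeta : boundary_form L D B beta)
  (hPhibeta : forall lam m x, L lam -> boundary (D lam) x ->
     Phi lam m x = beta lam m x)
  (hPsi : first_order_form L D psi F Phi beta Psi)
  (hsmooth : smooth_on (family_set L D)
     (fun p => \row_m natural_form D psi Phi Psi p.1 m p.2))
  (hX : action_angle L D psi g X)
  (hS : generating_function L D X Shat) :
  exists kappa : 'rV[R]_n -> 'I_n -> 'I_n -> R -> R,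
    (forall lam m k x, L lam -> D lam x ->
       curvature (natural_form D psi Phi Psi) lam m k x
       = kappa lam m k (action (D lam) (psi lam) x)) /\
    (forall (k : nat) (C : 'I_k -> R -> 'rV[R]_n)
            (p : nat) (S : 'I_p -> R * R -> 'rV[R]_n),
       closed_curve L C -> surface L S -> bounds C S ->
       let geo J := curve_integral C (mean_angle_form Psi X Shat J) in
       let flux J := surface_integral S (fun lam m j => kappa lam m j J) in
       forall I : R, 0 < I < action_max D ->
         [/\ derivable geo I 1, derivable flux I 1
           & derive1 geo I = derive1 flux I]).
Proof.
exists (action_curvature D psi Phi Psi); split=> [lam m k x Ll Dx|k C p S hC hS' hb].
  exact (curvature_action hL hL0 hD hpsi hg hH1 hPhi hPsi hsmooth hX hS m k Ll Dx).
exact (geometric_angle hL hL0 hD hpsi hg hH1 hPhi hPsi hsmooth hX hS hC hS' hb).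
Qed.
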